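(* Let $X$ be a real separable Banach space, and assume: (1) $Q:X^*\to X$ is linear, bounded, symmetric ($\langle Qx^*,y^*\rangle=\langle Qy^*,x^*\rangle$) and nonnegative ($\langle Qx^*,x^*\rangle\ge 0$), and $A:D(A)\subseteq X\to X$ generates a strongly continuous contraction semigroup $(e^{tA})_{t\ge0}$ on $X$; (2) for every $t>0$ the operator $Q_t:=\int_0^t e^{sA}Qe^{sA^*}\,ds$ is the covariance operator of a centred Gaussian measure on $X$; for every $x^*\in X^*$ the weak limit $Q_\infty x^*:=\lim_{t\to+\infty}Q_tx^*$ exists, and $Q_\infty$ is the covariance operator of a centred nondegenerate Gaussian measure $\mu_\infty$ on $X$; (3) for every $x^*\in D(A^* )$ one has $Q_\infty A^*x^*\in H$, and there is $c>0$ with $|Q_\infty A^*x^*|_H\le c\,|i^*x^*|_H$ for all $x^*\in D(A^* )$; (4) $U$ is a proper, $\|\cdot\|_X$-lower semicontinuous convex function on $X$ belonging to $W^{1,p}_H(X,\mu_\infty)$ for every $p\in[1,+\infty)$; set $\nu_\infty:=e^{-U}\mu_\infty$. Let $L_2$ be the perturbed Ornstein–Uhlenbeck operator in $L^2(X,\nu_\infty)$. Then $\mathscr{FC}_b^{2,1}(X)\subset D(L_2)$, and for every $u\in\mathscr{FC}_b^{2,1}(X)$ $$L_2u(x)=\tfrac12\mathrm{Tr}[D_H^2u(x)]_H+\langle x,A^*Du(x)\rangle_{X\times X^*}+[BD_Hu(x),D_HU(x)]_H\qquad\text{for }\nu_\infty\text{-a.e. }x\in X.$$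
   Context: $H$ is the Reproducing Kernel Hilbert Space of $Q$: the completion of $QX^*$ under $[Qx^*,Qy^*]_H:=\langle Qx^*,y^*\rangle_{X\times X^*}$, continuously embedded in $X$ by $i:H\to X$; $i^*:X^*\to H$ is the adjoint (with $H^*\cong H$), and $Q=i\circ i^*$. By (3) and the density of $i^*D(A^* )$ in $H$ there is a unique $B\in\mathcal L(H)$ with $Bi^*x^*=Q_\infty A^*x^*$ for all $x^*\in D(A^* )$; it is known that $B+B^*=-\mathrm{Id}_H$. $\mathscr{FC}_b^{k}(X)$ is the set of functions $f(x)=\varphi(\langle x,x_1^*\rangle,\dots,\langle x,x_n^*\rangle)$ with $n\in\mathbb N$, $\varphi\in C_b^k(\mathbb R^n)$ (bounded and continuous with bounded continuous derivatives up to order $k$), $x_j^*\in X^*$; $\mathscr{FC}_b^{k,1}(X)$ is the subset of those for which one can take $x_1^*,\dots,x_n^*\in D(A^* )$. For $f\in\mathscr{FC}_b^1(X)$, $D_Hf(x):=i^*Df(x)=\sum_{j}\frac{\partial\varphi}{\partial\xi_j}(\langle x,x_1^*\rangle,\dots,\langle x,x_n^*\rangle)\,i^*x_j^*$. For $f\in\mathscr{FC}_b^{2,1}(X)$, $D_H^2f(x):=\sum_{j,k=1}^n\frac{\partial^2\varphi}{\partial\xi_j\partial\xi_k}(\langle x,x_1^*\rangle,\dots,\langle x,x_n^*\rangle)\,Qx_j^*\otimes Qx_k^*$ (with $Qx_j^*$ regarded as an element of $H$), so that $\mathrm{Tr}[D_H^2f(x)]_H=\sum_{j,k=1}^n\langle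 Qx_j^*,x_k^*\rangle_{X\times X^*}\frac{\partial^2\varphi}{\partial\xi_j\partial\xi_k}(\langle x,x_1^*\rangle,\dots,\langle x,x_n^*\rangle)$; and $A^*Df(x)=\sum_j\frac{\partial\varphi}{\partial\xi_j}(\langle x,x_1^*\rangle,\dots,\langle x,x_n^*\rangle)A^*x_j^*$. Under (1)–(3), $D_H$ is known to be closable in $L^p(X,\mu_\infty)$; $W^{1,p}_H(X,\mu_\infty)$ is the domain of the closure (still denoted $D_H$; this defines $D_HU$). Under (1)–(4), $e^{-U}\in W^{1,p}_H(X,\mu_\infty)$ for all $p\in[1,+\infty)$, so $\nu_\infty$ is a finite measure, and $D_H:\mathscr{FC}_b^1(X)\to L^p(X,\nu_\infty;H)$ is closable in $L^p(X,\nu_\infty)$ for $p\in(1,+\infty)$; $W^{1,p}_H(X,\nu_\infty)$ is the domain of its closure (still denoted $D_H$). The form $\mathcal E(u,v):=-\int_X[BD_Hu,D_Hv]_H\,d\nu_\infty$ with domain $W^{1,2}_H(X,\nu_\infty)$ is a (nonsymmetric) coercive closed form on $L^2(X,\nu_\infty)$. The associated operator $L_2$ has domain the set of $u\in W^{1,2}_H(X,\nu_\infty)$ for which there is $g\in L^2(X,\nu_\infty)$ with $\mathcal E(u,v)=-\int_X g v\,d\nu_\infty$ for all $v\in\mathscr{FC}_b^1(X)$, and $L_2u:=g$. *)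

(* Defs.v *)
From HB Require Import structures.
From mathcomp Require Import all_boot all_order all_algebra.
From mathcomp Require Import sesquilinear.
From mathcomp Require Import all_classical all_reals all_analysis.
From mathcomp Require Import measurable_realfun.

Set Implicit Arguments.
Unset Strict Implicit.
Unset Printing Implicit Defensive.

Import Order.TTheory GRing.Theory Num.Theory.
Import numFieldNormedType.Exports.

Local Open Scope classical_set_scope.
Local Open Scope ring_scope.

(** ** The topological dual of a real normed space *)

Definition dual_pred (R : realType) (X : normedModType R) : {pred X -> R^o} :=
  fun f => `[< linear f /\ continuous f >].

Lemma dual_submod_closed (R : realType) (X : normedModType R) :
  submod_closed (@dual_pred R X).
Proof.
split.
  apply/asboolP; split; last by move=> x; exact: cvg_cst.
  by move=> a u v; rewrite /= scaler0 addr0.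
move=> a f g /asboolP[lf cf] /asboolP[lg cg]; apply/asboolP; split.
  by move=> b u v; rewrite !fctE lf lg !scalerDr !scalerA mulrC addrACA.
move=> x; apply: cvgD; last exact: cg.
by apply: cvgZr; exact: cf.
Qed.

HB.instance Definition _ (R : realType) (X : normedModType R) :=
  GRing.isSubmodClosed.Build R _ (@dual_pred R X) (@dual_submod_closed R X).

Record dual (R : realType) (X : normedModType R) :=
  Dual { dual_fun :> X -> R^o ; _ : dual_fun \in @dual_pred R X }.

HB.instance Definition _ (R : realType) (X : normedModType R) :=
  [isSub for @dual_fun R X].
HB.instance Definition _ (R : realType) (X : normedModType R) :=
  [Choice of dual X by <:].
HB.instance Definition _ (R : realType) (X : normedModType R) :=
  [SubChoice_isSubLmodule of dual X by <:].

Definition dual_norm (R : realType) (X : normedModType R) (xs : dual X) : R :=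
  sup [set `|xs x| | x in [set x : X | `|x| <= 1]].

Definition dual_bounded (R : realType) (X : normedModType R) (Q : dual X -> X) :=
  exists M : R, forall xs, `|Q xs| <= M * dual_norm xs.

(** ** Unbounded operators and their adjoints.  An operator [T : D -> X] is given
    by its domain [D] and a function whose values outside [D] are irrelevant. *)

Section Operators.
Context {R : realType} {X : normedModType R}.
Implicit Types (D : set X) (T : X -> X) (xs ys : dual X).

Definition is_adjoint D T xs ys := forall x, D x -> xs (T x) = ys x.

Definition adj_dom D T : set (dual X) :=
  [set xs | exists ys, is_adjoint D T xs ys].

(** Single-valued as soon as [D] is dense; the default value [0] is only taken
    outside [adj_dom D T]. *)
Definition adj D T xs : dual X := xget 0 [set ys | is_adjoint D T xs ys].

End Operators.

(** ** Strongly continuous contraction semigroups *)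

Section Semigroups.
Context {R : realType} {X : normedModType R}.

Record contraction_semigroup (S : R -> {linear X -> X}) : Prop := {
  semigroup0 : forall x, S 0 x = x ;
  semigroupD : forall s t, 0 <= s -> 0 <= t ->
    forall x, S (s + t) x = S s (S t x) ;
  semigroup_contraction : forall t, 0 <= t -> forall x, `|S t x| <= `|x| ;
  semigroup_continuous : forall x, S t x @[t --> 0^'+] --> x }.

Definition is_generator (S : R -> {linear X -> X}) (DA : set X) (A : X -> X) :=
  forall x,
  (DA x <-> cvg ((h^-1 *: (S h x - x)) @[h --> 0^'+])) /\
  (DA x -> (h^-1 *: (S h x - x)) @[h --> 0^'+] --> A x).

End Semigroups.

(** ** Gaussian measures on a Banach space *)

Definition borel (T : ptopologicalType) := g_sigma_algebraType (@open T).

Section Gaussian.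
Context {R : realType} {X : completeNormedModType R}.
Implicit Types (gamma : probability (borel X) R) (C : dual X -> X).

Definition is_weak_integral (a b : R) (f : R -> X) (v : X) :=
  forall ys : dual X,
  lebesgue_measure.-integrable `[a, b] (fun s => (ys (f s))%:E) /\
  ys v = \int[lebesgue_measure]_(s in `[a, b]) (ys (f s)).

(** The library's [normal_prob 0 0] is not the Dirac mass at [0]. *)
Definition centred_normal (s : R) (V : set R) : \bar R :=
  if s == 0 then \d_(0 : R) V else normal_prob 0 s V.

Definition centred_gaussian gamma :=
  forall xs : dual X, exists2 s : R, 0 <= s &
  forall V : set R, measurable V -> gamma (xs @^-1` V) = centred_normal s V.

Definition covariance_operator gamma C :=
  forall xs ys : dual X, ys (C xs) = \int[gamma]_x (xs x * ys x).

Definition nondegenerate_covariance C :=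
  forall xs : dual X, xs != 0 -> 0 < xs (C xs).

End Gaussian.

(** ** Hilbert spaces: a complete normed module whose norm comes from a scalar
    product [ip : {dot H for idfun}] *)

Section Hilbert.
Context {R : realType} {H : completeNormedModType R} (ip : {dot H for idfun}).

Definition hilbert_norm := forall h : H, `|h| ^+ 2 = ip h h.

(** Orthonormal bases of a separable Hilbert space as sequences; zero vectors are
    allowed so that finite-dimensional spaces are covered too. *)
Definition orthonormal_basis (e : nat -> H) :=
  [/\ forall j, ip (e j) (e j) = 1 \/ e j = 0,
      forall j k, j <> k -> ip (e j) (e k) = 0 &
      forall h, (forall j, ip h (e j) = 0) -> h = 0].

Definition trace (T : H -> H) : R :=
  xget 0 [set t | forall e, orthonormal_basis e ->
    series (fun k => ip (T (e k)) (e k)) @ \oo --> t].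

Definition tensor (a b : H) : H -> H := fun h => ip a h *: b.

End Hilbert.

(** [(H, ip)] with [i : H -> X] is the completion of [Q X^*] under
    [[Q x^*, Q y^*] = <Q x^*, y^*>], and [istar] is the adjoint of [i] (with [H]
    identified with its dual).  [istar x^*] is [Q x^*] seen as an element of [H]. *)
Record is_RKHS (R : realType) (X H : completeNormedModType R) (Q : dual X -> X)
    (ip : {dot H for idfun}) (i : {linear H -> X}) (istar : dual X -> H) : Prop := {
  RKHS_norm : hilbert_norm ip ;
  RKHS_continuous : continuous i ;
  RKHS_injective : injective i ;
  RKHS_adjoint : forall xs h, ip (istar xs) h = xs (i h) ;
  RKHS_factor : forall xs, i (istar xs) = Q xs ;
  RKHS_product : forall xs ys, ip (istar xs) (istar ys) = ys (Q xs) ;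
  RKHS_dense : dense (range istar) }.

(** ** Smooth cylindrical functions *)

Section PartialDerivatives.
Context {R : realType} {n : nat}.
Implicit Types phi : 'rV[R]_n -> R.

Definition partial (j : 'I_n) phi : 'rV[R]_n -> R :=
  fun xi => 'D_(delta_mx 0 j) phi xi.

Definition bounded_continuous phi :=
  continuous phi /\ exists M : R, forall xi, `|phi xi| <= M.

Fixpoint Cb (k : nat) phi : Prop :=
  bounded_continuous phi /\
  if k is k'.+1 then
    forall j, (forall xi, derivable phi xi (delta_mx 0 j)) /\ Cb k' (partial j phi)
  else True.

End PartialDerivatives.

Unset Implicit Arguments.
Record cylinder (R : realType) (X : normedModType R) := Cylinder {
  cyl_dim : nat ;
  cyl_phi : 'rV[R]_cyl_dim -> R ;
  cyl_xs : 'I_cyl_dim -> dual X }.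
Arguments cylinder {R} X.
Arguments cyl_dim {R X} c.
Arguments cyl_phi {R X} c xi.
Arguments cyl_xs {R X} c j.

Section Cylindrical.
Context {R : realType} {X : normedModType R}.
Implicit Type c : cylinder X.

Definition cyl_coord c (x : X) : 'rV[R]_(cyl_dim c) := \row_j cyl_xs c j x.

Definition cyl_fun c (x : X) : R := cyl_phi c (cyl_coord c x).

Definition cyl_d c (j : 'I_(cyl_dim c)) (x : X) : R :=
  partial j (cyl_phi c) (cyl_coord c x).

Definition cyl_d2 c (j k : 'I_(cyl_dim c)) (x : X) : R :=
  partial j (partial k (cyl_phi c)) (cyl_coord c x).

Set Implicit Arguments.

Definition FCb (k : nat) : set (X -> R) :=
  [set f | exists2 c, Cb k (cyl_phi c) & f = cyl_fun c].

Definition cyl_in_adj_dom (DA : set X) (A : X -> X) c :=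
  forall j, adj_dom DA A (cyl_xs c j).

Definition FCb_adj (k : nat) (DA : set X) (A : X -> X) : set (X -> R) :=
  [set f | exists c, [/\ Cb k (cyl_phi c), cyl_in_adj_dom DA A c & f = cyl_fun c]].

Definition adj_D (DA : set X) (A : X -> X) c (x : X) : dual X :=
  \sum_(j < cyl_dim c) cyl_d c j x *: adj DA A (cyl_xs c j).

End Cylindrical.

Section HGradient.
Context {R : realType} {X H : completeNormedModType R}.
Variables (ip : {dot H for idfun}) (istar : dual X -> H).
Implicit Types (c : cylinder X) (m : {measure set (borel X) -> \bar R}).

Definition D_H c (x : X) : H := \sum_(j < cyl_dim c) cyl_d c j x *: istar (cyl_xs c j).

Definition D2_H c (x : X) : H -> H := fun h =>
  \sum_(j < cyl_dim c) \sum_(k < cyl_dim c)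
    cyl_d2 c j k x *: tensor ip (istar (cyl_xs c j)) (istar (cyl_xs c k)) h.

Definition in_Lp m (p : R) (u : X -> \bar R) :=
  measurable_fun [set: borel X] (u : borel X -> \bar R) /\ ('N[m]_(p%:E)[(u : borel X -> \bar R)] < +oo)%E.

Definition in_LpH m (p : R) (F : X -> H) :=
  measurable_fun [set: borel X] (F : borel X -> borel H) /\
  ('N[m]_(p%:E)[(fun x : borel X => `|F x|%:E)] < +oo)%E.

(** Graph of the closure in [L^p(X, m)] of [D_H : FC_b^1(X) -> L^p(X, m; H)]:
    [u] belongs to [W^{1,p}_H(X, m)] and [F] is a version of [D_H u]. *)
Definition W1p_grad m (p : R) (u : X -> \bar R) (F : X -> H) :=
  [/\ in_Lp m p u, in_LpH m p F &
      exists c : nat -> cylinder X,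
      [/\ forall n, Cb 1 (cyl_phi (c n)),
          'N[m]_(p%:E)[(fun x : borel X => (cyl_fun (c n) x)%:E - u x)]%E
            @[n --> \oo] --> 0%E &
          'N[m]_(p%:E)[(fun x : borel X => `|(D_H (c n) x - F x)%R|%:E)]%E
            @[n --> \oo] --> 0%E]].

Variable B : H -> H.

(** The form [E] in terms of the gradients of its two arguments. *)
Definition OU_form m (Du Dv : X -> H) : R :=
  - \int[m]_(x in [set: borel X]) ip (B (Du x)) (Dv x).

(** Graph of the operator [L_2]: [u] belongs to its domain and [L_2 u = g]. *)
Definition L2_graph m (u g : X -> R) :=
  in_Lp m 2 (EFin \o g) /\
  exists2 Du : X -> H, W1p_grad m 2 (EFin \o u) Du &
  forall v : cylinder X, Cb 1 (cyl_phi v) ->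
    OU_form m Du (D_H v) = - \int[m]_(x in [set: borel X]) (g x * cyl_fun v x).

Definition L2_dom m : set (X -> R) := [set u | exists g, L2_graph m u g].

End HGradient.

(** ** Convex functions with values in [(-oo, +oo]] *)

Section Convex.
Context {R : realType} {X : normedModType R}.
Implicit Type U : X -> \bar R.

Definition proper_fun U := (forall x, U x != -oo%E) /\ (exists x, U x != +oo%E).

Definition econvex U := forall (x y : X) (t : R), 0 <= t -> t <= 1 ->
  (U (t *: x + (1 - t) *: y)%R <= t%:E * U x + (1 - t)%:E * U y)%E.

End Convex.

(* Main.v *)
(** The identity rests on integration by parts against [nu].  For the Gaussian measure,
    [int y w dmu = int <Dw, Qinf y> dmu] for every smooth cylinder function [w]: it follows
    from the characteristic function for cosines of linear functionals, and is extended by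
    approximating [w], one variable at a time, by Bernstein polynomials in [sin (x_1 / L)].
    Replacing [w] by [w theta(U)], with [theta] increasing to [exp (- t)], turns it into
    [int y w dnu = int ([D_H w, h] - w [D_H U, h]) dnu] whenever [i h = Qinf y]; the weight
    is in [L^2(mu)] because a convex lower semicontinuous [U] has an affine minorant.

    Differentiating [xs (Q_t xs)] along the adjoint semigroup yields the Lyapunov equation
    [xs (Q xs) = - 2 (A^* xs) (Qinf xs)], hence [B + B^* = - Id].  For [y = A^* x_j] and
    [h = B istar x_j] we have [i h = Qinf y], so the formula with [w = (d_j phi) v], summed
    over [j], gives the action of the form on [u] and [v], the second derivatives
    combining into a trace by the skewness of [B + 1/2].

    Conversely, a second candidate [Du] for the gradient differs from [D_H u] by a limit of
    [D_H d_n] with [d_n -> 0]; the formula shows that it is orthogonal to every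
    [B istar x] with [x] in the domain of [A^*].  These vectors are dense, so the gradient,
    and with it [L_2 u], is unique. *)

From HB Require Import structures.
Require Import Defs.
From mathcomp Require Import all_boot all_order all_algebra.
From mathcomp Require Import sesquilinear.
From mathcomp Require Import all_classical all_reals all_analysis.
From mathcomp Require Import measurable_realfun.
From mathcomp Require Import ring lra.

Import Order.TTheory GRing.Theory Num.Theory.
Import numFieldNormedType.Exports.

Local Open Scope classical_set_scope.
Local Open Scope ring_scope.

Set Implicit Arguments.
Unset Strict Implicit.
Unset Printing Implicit Defensive.

(** * The Hahn-Banach theorem and the dual space *)

(** The formula is claimed for every [L2u] in the graph, and that graph allows any [Du] reached by
    the closure. It therefore contains the closability of [D_H] in L^2(nu), at least as far as the
    form sees it, and integration by parts has to serve both existence and uniqueness.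

    Integrability shapes the estimates. The weight is used through its L^2(mu) bound, so a function
    is put in L^2(nu) by showing that its square is in L^2(mu): hence fourth moments of functionals
    and the exponent 4 for the gradient of [U].

    The adjoint semigroup need not be strongly continuous. It is handled by testing orbits of
    vectors; on the domain of the adjoint generator its orbits are Lipschitz, which is enough to
    differentiate the quadratic form of [Q].

    Bernstein polynomials require a variable in a bounded interval, whereas [x_1] is unbounded.
    [L sin (x_1 / L)] is bounded, tends to [x_1], and multiplication by sines preserves the
    trigonometric class in which the Gaussian identity is known.

    The cut-off [theta (t) = 1 / (exp t + eps)] satisfies [|theta'| <= theta <= exp (- t)], so one
    dominating function serves for all [eps]. *)

Definition rconvex {R : realType} {V : lmodType R} (p : V -> R) :=
  forall (x y : V) (t : R), 0 <= t -> t <= 1 ->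
  p (t *: x + (1 - t) *: y) <= t * p x + (1 - t) * p y.

Section HahnBanach.
Context {R : realType} {V : lmodType R}.
Implicit Types (p q : V -> R).

(** Convexity at the midpoint [0] of [x] and [- x]. This pointwise lower bound keeps infima over
    chains finite. *)
Lemma rconvex_opp_lb p q : rconvex q -> q 0 = 0 -> (forall x, q x <= p x) ->
  forall x, - p (- x) <= q x.
Proof.
move=> cq q0 qp x.
have := cq x (- x) 2^-1.
rewrite (_ : 2^-1 *: x + (1 - 2^-1) *: - x = 0); last first.
  by rewrite scalerN -scalerBl (_ : _ - _ = 0) ?scale0r//; lra.
have h := qp (- x).
by move=> /(_ ltac:(lra) ltac:(lra)); rewrite q0; lra.
Qed.

(** Zorn's lemma on the convex minorants vanishing at [0]. The infimum of a chain stays convex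
    because members almost minimal at [x] and at [y] are comparable, so the smaller one is almost
    minimal at both points. *)
Lemma rconvex_minimal p : rconvex p -> p 0 = 0 -> exists q,
  [/\ rconvex q, q 0 = 0, forall x, q x <= p x &
   forall s, rconvex s -> s 0 = 0 -> (forall x, s x <= q x) -> s = q].
Proof.
move=> cp p0.
pose P (q : V -> R) := [/\ rconvex q, q 0 = 0 & forall x, q x <= p x].
pose T := {q : V -> R | P q}.
pose r (a b : T) := `[< forall x, sval b x <= sval a x >].
have pP : P p by [].
have [||A totA|[q [cq q0 qp]] qmin] := @ZL_preorder T (exist P p pP) r.
- by move=> t; apply/asboolP.
- move=> a b c /asboolP ab /asboolP bc; apply/asboolP => x.
  exact: le_trans (bc x) (ab x).
- have [[a0 Aa0]|A0] := pselect (A !=set0); last first.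
    exists (exist P p pP) => s As; exfalso; apply: A0; by exists s.
  pose E x := [set sval a x | a in A].
  have E0 x : E x !=set0 by exists (sval a0 x), a0.
  have lbE x : lbound (E x) (- p (- x)).
    by move=> _ [[a [ca a00 ap]] _ <-] /=; exact: rconvex_opp_lb.
  have infE x : has_inf (E x) by split => //; exists (- p (- x)).
  have infle a x : A a -> inf (E x) <= sval a x.
    by move=> Aa; apply: ge_inf; [exists (- p (- x))|exists a].
  suff QP : P (fun x => inf (E x)).
    exists (exist P _ QP) => s As; apply/asboolP => x /=; exact: infle.
  split.
  + move=> x y t t0 t1; apply/ler_addgt0Pr => e e0.
    have [_ [a Aa <-] ax] := inf_adherent e0 (infE x).
    have [_ [b Ab <-] bx] := inf_adherent e0 (infE y).
    have [c Ac [ca cb]] : exists2 c, A c & (forall x, sval c x <= sval a x) /\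
        (forall x, sval c x <= sval b x).
      by have [/asboolP ab|/asboolP ab] := totA _ _ Aa Ab; [exists b|exists a].
    apply: (le_trans (infle c _ Ac)).
    have [cc _ _] := svalP c.
    apply: (le_trans (cc _ _ _ t0 t1)).
    have h1 : sval c x <= inf (E x) + e by rewrite (le_trans (ca x))// ltW.
    have h2 : sval c y <= inf (E y) + e by rewrite (le_trans (cb y))// ltW.
    have := ler_wpM2l t0 h1.
    have t1' : 0 <= 1 - t by lra.
    have := ler_wpM2l t1' h2; lra.
  + rewrite (_ : E 0 = [set 0]) ?inf1//; apply/seteqP; split => y.
      by move=> [[a [ca a00 ap]] _ <-].
    by move=> ->; exists a0 => //; have [] := svalP a0.
  + move=> x; rewrite (le_trans (infle _ _ Aa0))//.
    by have [_ _] := svalP a0; exact.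
- exists q; split => // s cs s0 sq.
  have sP : P s.
    by split => // x; exact: le_trans (sq x) (qp x).
  have /= := qmin (exist P s sP); rewrite /r => /(_ (asboolT sq)) /asboolP /= qs.
  by apply/funext => x; apply/eqP; rewrite eq_le sq qs.
Qed.

(** Each property comes from a competitor below [q]: [s^-1 * q (s *: x)] with [s <= 1] gives
    homogeneity, and the infimum over [t >= 0] of [q (x + t *: y) - t * q y] gives
    superadditivity. *)
Lemma minimal_convex_linear q : rconvex q -> q 0 = 0 ->
  (forall s, rconvex s -> s 0 = 0 -> (forall x, s x <= q x) -> s = q) ->
  linear (q : V -> R^o).
Proof.
move=> cq q0 qmin.
have hom01 (s : R) x : 0 < s -> s <= 1 -> q (s *: x) = s * q x.
  move=> s0 s1.
  have E : (fun x => s^-1 * q (s *: x)) = q.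
    apply: qmin => [y z t t0 t1||y].
    - rewrite scalerDr !scalerA ![s * _]mulrC -!scalerA.
      rewrite (mulrCA t) (mulrCA (1 - t)) -mulrDr ler_pM2l ?invr_gt0//.
      exact: cq.
    - by rewrite scaler0 q0 mulr0.
    - rewrite ler_pdivrMl//; have := cq y 0 s (ltW s0) s1.
      by rewrite scaler0 addr0 q0 mulr0 addr0.
  by rewrite -[in RHS]E mulrA divff ?gt_eqF// mul1r.
have hom (s : R) x : 0 < s -> q (s *: x) = s * q x.
  move=> s0; have [s1|s1] := leP s 1; first exact: hom01.
  have := @hom01 s^-1 (s *: x); rewrite invr_gt0 => /(_ s0).
  rewrite invf_le1 ?(ltW s1)// => /(_ isT).
  rewrite scalerA mulVf ?gt_eqF// scale1r => ->.
  by rewrite mulrA divff ?gt_eqF// mul1r.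
have sub x y : q (x + y) <= q x + q y.
  have := cq x y 2^-1 ltac:(lra) ltac:(lra).
  rewrite (_ : 1 - 2^-1 = 2^-1); last by lra.
  by rewrite -(scalerDr _ x y) hom ?invr_gt0//; lra.
have homge (t : R) y : 0 <= t -> q (t *: y) = t * q y.
  rewrite le_eqVlt => /predU1P[<-|]; last exact: hom.
  by rewrite scale0r q0 mul0r.
have add x y : q (x + y) = q x + q y.
  pose E x := [set q (x + t *: y) - t * q y | t in [set t | 0 <= t]].
  have lbE z : lbound (E z) (- q (- z)).
    move=> _ [t /= t0 <-]; have := sub (z + t *: y) (- z).
    by rewrite addrAC subrr add0r homge//; lra.
  have infle z (t : R) : 0 <= t -> inf (E z) <= q (z + t *: y) - t * q y.
    by move=> t0; apply: ge_inf; [exists (- q (- z))|exists t].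
  have infE z : has_inf (E z).
    by split; [exists (q (z + 0 *: y) - 0 * q y), 0 => /=|exists (- q (- z))].
  suff Eq : (fun x => inf (E x)) = q.
    apply/eqP; rewrite eq_le sub/=.
    by have := infle x 1 ler01; rewrite scale1r (congr1 (@^~ x) Eq); lra.
  apply: qmin.
  - move=> u v l l0 l1; apply/ler_addgt0Pr => e e0.
    have [_ [a /= a0 <-] au] := inf_adherent e0 (infE u).
    have [_ [b /= b0 <-] bv] := inf_adherent e0 (infE v).
    have l1' : 0 <= 1 - l by lra.
    have t0 : 0 <= l * a + (1 - l) * b by rewrite addr_ge0// mulr_ge0.
    apply: (le_trans (infle _ _ t0)).
    rewrite (_ : _ + _ *: y = l *: (u + a *: y) + (1 - l) *: (v + b *: y)); last first.
      by rewrite !scalerDr !scalerA [in RHS]addrACA -scalerDl.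
    have := cq (u + a *: y) (v + b *: y) l l0 l1.
    have := ler_wpM2l l0 (ltW au).
    have := ler_wpM2l l1' (ltW bv); lra.
  - rewrite (_ : E 0 = [set 0]) ?inf1//; apply/seteqP; split => z.
      by move=> [t /= t0 <-]; rewrite add0r homge// subrr.
    by move=> ->; exists 0 => //=; rewrite scale0r addr0 q0 mul0r subrr.
  - by move=> z; have := infle z 0 (lexx _); rewrite scale0r addr0 mul0r subr0.
have opp x : q (- x) = - q x.
  by apply/eqP; rewrite -addr_eq0 -add addNr q0.
move=> a x y; rewrite add; congr (_ + _).
have [a0|a0] := leP 0 a; first by rewrite homge.
have -> : a *: x = - ((- a) *: x) by rewrite scaleNr opprK.
by rewrite opp homge ?oppr_ge0 ?(ltW a0)// mulNr opprK.
Qed.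

(** Domination by a convex function vanishing at [0], not only by a sublinear one: it applies as it
    stands to a translated norm and to an inf-convolution. *)
Theorem hahn_banach p : rconvex p -> p 0 = 0 ->
  exists2 l : V -> R^o, linear l & forall x, l x <= p x.
Proof.
move=> cp p0; have [q [cq q0 qp qmin]] := rconvex_minimal cp p0.
by exists q => //; exact: minimal_convex_linear.
Qed.

End HahnBanach.

Section Dual.
Context {R : realType} {X : normedModType R}.
Implicit Types (xs ys : dual X).

Lemma dual_linear xs : linear (xs : X -> R^o).
Proof. by case: xs => f /= /asboolP[]. Qed.

HB.instance Definition _ xs :=
  GRing.isLinear.Build R X R^o _ (dual_fun xs) (dual_linear xs).

Lemma dual_continuous xs : continuous (xs : X -> R^o).
Proof. by case: xs => f /= /asboolP[]. Qed.

Lemma dualD xs ys x : (xs + ys) x = (xs x : R) + (ys x : R). Proof. by []. Qed.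

Lemma dualZ a xs x : (a *: xs) x = a * (xs x : R). Proof. by []. Qed.

Lemma dual0 x : (0 : dual X) x = 0 :> R. Proof. by []. Qed.

Lemma dualB xs ys x : (xs - ys) x = (xs x : R) - (ys x : R). Proof. by []. Qed.

Lemma dual_sum n (F : 'I_n -> dual X) x : (\sum_i F i) x = \sum_i (F i x : R).
Proof. by elim/big_rec2: _ => // i y xs _ <-. Qed.

Lemma dual_subv xs (x y : X) : xs (x - y) = (xs x : R) - (xs y : R).
Proof. exact: linearB. Qed.

Lemma dual_addv xs (x y : X) : xs (x + y) = (xs x : R) + (xs y : R).
Proof. exact: linearD. Qed.

Lemma dual_scalev xs (a : R) (x : X) : xs (a *: x) = a * (xs x : R).
Proof. exact: linearZ. Qed.

Lemma dual_ext xs ys : (forall x, xs x = ys x) -> xs = ys.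
Proof. by move=> h; apply: val_inj; apply/funext. Qed.

Lemma dual_bound xs : exists2 C : R, 0 <= C & forall x, `|xs x : R| <= C * `|x|.
Proof.
have /linear_bounded_continuous/linear_boundedP := @dual_continuous xs.
move=> [M [_ hM]]; exists (`|M| + 1); first by rewrite addr_ge0.
by apply: hM; rewrite (le_lt_trans (ler_norm _))// ltrDl.
Qed.

Lemma dual_norm_has_sup xs :
  has_sup [set `|xs x| | x in [set x : X | `|x| <= 1]].
Proof.
split; first by exists `|xs 0|, 0 => //=; rewrite normr0.
have [C C0 hC] := dual_bound xs.
exists C => _ [x /= x1 <-]; rewrite (le_trans (hC x))//.
by rewrite -[leRHS]mulr1 ler_wpM2l.
Qed.

Lemma dual_norm_ge0 xs : 0 <= dual_norm xs.
Proof.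
apply: le_trans (normr_ge0 (xs 0)) _.
apply: (sup_upper_bound (dual_norm_has_sup xs)).
by exists 0 => //=; rewrite normr0.
Qed.

Lemma le_dual_norm xs x : `|xs x : R| <= dual_norm xs * `|x|.
Proof.
have [->|x0] := eqVneq x 0; first by rewrite linear0 normr0 normr0 mulr0.
have x1 : 0 < `|x| by rewrite normr_gt0.
rewrite -ler_pdivrMr//.
have -> : `|xs x| / `|x| = `|xs (`|x|^-1 *: x)|.
  by rewrite linearZ/= normrZ normfV normr_id mulrC.
apply: (sup_upper_bound (dual_norm_has_sup xs)).
by exists (`|x|^-1 *: x) => //=; rewrite normrZ normfV normr_id mulVf ?gt_eqF.
Qed.

Lemma dual_norm_le xs C : (forall x, `|x| <= 1 -> `|xs x : R| <= C) -> dual_norm xs <= C.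
Proof.
move=> h; apply: ge_sup; first by have [] := dual_norm_has_sup xs.
by move=> _ [x /= x1 <-]; exact: h.
Qed.

Lemma mk_dual (f : X -> R^o) (C : R) : linear f ->
  (forall x, `|f x| <= C * `|x|) -> exists xs : dual X, forall x, xs x = f x.
Proof.
move=> lf hf.
have cf : continuous f.
  pose g : {linear X -> R^o} := HB.pack f (GRing.isLinear.Build R X R^o _ f lf).
  apply: (@bounded_linear_continuous _ _ _ g); apply/linear_boundedP.
  exists C; split; first exact: num_real.
  by move=> r Cr x; apply: (le_trans (hf x)); rewrite ler_wpM2r// ltW.
by exists (Dual (asboolT (conj lf cf))).
Qed.

(** The dominating function [|x + x0| - |x0|] equals [- |x0|] at [- x0], which forces the value at
    [x0]; the triangle inequality bounds the functional by the norm. *)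
Lemma norming_functional (x0 : X) : exists xs : dual X,
  (forall x, `|xs x : R| <= `|x|) /\ (xs x0 : R) = `|x0|.
Proof.
have [||l ll hl] := @hahn_banach R X (fun x => `|x + x0| - `|x0|).
- move=> x y t t0 t1.
  have -> : t *: x + (1 - t) *: y + x0 = t *: (x + x0) + (1 - t) *: (y + x0).
    rewrite !scalerDr [in RHS]addrACA -scalerDl.
    by rewrite (_ : t + (1 - t) = 1) ?scale1r//; lra.
  have := ler_normD (t *: (x + x0)) ((1 - t) *: (y + x0)).
  by rewrite !normrZ (ger0_norm t0) ger0_norm; lra.
- by rewrite add0r subrr.
pose g : {linear X -> R^o} := HB.pack l (GRing.isLinear.Build R X R^o _ l ll).
have lN x : l (- x) = - l x by exact: (linearN g).
have l1 x : l x <= `|x| by rewrite (le_trans (hl x))// lerBlDr ler_normD.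
have l2 x : `|l x| <= `|x|.
  by rewrite ler_norml l1 andbT lerNl -lN (le_trans (l1 _))// normrN.
have [xs hxs] := @mk_dual l 1 ll (fun x => ltac:(by rewrite mul1r)).
exists xs; split => [x|]; rewrite hxs//; apply/eqP; rewrite eq_le l1/=.
by have := hl (- x0); rewrite lN addNr normr0 sub0r lerN2.
Qed.

Lemma norm_le_dual (x : X) C : (forall xs : dual X, dual_norm xs <= 1 -> (xs x : R) <= C) ->
  `|x| <= C.
Proof.
move=> h; have [xs [xs1 <-]] := norming_functional x.
by apply: h; apply: dual_norm_le => y y1; rewrite (le_trans (xs1 y)).
Qed.

End Dual.

(** * The adjoint semigroup and the Lyapunov equation *)

Lemma cauchy_seq_cvg {R : realType} {V : completeNormedModType R} (v : nat -> V) :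
  (forall e : R, 0 < e -> exists N, forall m n, (N <= m)%N -> (N <= n)%N ->
    `|v m - v n| < e) -> cvgn v.
Proof.
move=> hv; apply/cauchy_cvgP/cauchy_ballP => e e0.
have [N hN] := hv e e0.
exists (v @` [set m | (N <= m)%N], v @` [set m | (N <= m)%N]).
  by split; exists N => // m Nm; exists m.
move=> [x y] /= [[m /= Nm <-] [n /= Nn <-]].
by rewrite -ball_normE/=; exact: hN.
Qed.

Lemma cvg_harmonic_bound {R : realType} {V : normedModType R} (u : nat -> V) (l : V)
    (C : R) :
  (forall n, `|u n - l| <= C * n.+1%:R^-1) -> u n @[n --> \oo] --> l.
Proof.
move=> h; apply/cvgrPdist_le => e e0.
near=> n; rewrite distrC (le_trans (h n))// ler_pdivrMr// mulrC -ler_pdivrMr//.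
by rewrite (@le_trans _ _ n%:R)// ?ler_nat//; near: n; exact: nbhs_infty_ger.
Unshelve. all: by end_near. Qed.

(** * Primitives of continuous functions on a half-line *)

Section Primitive.
Context {R : realType}.
Implicit Types (g G : R -> R).

Lemma continuous_itv_integrable g (a b : R) : continuous g ->
  lebesgue_measure.-integrable `[a, b] (EFin \o g).
Proof.
move=> cg; apply: continuous_compact_integrable; first exact: segment_compact.
exact: continuous_subspaceT.
Qed.

(** The half-line starts at [-1] so that [0], where orbits begin, is an interior point and the
    derivative there is two-sided. *)
Definition primitive g G := forall x : R, -1 < x -> is_derive x 1 G (g x).

Lemma primitive_exists g : continuous g -> exists G, primitive g G.
Proof.
move=> cg; exists (fun x => \int[lebesgue_measure]_(t in `[-1, x]) g t) => x x1.
have [] := @continuous_FTC1_closed R g (-1) x (x + 1) _ _ x1 (cg x).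
- by rewrite ltrDl.
- exact: continuous_itv_integrable.
by move=> d <-; rewrite derive1E; exact: derivableP.
Qed.

Lemma primitive_continuous g G x : primitive g G -> -1 < x ->
  {for x, continuous G}.
Proof.
move=> pG x1; have [d _] := pG x x1.
exact/differentiable_continuous/derivable1_diffP.
Qed.

Lemma integral_primitive g G (a b : R) : continuous g -> primitive g G ->
  -1 < a -> a <= b -> \int[lebesgue_measure]_(t in `[a, b]) g t = G b - G a.
Proof.
move=> cg pG a1; rewrite le_eqVlt => /predU1P[<-|ab].
  by rewrite set_itv1 Rintegral_set1 subrr.
have b1 : -1 < b by exact: lt_trans ab.
rewrite /Rintegral (@continuous_FTC2 R g G)//.
- exact: continuous_subspaceT.
- split.
  + move=> x; rewrite in_itv/= => /andP[ax xb].
    by have [] := pG x (lt_trans a1 ax).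
  + by apply: cvg_at_right_filter; exact: (primitive_continuous pG a1).
  + by apply: cvg_at_left_filter; exact: (primitive_continuous pG b1).
- move=> x; rewrite in_itv/= => /andP[ax xb].
  by rewrite derive1E; have [_ ->] := pG x (lt_trans a1 ax).
Qed.

(** Mean value theorem for [G], with [c] a frozen value of the integrand. Estimates of weak
    integrals are reduced to this inequality. *)
Lemma primitive_increment g G (a h c e : R) : primitive g G -> -1 < a -> 0 <= h ->
  (forall r, 0 <= r -> r <= h -> `|g (a + r) - c| <= e) ->
  `|G (a + h) - G a - h * c| <= h * e.
Proof.
move=> pG a1; rewrite le_eqVlt => /predU1P[<- _|h0 hg].
  by rewrite addr0 subrr !mul0r subr0 normr0.
have ah : a < a + h by rewrite ltrDl.
have [||x] := @MVT R G g a (a + h) ah.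
- by move=> x; rewrite in_itv/= => /andP[ax _]; exact: pG (lt_trans a1 ax).
- apply: continuous_in_subspaceT => x; rewrite inE/= in_itv/= => /andP[ax _].
  exact: (primitive_continuous pG (lt_le_trans a1 ax)).
rewrite in_itv/= => /andP[ax xh] ->.
rewrite (_ : a + h - a = h) 1?(mulrC (g x)) -?mulrBr; last by ring.
rewrite normrM (gtr0_norm h0) ler_wpM2l ?(ltW h0)//.
by have := hg (x - a); rewrite (addrC a) subrK; apply; lra.
Qed.

End Primitive.

(** * Orbits of a contraction semigroup and the domain of the adjoint generator *)

Section Semigroup.
Context {R : realType} {X : completeNormedModType R}.
Variable S : R -> {linear X -> X}.
Hypothesis hS : contraction_semigroup S.
Implicit Types (z : X) (xs ys : dual X).

Lemma semigroup_near0 z (e : R) : 0 < e ->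
  exists2 d : R, 0 < d & forall h, 0 <= h -> h < d -> `|S h z - z| <= e.
Proof.
move=> e0.
have /cvgrPdist_le/(_ e e0) := @semigroup_continuous _ _ _ hS z.
rewrite near_withinE => /nbhs_ballP[d /= d0 hd]; exists d => // h.
rewrite le_eqVlt => /predU1P[<-|h0] hlt.
  by rewrite (semigroup0 hS) subrr normr0 ltW.
by rewrite distrC; apply: hd => //; rewrite /ball/= sub0r normrN gtr0_norm.
Qed.

Lemma semigroup_dist z (r s : R) : 0 <= r -> r <= s ->
  `|S s z - S r z| <= `|S (s - r) z - z|.
Proof.
move=> r0 rs; have sr0 : 0 <= s - r by rewrite subr_ge0.
have {1}-> : s = r + (s - r) by rewrite addrC subrK.
by rewrite (semigroupD hS)// -linearB; exact: (semigroup_contraction hS).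
Qed.

(** The absolute value extends the orbit evenly to negative times, so that continuity and primitives
    are available on the whole line. *)
Lemma orbit_continuous z : continuous (fun r : R => S `|r| z).
Proof.
move=> r; apply/cvgrPdist_le => e e0.
have [d d0 hd] := semigroup_near0 z e0.
near=> s; have rs : `|r - s| < d.
  by near: s; apply/nbhs_ballP; exists d.
have hn : `|(`|r| - `|s|)| < d by exact: le_lt_trans (ler_dist_dist _ _) rs.
have [sr|sr] := leP `|s| `|r|.
  apply: (le_trans (semigroup_dist z (normr_ge0 s) sr)); apply: hd.
    by rewrite subr_ge0.
  exact: le_lt_trans (ler_norm _) hn.
rewrite distrC; apply: (le_trans (semigroup_dist z (normr_ge0 r) (ltW sr))).
apply: hd; first by rewrite subr_ge0 ltW.
by rewrite distrC in hn; exact: le_lt_trans (ler_norm _) hn.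
Unshelve. all: by end_near. Qed.

Lemma dual_orbit_continuous z xs : continuous (fun r : R => xs (S `|r| z) : R).
Proof.
by move=> r; apply: (cvg_comp _ _ (@orbit_continuous z r)); exact: dual_continuous.
Qed.

(** The bound involves the functional only through its norm and does not depend on [a], so it is
    uniform over the dual ball and along the orbit. *)
Lemma dual_orbit_near z xs (a h e : R) : 0 <= a ->
  (forall r, 0 <= r -> r <= h -> `|S r z - z| <= e) ->
  forall r, 0 <= r -> r <= h ->
  `|(xs (S `|a + r| z) : R) - (xs (S `|a| z) : R)| <= dual_norm xs * e.
Proof.
move=> a0 he r r0 rh; rewrite -dual_subv (le_trans (le_dual_norm _ _))//.
rewrite ler_wpM2l ?dual_norm_ge0// !ger0_norm ?addr_ge0//.
rewrite (le_trans (semigroup_dist z a0 _)) ?lerDl//.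
by rewrite (addrC a) addrK he.
Qed.

Lemma semigroup_compE xs (t : R) : 0 <= t ->
  exists ys : dual X, forall x, ys x = xs (S t x).
Proof.
move=> t0; have lf : linear ((fun x => xs (S t x)) : X -> R^o).
  by move=> a x y; rewrite !linearP.
apply: (@mk_dual R X _ (dual_norm xs) lf) => x.
by rewrite (le_trans (le_dual_norm _ _))// ler_wpM2l ?dual_norm_ge0//
  (semigroup_contraction hS).
Qed.

(** [v] is a left Riemann sum of the orbit, with mesh below the continuity scale [d]. The error is
    uniform over functionals of bounded norm, which later allows a limit in norm. *)
Lemma orbit_approx_integral z (e t : R) : 0 < e -> 0 < t ->
  exists v, forall xs,
  `|(xs v : R) - \int[lebesgue_measure]_(r in `[0, t]) xs (S `|r| z)|
    <= t * (dual_norm xs * e).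
Proof.
move=> e0 t0; have [d d0 hd] := semigroup_near0 z e0.
have [N hN] : exists N : nat, t / N.+1%:R < d.
  exists (Num.truncn (t / d)); rewrite ltr_pdivrMr// mulrC -ltr_pdivrMr//.
  by rewrite truncnS_gt.
set h := t / N.+1%:R in hN.
have h0 : 0 < h by rewrite divr_gt0.
have hh r : 0 <= r -> r <= h -> `|S r z - z| <= e.
  by move=> r0 rh; apply: hd => //; exact: le_lt_trans hN.
suff key n : exists v, forall xs G, primitive (fun r => xs (S `|r| z)) G ->
    `|(xs v : R) - (G (n%:R * h) - G 0)| <= n%:R * h * (dual_norm xs * e).
  have [v hv] := key N.+1; exists v => xs.
  have cg := @dual_orbit_continuous z xs.
  have [G pG] := primitive_exists cg.
  rewrite (integral_primitive cg pG) ?(ltW t0)//.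
  by have := hv _ _ pG; rewrite /h mulrC divfK.
elim: n => [|n [v hv]].
  by exists 0 => xs G _; rewrite !mul0r linear0 !subrr normr0.
exists (v + h *: S `|n%:R * h| z) => xs G pG.
have nh0 : 0 <= n%:R * h by rewrite mulr_ge0// ltW.
have nh1 : -1 < n%:R * h by rewrite (lt_le_trans _ nh0).
have := primitive_increment pG nh1 (ltW h0)
  (dual_orbit_near xs nh0 hh).
have := hv _ _ pG.
rewrite dual_addv dual_scalev.
rewrite -natr1 mulrDl mul1r mulrDl !ler_norml; lra.
Qed.

(** The integral of the orbit as a vector of [X]: Riemann sums are Cauchy in norm because the
    integrals against functionals are approached uniformly on the dual ball. *)
Lemma orbit_integral z (t : R) : 0 < t -> exists v, forall xs,
  (xs v : R) = \int[lebesgue_measure]_(r in `[0, t]) xs (S `|r| z).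
Proof.
move=> t0.
have /choice[v hv] : forall n : nat, exists v, forall xs,
  `|(xs v : R) - \int[lebesgue_measure]_(r in `[0, t]) xs (S `|r| z)|
    <= t * (dual_norm xs * n.+1%:R^-1).
  by move=> n; apply: orbit_approx_integral.
have hvC m n : `|v m - v n| <= t * m.+1%:R^-1 + t * n.+1%:R^-1.
  apply: norm_le_dual => xs xs1; rewrite dual_subv.
  have B k : `|(xs (v k) : R) - \int[lebesgue_measure]_(r in `[0, t]) xs (S `|r| z)|
      <= t * k.+1%:R^-1.
    by rewrite (le_trans (hv k xs))// ler_pM2l// ler_piMl.
  move: (B m) (B n); move: (t / m.+1%:R) (t / n.+1%:R) => a b.
  by rewrite !ler_norml; lra.
have cv : cvgn v.
  apply: cauchy_seq_cvg => e e0.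
  have [N hN] : exists N : nat, 2 * t / e < N.+1%:R.
    by exists (Num.truncn (2 * t / e)); rewrite truncnS_gt.
  have hk k : (N <= k)%N -> t * k.+1%:R^-1 < e / 2.
    move=> Nk; rewrite ltr_pdivrMr//.
    have Nk1 : N.+1%:R <= k.+1%:R :> R by rewrite ler_nat.
    rewrite ltr_pdivrMr// in hN.
    have := ler_wpM2l (ltW e0) Nk1; lra.
  exists N => m n Nm Nn; rewrite (le_lt_trans (hvC m n))//.
  by rewrite [e]splitr ltrD// hk.
exists (limn v) => xs.
have h1 : (xs (v n) : R^o) @[n --> \oo] --> xs (limn v).
  by apply: cvg_comp cv _; exact: dual_continuous.
apply: (cvg_unique _ h1) => //.
apply: (@cvg_harmonic_bound _ _ _ _ (t * dual_norm xs)) => n.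
by rewrite -mulrA.
Qed.

(** The bracket is the effect of [S h - 1] on the integral of the orbit over [[0, t]]; its two
    halves are integrals over intervals of length [h], starting at [t] and at [0]. *)
Lemma orbit_increment z xs (t h e : R) (G : R -> R) :
  primitive (fun r => xs (S `|r| z)) G -> 0 <= t -> 0 < h ->
  (forall r, 0 <= r -> r <= h -> `|S r z - z| <= e) ->
  `|h^-1 * (G (t + h) - G t - (G h - G 0)) - (xs (S t z - z) : R)|
    <= 2 * (dual_norm xs * e).
Proof.
move=> pG t0 h0 he.
have t1 : -1 < t by rewrite (lt_le_trans _ t0).
have o1 : -1 < 0 :> R by [].
have A1 := primitive_increment pG t1 (ltW h0) (dual_orbit_near xs t0 he).
have A2 := primitive_increment pG o1 (ltW h0) (dual_orbit_near xs (lexx 0) he).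
rewrite add0r normr0 (semigroup0 hS) in A2.
rewrite (ger0_norm t0) in A1.
rewrite dual_subv.
set D := _ - _ - _; set k := (xs (S t z) : R) - xs z.
have -> : h^-1 * D - k = h^-1 * (D - h * k).
  by rewrite (mulrBr _ D) mulKf ?gt_eqF.
rewrite normrM normfV (gtr0_norm h0) ler_pdivrMl// {}/D {}/k.
move: A1 A2; rewrite !ler_norml; lra.
Qed.

Lemma orbit_integralE z xs (t : R) (G : R -> R) :
  primitive (fun r => xs (S `|r| z)) G -> 0 <= t ->
  \int[lebesgue_measure]_(r in `[0, t]) xs (S `|r| z) = G t - G 0.
Proof. by move=> pG t0; rewrite (integral_primitive (@dual_orbit_continuous z xs) pG). Qed.

Lemma orbit_shift z xs (t h : R) (G : R -> R) :
  primitive (fun r => xs (S `|r| z)) G -> 0 <= t -> 0 <= h ->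
  \int[lebesgue_measure]_(r in `[0, t]) xs (S `|r| (S h z)) = G (t + h) - G h.
Proof.
move=> pG t0 h0; pose f (r : R) : R := xs (S `|r| z).
transitivity (\int[lebesgue_measure]_(r in `[0, t]) f (r + h)).
  apply: eq_Rintegral => r; rewrite inE/= in_itv/= => /andP[r0 _].
  by rewrite -(semigroupD hS)// /f !ger0_norm// addr_ge0.
have cf : continuous (fun r => f (r + h)).
  move=> r; apply: (@continuous_comp _ _ _ (fun r => r + h) f).
    by apply: continuousD => //; exact: cst_continuous.
  exact: dual_orbit_continuous.
have pf : primitive (fun r => f (r + h)) (fun r => G (r + h)).
  move=> r r1; have rh1 : -1 < r + h by lra.
  have dG := pG _ rh1.
  have := @is_derive1_comp _ G (fun r => r + h) r (f (r + h)) 1 dG _.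
  by rewrite mulr1; apply; exact: is_derive_shift.
by rewrite (integral_primitive cf pf)// add0r.
Qed.

Section Generator.
Variables (DA : set X) (A : X -> X).
Hypothesis hA : is_generator S DA A.

(** The integral of an orbit lies in the domain of the generator. The difference quotient converges
    in norm since [orbit_increment] is uniform over functionals of norm at most one. *)
Lemma generator_orbit_integral z (t : R) v : 0 < t ->
  (forall xs, xs v = \int[lebesgue_measure]_(r in `[0, t]) xs (S `|r| z)) ->
  DA v /\ A v = S t z - z.
Proof.
move=> t0 hv.
suff cv : (h^-1 *: (S h v - v)) @[h --> 0^'+] --> S t z - z.
  have [[_ h1] h2] := hA v; have Dv : DA v by apply: h1; apply/cvg_ex; eexists; exact: cv.
  by split => //; exact: (cvg_unique _ (h2 Dv) cv).
apply/cvgrPdist_le => e e0.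
have e2 : 0 < e / 2 by rewrite divr_gt0.
have [d d0 hd] := semigroup_near0 z e2.
near=> h.
have h0 : 0 < h by near: h; exact: nbhs_right_gt.
have hld : h < d by near: h; exact: nbhs_right_lt.
rewrite distrC; apply: norm_le_dual => xs xs1.
have [G pG] := primitive_exists (@dual_orbit_continuous z xs).
have E1 : (xs (S h v - v) : R) = G (t + h) - G t - (G h - G 0).
  have [ys hys] := semigroup_compE xs (ltW h0).
  rewrite dual_subv -[xs (S h v)]hys !hv (orbit_integralE pG (ltW t0)).
  rewrite (_ : Rintegral _ _ _ =
      \int[lebesgue_measure]_(r in `[0, t]) xs (S `|r| (S h z))).
    by rewrite (orbit_shift pG) ?ltW//; ring.
  by apply: eq_Rintegral => r _; rewrite hys -!(semigroupD hS) ?(ltW h0)// addrC.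
have := orbit_increment pG (ltW t0) h0 (fun r r0 rh => hd r r0 (le_lt_trans rh hld)).
rewrite (dual_subv _ (h^-1 *: _)) dual_scalev E1 => /(le_trans (ler_norm _)) /le_trans; apply.
have := dual_norm_ge0 xs; nra.
Unshelve. all: by end_near. Qed.

Lemma adjP xs : adj_dom DA A xs -> is_adjoint DA A xs (adj DA A xs).
Proof. exact: xgetPex. Qed.

(** Testing the adjoint on the orbit integral, which belongs to [DA], gives the integrated
    derivative of the orbit against [xs] for every [z], not only for [z] in [DA]. *)
Lemma adj_orbit z xs (t : R) : adj_dom DA A xs -> 0 < t ->
  (xs (S t z) : R) - (xs z : R) =
  \int[lebesgue_measure]_(r in `[0, t]) adj DA A xs (S `|r| z).
Proof.
move=> Dxs t0; have [v hv] := orbit_integral z t0.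
have [Dv Av] := generator_orbit_integral t0 hv.
by rewrite -hv -dual_subv -Av; exact: adjP.
Qed.

(** The average of the adjoint orbit is in the domain of the adjoint, with image [S_t^* xs - xs].
    Such averages supply the elements of [adj_dom] used to separate points. *)
Lemma orbit_average xs (t : R) : 0 < t -> exists2 ys : dual X,
  forall z, (ys z : R) = \int[lebesgue_measure]_(r in `[0, t]) xs (S `|r| z) &
  adj_dom DA A ys.
Proof.
move=> t0.
pose f z : R^o := \int[lebesgue_measure]_(r in `[0, t]) xs (S `|r| z).
have it z : lebesgue_measure.-integrable `[0, t] (EFin \o (fun r => xs (S `|r| z) : R)).
  exact: (continuous_itv_integrable _ _ (@dual_orbit_continuous z xs)).
have lf : linear f.
  move=> a x y; rewrite /f.
  transitivity (\int[lebesgue_measure]_(r in `[0, t])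
      (a * (xs (S `|r| x) : R) + (xs (S `|r| y) : R))).
    by apply: eq_Rintegral => r _; rewrite linearP dual_addv dual_scalev.
  have ia : lebesgue_measure.-integrable `[0, t]
      (EFin \o (fun r => a * (xs (S `|r| x) : R))).
    apply: continuous_itv_integrable => r.
    by apply: cvgM; [exact: cvg_cst|exact: dual_orbit_continuous].
  by rewrite (RintegralD _ ia (it y))// (RintegralZl _ _ (it x)).
have [|ys hys] := @mk_dual R X f (t * dual_norm xs) lf.
  move=> z; rewrite /f.
  have [G pG] := primitive_exists (@dual_orbit_continuous z xs).
  rewrite (orbit_integralE pG (ltW t0)).
  have o1 : -1 < 0 :> R by [].
  have := @primitive_increment _ _ _ 0 t 0 (dual_norm xs * `|z|) pG o1 (ltW t0).
  rewrite add0r mulr0 subr0 mulrA; apply => r r0 rt.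
  rewrite subr0 (le_trans (le_dual_norm _ _))// ler_wpM2l ?dual_norm_ge0//.
  exact: (semigroup_contraction hS).
exists ys => //.
have [w hw] := semigroup_compE xs (ltW t0).
exists (w - xs) => z Dz; rewrite dualB hw -dual_subv.
have hAz := (hA z).2 Dz.
have : (ys (h^-1 *: (S h z - z)) : R) @[h --> 0^'+] --> (ys (A z) : R).
  by apply: (cvg_comp _ _ hAz); exact: dual_continuous.
move=> /(@cvg_unique _ _ _ _); apply => //.
apply/cvgrPdist_le => e e0.
have e2 : 0 < e / (2 * (dual_norm xs + 1)).
  by rewrite divr_gt0// mulr_gt0// ltr_wpDl// dual_norm_ge0.
have [d d0 hd] := semigroup_near0 z e2.
near=> h.
have h0 : 0 < h by near: h; exact: nbhs_right_gt.
have hld : h < d by near: h; exact: nbhs_right_lt.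
have [G pG] := primitive_exists (@dual_orbit_continuous z xs).
have -> : (ys (h^-1 *: (S h z - z)) : R) = h^-1 * (G (t + h) - G t - (G h - G 0)).
  rewrite dual_scalev dual_subv !hys /f (orbit_integralE pG (ltW t0)).
  by rewrite (orbit_shift pG) ?ltW//; congr (_ * _); ring.
rewrite distrC (le_trans (orbit_increment pG (ltW t0) h0
  (fun r r0 rh => hd r r0 (le_lt_trans rh hld))))//.
rewrite mulrCA mulrA mulrA ler_pdivrMr; last first.
  by rewrite mulr_gt0// ltr_wpDl// dual_norm_ge0.
have := dual_norm_ge0 xs; nra.
Unshelve. all: by end_near. Qed.

(** Averages over short intervals annihilate [z], while after division by the length they are close
    to [xs z]. The domain need not be norm dense in the dual, but it separates points. *)
Lemma adj_dom_separates z : (forall xs, adj_dom DA A xs -> (xs z : R) = 0) ->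
  forall xs, (xs z : R) = 0.
Proof.
move=> hz xs.
have [G pG] := primitive_exists (@dual_orbit_continuous z xs).
apply/eqP; rewrite -normr_le0; apply/ler_addgt0Pl => e e0; rewrite addr0.
have e2 : 0 < e / (dual_norm xs + 1).
  by rewrite divr_gt0// ltr_wpDl// dual_norm_ge0.
have [d d0 hd] := semigroup_near0 z e2.
(* Half of [d], so that the closed interval of averaging lies inside the range of [hd]. *)
have d2 : 0 < d / 2 by rewrite divr_gt0.
have [ys hys Dys] := orbit_average xs d2.
have := hz _ Dys; rewrite hys (orbit_integralE pG (ltW d2)) => G0.
have o1 : -1 < 0 :> R by [].
have hd' r : 0 <= r -> r <= d / 2 -> `|S r z - z| <= e / (dual_norm xs + 1).
  by move=> r0 rd; apply: hd => //; lra.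
have := primitive_increment pG o1 (ltW d2) (dual_orbit_near xs (lexx 0) hd').
rewrite add0r G0 sub0r normrN normr0 (semigroup0 hS) normrM (gtr0_norm d2).
rewrite ler_pM2l// => /le_trans; apply.
rewrite mulrA ler_pdivrMr; last by rewrite ltr_wpDl// dual_norm_ge0.
by have := dual_norm_ge0 xs; nra.
Qed.

End Generator.
End Semigroup.

(** A quadratic error does not affect the derivative. The bound is asked for [u >= 0] only, which
    covers a neighbourhood of [s > 0]. *)
Lemma is_derive_quadratic {R : realType} (f G : R -> R) (s l C : R) : 0 < s ->
  is_derive s 1 G l ->
  (forall u, 0 <= u -> `|f u - f s - (G u - G s)| <= C * (u - s) ^+ 2) ->
  is_derive s 1 f l.
Proof.
move=> s0 [dG GE] fG.
suff cf : h^-1 *: (f (h *: 1 + s) - f s) @[h --> 0^'] --> l.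
  by apply: DeriveDef; [apply/cvg_ex; exists l|exact: cvg_lim cf].
have C0 : 0 <= C.
  have := fG (s + 1) ltac:(lra).
  by rewrite (_ : s + 1 - s = 1) ?expr1n ?mulr1; [exact: le_trans|ring].
have cG : h^-1 *: (G (h *: 1 + s) - G s) @[h --> 0^'] --> l.
  by rewrite -GE; exact: dG.
apply/cvgrPdist_le => e e0.
have e2 : 0 < e / 2 by rewrite divr_gt0.
move/cvgrPdist_le/(_ _ e2) : cG => cG.
near=> h.
have h0 : h != 0 by near: h; exact: nbhs_dnbhs_neq.
have hs : `|h| < s by near: h; apply: dnbhs0_lt; exact: s0.
have hC : `|h| < e / (2 * (C + 1)).
  by near: h; apply: dnbhs0_lt; rewrite divr_gt0// mulr_gt0// ltr_wpDl.
have us : 0 <= h *: 1 + s.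
  by move: hs; rewrite /GRing.scale/= mulr1 ltr_norml; lra.
have := fG _ us; rewrite addrK.
have : `|l - h^-1 *: (G (h *: 1 + s) - G s)| <= e / 2.
  by near: h; exact: cG.
set u := G (_ + _) - _; set v := f (_ + _) - _ => lu.
rewrite /GRing.scale/= mulr1 => vu.
have -> : l - h^-1 * v = (l - h^-1 * u) - h^-1 * (v - u) by ring.
apply: (le_trans (ler_normB _ _)); rewrite [e]splitr lerD//.
rewrite normrM normfV ler_pdivrMl ?normr_gt0// (le_trans vu)//.
rewrite -real_normK ?num_real// expr2 mulrCA ler_pM2l ?normr_gt0//.
move: hC; rewrite ltr_pdivlMr ?mulr_gt0// ?ltr_wpDl//.
by have := normr_ge0 h; nra.
Unshelve. all: by end_near. Qed.

(** * The quadratic form of [Q] along the adjoint semigroup *)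

Section Lyapunov.
Context {R : realType} {X : completeNormedModType R}.
Variables (Q : {linear dual X -> X}) (S : R -> {linear X -> X}).
Variables (DA : set X) (A : X -> X).
Hypotheses (hQ_bounded : dual_bounded Q)
  (hQ_sym : forall xs ys : dual X, ys (Q xs) = xs (Q ys))
  (hQ_ge0 : forall xs : dual X, 0 <= xs (Q xs))
  (hS : contraction_semigroup S) (hA : is_generator S DA A).
Implicit Types (x z : X) (xs ys : dual X).

Local Notation star s xs := (adj setT (S `|s|) xs).

(** The adjoint of a bounded operator is everywhere defined, so the default value of [adj] is not
    taken here. *)
Lemma adj_semigroupE (s : R) xs x : star s xs x = xs (S `|s| x).
Proof.
have [ys hys] := semigroup_compE hS xs (normr_ge0 s).
have h : adj_dom setT (S `|s|) xs by exists ys => y _.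
by have := xgetPex 0 h; move=> /(_ x I) ->.
Qed.

Lemma adj_semigroup_norm (s : R) xs : dual_norm (star s xs) <= dual_norm xs.
Proof.
apply: dual_norm_le => x x1; rewrite adj_semigroupE (le_trans (le_dual_norm _ _))//.
rewrite ler_piMr ?dual_norm_ge0// (le_trans _ x1)//.
exact: (semigroup_contraction hS).
Qed.

Variable xs : dual X.
Hypothesis Dxs : adj_dom DA A xs.
Let ys := adj DA A xs.
(** [f] is the integrand of [xs (Qt t xs)], and [g] is its derivative at positive times. *)
Let f (s : R) : R := star s xs (Q (star s xs)).
Let g (s : R) : R := 2 * star s ys (Q (star s xs)).

Lemma star_primitive z (G : R -> R) (s t : R) :
  primitive (fun r => ys (S `|r| z)) G -> 0 <= s -> 0 <= t ->
  (star t xs z : R) - star s xs z = G t - G s.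
Proof.
move=> pG; suff h u : 0 <= u -> (star u xs z : R) - xs z = G u - G 0.
  by move=> s0 t0; have := h s s0; have := h t t0; lra.
rewrite adj_semigroupE le_eqVlt => /predU1P[<-|u0].
  by rewrite normr0 (semigroup0 hS) !subrr.
rewrite (gtr0_norm u0) (adj_orbit hS hA z Dxs u0).
exact: (orbit_integralE hS pG (ltW u0)).
Qed.

(** The increments of this adjoint orbit are integrals of the orbit of [ys = A^* xs], which
    contraction keeps bounded. This replaces strong continuity of the adjoint semigroup. *)
Lemma star_lipschitz (s t : R) : 0 <= s -> 0 <= t ->
  dual_norm (star t xs - star s xs) <= dual_norm ys * `|t - s|.
Proof.
wlog st : s t / s <= t => [hw s0 t0|s0 t0].
  have [|/ltW] := leP s t; first by move/hw; exact.
  move=> /hw/(_ t0 s0); rewrite [in X in _ -> X]distrC => /(le_trans _); apply.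
  by apply: dual_norm_le => x x1; rewrite dualB distrC -dualB;
    rewrite (le_trans (le_dual_norm _ _))// ler_piMr// dual_norm_ge0.
apply: dual_norm_le => x x1.
have [G pG] := primitive_exists (dual_orbit_continuous hS (z := x) (xs := ys)).
rewrite dualB (star_primitive pG s0 t0).
have st0 : 0 <= t - s by rewrite subr_ge0.
have s1 : -1 < s by lra.
have := @primitive_increment _ _ _ s (t - s) 0 (dual_norm ys) pG s1 st0.
rewrite mulr0 subr0 (addrC s) subrK (ger0_norm st0) mulrC; apply => r r0 rt.
rewrite subr0 (le_trans (le_dual_norm _ _))// ler_piMr ?dual_norm_ge0//.
by rewrite (le_trans (semigroup_contraction hS _ _)).
Qed.

(** Expansion of the quadratic form around [s]; the last term is of second order in [t - s]. *)
Lemma energy_increment (s t : R) :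
  f t - f s = 2 * ((star t xs : dual X) (Q (star s xs)) - f s)
              + (star t xs - star s xs) (Q (star t xs - star s xs)).
Proof.
rewrite /f (linearB Q) !dualB !dual_subv (hQ_sym (star s xs) (star t xs)).
by ring.
Qed.

Lemma covariance_bound : exists2 M : R, 0 <= M & forall us vs : dual X,
  `|us (Q vs) : R| <= M * (dual_norm us * dual_norm vs).
Proof.
have [M hM] := hQ_bounded; exists `|M|; first exact: normr_ge0.
move=> us vs; rewrite (le_trans (le_dual_norm _ _))// mulrCA.
rewrite ler_wpM2l ?dual_norm_ge0// (le_trans (hM _))//.
by rewrite ler_wpM2r ?dual_norm_ge0// ler_norm.
Qed.

(** With [Q (star s xs)] frozen, the first-order part has the primitive [2 G], and [star_lipschitz]
    makes the remainder quadratic. *)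
Lemma energy_is_derive (s : R) : 0 < s -> is_derive s 1 f (g s).
Proof.
move=> s0; set z := Q (star s xs).
have [G pG] := primitive_exists (dual_orbit_continuous hS (z := z) (xs := ys)).
have [M M0 hM] := covariance_bound.
have s1 : -1 < s by lra.
have dG : is_derive s 1 (2 \*: G) (g s).
  rewrite /g adj_semigroupE; have dG := pG s s1.
  exact: is_deriveZ.
apply: (is_derive_quadratic (C := M * dual_norm ys ^+ 2) s0 dG) => u u0.
have -> : f u - f s - ((2 \*: G) u - (2 \*: G) s) =
    (star u xs - star s xs) (Q (star u xs - star s xs)).
  rewrite energy_increment.
  have := star_primitive pG (ltW s0) u0; rewrite -/z -[star s xs z]/(f s).
  rewrite /= /GRing.scale/=.
  by move=> E; have -> : G u = G s + (star u xs z - f s) by [rewrite E; ring]; ring.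
apply: (le_trans (hM _ _)); rewrite -mulrA ler_wpM2l//.
rewrite -(real_normK (num_real (u - s))) -exprMn expr2.
by rewrite ler_pM ?dual_norm_ge0// star_lipschitz// ltW.
Qed.

Lemma star_abs (s : R) us : star s us = star `|s| us.
Proof. by rewrite normr_id. Qed.

(** By symmetry the increment is the form evaluated at the difference and the sum of the two
    functionals. The bound reaches time [0], where [energy_is_derive] does not apply. *)
Lemma energy_dist : exists2 L : R, 0 <= L & forall s t : R, `|f t - f s| <= L * `|t - s|.
Proof.
have [M M0 hM] := covariance_bound.
exists (M * (dual_norm ys * (2 * dual_norm xs))).
  by rewrite !mulr_ge0 ?dual_norm_ge0.
move=> s t.
have -> : f t - f s = (star t xs - star s xs) (Q (star t xs + star s xs)).
  rewrite /f (linearD Q) !dualB !dual_addv (hQ_sym (star s xs) (star t xs)).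
  by ring.
apply: (le_trans (hM _ _)); rewrite -!mulrA ler_wpM2l//.
have h1 : dual_norm (star t xs - star s xs) <= dual_norm ys * `|t - s|.
  rewrite (star_abs s) (star_abs t) (le_trans (star_lipschitz _ _))//.
  by rewrite ler_wpM2l ?dual_norm_ge0// ler_dist_dist.
have h2 : dual_norm (star t xs + star s xs) <= 2 * dual_norm xs.
  apply: dual_norm_le => x x1; rewrite dualD mulr_natl mulr2n.
  rewrite (le_trans (ler_normD _ _))// lerD//.
    rewrite (le_trans (le_dual_norm _ _))// (le_trans _ (adj_semigroup_norm t xs))//.
    by rewrite ler_piMr ?dual_norm_ge0.
  rewrite (le_trans (le_dual_norm _ _))// (le_trans _ (adj_semigroup_norm s xs))//.
  by rewrite ler_piMr ?dual_norm_ge0.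
rewrite [leRHS](_ : _ = (dual_norm ys * `|t - s|) * (2 * dual_norm xs)); last by ring.
by rewrite ler_pM ?dual_norm_ge0.
Qed.

Lemma energy_continuous : continuous f.
Proof.
have [L L0 hL] := energy_dist.
move=> s; apply/cvgrPdist_le => e e0; near=> t.
rewrite distrC (le_trans (hL _ _))//.
have : `|t - s| < e / (L + 1).
  near: t; apply/nbhs_ballP; exists (e / (L + 1)) => /=.
    by rewrite divr_gt0// ltr_wpDl.
  by move=> t; rewrite /ball/= distrC.
rewrite ltr_pdivlMr ?ltr_wpDl// => h.
by have := normr_ge0 (t - s); nra.
Unshelve. all: by end_near. Qed.

(** Two quantities vary: the orbit of a fixed vector, which is continuous, and the vector
    [Q (star t xs)] itself, controlled by the Lipschitz bound. *)
Lemma energy_derivative_continuous : continuous g.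
Proof.
have [M M0 hM] := covariance_bound.
move=> s; apply/cvgrPdist_le => e e0.
set z := Q (star s xs).
have c1 := @dual_orbit_continuous _ _ _ hS z ys s.
have e4 : 0 < e / 4 by rewrite divr_gt0.
move/cvgrPdist_le/(_ _ e4) : c1 => c1.
pose C := M * (dual_norm ys * dual_norm ys).
have C0 : 0 <= C by rewrite !mulr_ge0 ?dual_norm_ge0.
near=> t.
have h1 : `|(ys (S `|s| z) : R) - ys (S `|t| z)| <= e / 4 by near: t.
have : `|t - s| < e / (4 * (C + 1)).
  near: t; apply/nbhs_ballP; exists (e / (4 * (C + 1))) => /=.
    by rewrite divr_gt0// mulr_gt0// ltr_wpDl.
  by move=> t; rewrite /ball/= distrC.
rewrite ltr_pdivlMr ?mulr_gt0 ?ltr_wpDl// => h2.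
have h3 : `|star t ys (Q (star t xs - star s xs)) : R| <= C * `|t - s|.
  apply: (le_trans (hM _ _)); rewrite /C -!mulrA ler_wpM2l//.
  rewrite ler_pM ?dual_norm_ge0 ?adj_semigroup_norm//.
  rewrite (star_abs s) (star_abs t) (le_trans (star_lipschitz _ _))//.
  by rewrite ler_wpM2l ?dual_norm_ge0// ler_dist_dist.
have -> : g s - g t = 2 * ((ys (S `|s| z) : R) - ys (S `|t| z))
    - 2 * star t ys (Q (star t xs - star s xs)).
  by rewrite /g (linearB Q) dual_subv -!adj_semigroupE; ring.
have h4 : C * `|t - s| <= e / 4 by have := normr_ge0 (t - s); nra.
move: h1 h3; rewrite !ler_norml; lra.
Unshelve. all: by end_near. Qed.

Lemma energy_FTC (t : R) : 0 < t ->
  \int[lebesgue_measure]_(s in `[0, t]) g s = f t - f 0.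
Proof.
move=> t0; rewrite /Rintegral (@continuous_FTC2 R g f)//.
- exact: (continuous_subspaceT energy_derivative_continuous).
- split.
  + by move=> x; rewrite in_itv/= => /andP[x0 _]; have [] := energy_is_derive x0.
  + by apply: cvg_at_right_filter; exact: energy_continuous.
  + by apply: cvg_at_left_filter; exact: energy_continuous.
- move=> x; rewrite in_itv/= => /andP[x0 _].
  by rewrite derive1E; have [_ ->] := energy_is_derive x0.
Qed.

Variables (Qt : R -> dual X -> X) (Qinf : dual X -> X).
Hypotheses (hQt : forall t, 0 < t -> forall xs,
     is_weak_integral 0 t (fun s => S s (Q (adj setT (S s) xs))) (Qt t xs))
  (hQinf : forall xs ys : dual X, ys (Qt t xs) @[t --> +oo] --> ys (Qinf xs)).

Lemma weak_integral_star (us : dual X) (t : R) : 0 < t ->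
  (us (Qt t xs) : R) =
  \int[lebesgue_measure]_(s in `[0, t]) star s us (Q (star s xs)).
Proof.
move=> t0; have [_ ->] := hQt t0 xs us.
apply: eq_Rintegral => s; rewrite inE/= in_itv/= => /andP[s0 _].
by rewrite adj_semigroupE ger0_norm.
Qed.

(** [g] is twice the integrand of [Qt t xs] tested against [ys], so the fundamental theorem turns
    the weak integral into an increment of the energy. *)
Lemma energyE (t : R) : 0 < t -> f t - f 0 = 2 * (ys (Qt t xs) : R).
Proof.
move=> t0; rewrite -energy_FTC// weak_integral_star// /g RintegralZl//.
have -> : (fun s => star s ys (Q (star s xs))) = (fun s => 2^-1 * g s).
  by apply/funext => s; rewrite /g mulrA mulVf ?mul1r.
apply: continuous_itv_integrable => s.
by apply: cvgM; [exact: cvg_cst|exact: energy_derivative_continuous].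
Qed.

(* The energy converges at infinity and so does its integral, so its limit is 0. *)
Lemma energy_vanishes : f 0 + 2 * (ys (Qinf xs) : R) = 0.
Proof.
set L := _ + _.
have fL : f t @[t --> +oo] --> L.
  have h : f 0 + 2 * (ys (Qt t xs) : R) @[t --> +oo] --> L.
    apply: cvgD; first exact: cvg_cst.
    by apply: cvgM; [exact: cvg_cst|exact: hQinf].
  apply: cvg_trans h; apply: near_eq_cvg; exists 0; split=> [|t t0]; first exact: num_real.
  by rewrite -energyE//; ring.
have [F pF] := primitive_exists energy_continuous.
have FP t : 0 < t -> F t = F 0 + (xs (Qt t xs) : R).
  move=> t0; rewrite weak_integral_star//.
  by rewrite (integral_primitive energy_continuous pF) ?(ltW t0)//; ring.
have FL : F t @[t --> +oo] --> F 0 + (xs (Qinf xs) : R).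
  have h : F 0 + (xs (Qt t xs) : R) @[t --> +oo] --> F 0 + (xs (Qinf xs) : R).
    by apply: cvgD; [exact: cvg_cst|exact: hQinf].
  apply: cvg_trans h; apply: near_eq_cvg; exists 0; split=> [|t t0]; first exact: num_real.
  by rewrite -FP.
apply/eqP; rewrite -normr_le0; apply/ler_addgt0Pl => e e0; rewrite addr0.
have e3 : 0 < e / 3 by rewrite divr_gt0.
have [T1 [_ h1]] : \forall t \near +oo, `|L - f t| <= e / 3.
  by move/cvgrPdist_le : fL; apply.
have [T2 [_ h2]] : \forall t \near +oo, `|F 0 + (xs (Qinf xs) : R) - F t| <= e / 3.
  by move/cvgrPdist_le : FL; apply.
pose t := 1 + `|T1| + `|T2|.
have tT1 : T1 < t.
  by rewrite /t; have := ler_norm T1; have := normr_ge0 T2; lra.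
have tT2 : T2 < t.
  by rewrite /t; have := ler_norm T2; have := normr_ge0 T1; lra.
have t0 : -1 < t by rewrite /t; have := normr_ge0 T1; have := normr_ge0 T2; lra.
have := @primitive_increment _ _ _ t 1 L (e / 3) pF t0 ler01.
rewrite !mul1r => /(_ _).
have hf r : 0 <= r -> r <= 1 -> `|f (t + r) - L| <= e / 3.
  by move=> r0 r1; rewrite distrC h1//; lra.
move=> /(_ hf).
have := h2 t tT2; have := h2 (t + 1) ltac:(lra).
rewrite !ler_norml; lra.
Qed.

Lemma lyapunov_quadratic : (xs (Q xs) : R) = - (2 * (ys (Qinf xs) : R)).
Proof.
have := energy_vanishes; rewrite /f.
have -> : star (0 : R) xs = xs.
  by apply: dual_ext => x; rewrite adj_semigroupE normr0 (semigroup0 hS).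
by move=> /eqP; rewrite addr_eq0 => /eqP.
Qed.

End Lyapunov.

(** * Hilbert spaces and the reproducing kernel Hilbert space *)

Lemma cvg_ord_sum {R : realType} {V : normedModType R} {T : Type} (F : set_system T)
    {FF : Filter F} n (f : 'I_n -> T -> V) (l : 'I_n -> V) :
  (forall i, f i x @[x --> F] --> l i) ->
  \sum_(i < n) f i x @[x --> F] --> \sum_(i < n) l i.
Proof.
elim: n f l => [|n IH] f l fl.
  by rewrite big_ord0; under eq_fun do rewrite big_ord0; exact: cvg_cst.
rewrite big_ord_recr/=; under eq_fun do rewrite big_ord_recr/=.
by apply: cvgD => //; exact: IH.
Qed.

Section HilbertSpace.
Context {R : realType} {H : completeNormedModType R} (ip : {dot H for idfun}).
Hypothesis hN : hilbert_norm ip.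
Implicit Types (u v w h : H).

Lemma ipC u v : ip u v = ip v u.
Proof. by rewrite hermC expr0 mul1r. Qed.

Lemma ipDl u v w : ip (u + v) w = ip u w + ip v w.
Proof. exact: linearDl. Qed.

Lemma ipDr u v w : ip w (u + v) = ip w u + ip w v.
Proof. exact: linearDr. Qed.

Lemma ipZl (a : R) u w : ip (a *: u) w = a * ip u w.
Proof. exact: linearZl_LR. Qed.

Lemma ipZr (a : R) u w : ip w (a *: u) = a * ip w u.
Proof. by rewrite ipC ipZl ipC. Qed.

Lemma ip0l w : ip 0 w = 0. Proof. by rewrite -(scale0r 0) ipZl mul0r. Qed.

Lemma ip0r w : ip w 0 = 0. Proof. by rewrite ipC ip0l. Qed.

Lemma ipNl u w : ip (- u) w = - ip u w.
Proof. by rewrite -scaleN1r ipZl mulN1r. Qed.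

Lemma ipNr u w : ip w (- u) = - ip w u.
Proof. by rewrite ipC ipNl ipC. Qed.

Lemma ipBl u v w : ip (u - v) w = ip u w - ip v w.
Proof. by rewrite ipDl ipNl. Qed.

Lemma ipBr u v w : ip w (u - v) = ip w u - ip w v.
Proof. by rewrite ipDr ipNr. Qed.

Lemma ip_suml n (F : 'I_n -> H) w : ip (\sum_i F i) w = \sum_i ip (F i) w.
Proof. by elim/big_rec2: _ => [|i y x _ <-]; rewrite ?ip0l ?ipDl. Qed.

Lemma ip_sumr n (F : 'I_n -> H) w : ip w (\sum_i F i) = \sum_i ip w (F i).
Proof. by rewrite ipC ip_suml; apply: eq_bigr => i _; rewrite ipC. Qed.

Lemma ip_sq u : ip u u = `|u| ^+ 2. Proof. by rewrite hN. Qed.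

Lemma ip_self0 u : ip u u = 0 -> u = 0.
Proof. by rewrite ip_sq => /eqP; rewrite sqrf_eq0 normr_eq0 => /eqP. Qed.

Lemma normB_sq u v : `|u - v| ^+ 2 = `|u| ^+ 2 - 2 * ip u v + `|v| ^+ 2.
Proof. by rewrite -!ip_sq ipBl !ipBr (ipC v u); ring. Qed.

Lemma cauchy_schwarz u v : `|ip u v| <= `|u| * `|v|.
Proof.
have [->|v0] := eqVneq v 0; first by rewrite ip0r !normr0 mulr0.
have v1 : 0 < `|v| ^+ 2 by rewrite exprn_gt0// normr_gt0.
rewrite -(ler_pXn2r (n := 2)) ?nnegrE ?mulr_ge0// real_normK ?num_real// exprMn.
have := sqr_ge0 `|u - (ip u v / `|v| ^+ 2) *: v|.
rewrite normB_sq normrZ exprMn ipZr real_normK ?num_real// => h.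
have : 0 <= (`|u| ^+ 2 - 2 * (ip u v / `|v| ^+ 2 * ip u v) +
  (ip u v / `|v| ^+ 2) ^+ 2 * `|v| ^+ 2) * `|v| ^+ 2.
  by rewrite mulr_ge0// ltW.
set N := `|v| ^+ 2 in v1 *; have N0 : N != 0 by rewrite gt_eqF.
suff -> : (`|u| ^+ 2 - 2 * (ip u v / N * ip u v) + (ip u v / N) ^+ 2 * N) * N =
  `|u| ^+ 2 * N - ip u v ^+ 2 by rewrite subr_ge0.
by field.
Qed.

Lemma ip_continuous u : continuous (ip u : H -> R).
Proof.
move=> v; apply/cvgrPdist_le => e e0; near=> w.
rewrite -ipBr (le_trans (cauchy_schwarz _ _))//.
have : `|v - w| <= e / (`|u| + 1).
  near: w; apply: cvgr_dist_le; first exact: cvg_id.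
  by rewrite divr_gt0// ltr_wpDl.
rewrite ler_pdivlMr ?ltr_wpDl// => h.
by have := normr_ge0 (v - w); have := normr_ge0 u; nra.
Unshelve. all: by end_near. Qed.

Lemma ip_cvgr u (v : nat -> H) l : v n @[n --> \oo] --> l ->
  ip u (v n) @[n --> \oo] --> ip u l.
Proof. by move=> h; apply: (cvg_comp _ _ h); exact: ip_continuous. Qed.

Lemma ip_cvg {T : Type} (F : set_system T) {FF : Filter F} (u v : T -> H) (a b : H) :
  u x @[x --> F] --> a -> v x @[x --> F] --> b ->
  ip (u x) (v x) @[x --> F] --> ip a b.
Proof.
have polar w z : ip w z = 4^-1 * (`|w + z| ^+ 2 - `|w - z| ^+ 2).
  by rewrite -!ip_sq !ipDl !ipDr !ipNl !ipNr (ipC z w); field.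
move=> ua vb; rewrite polar; under eq_fun do rewrite polar.
apply: cvgM; first exact: cvg_cst.
under eq_fun do rewrite !expr2; rewrite !expr2.
by apply: cvgB; apply: cvgM; apply: cvg_norm; first [exact: cvgD|exact: cvgB].
Qed.

(** Projection onto a subspace that need not be closed: a minimising sequence is Cauchy by the
    parallelogram law, and the residue at its limit is orthogonal to the subspace, hence zero. *)
Lemma orthogonal_dense (M : set H) : M 0 ->
  (forall (a : R) u v, M u -> M v -> M (a *: u + v)) ->
  (forall h, (forall m, M m -> ip m h = 0) -> h = 0) ->
  forall h (e : R), 0 < e -> exists2 m, M m & `|h - m| < e.
Proof.
move=> M0 ML Mp h.
pose E := [set `|h - m| ^+ 2 | m in M].
have hE : has_inf E.
  by split; [exists (`|h - 0| ^+ 2), 0|exists 0 => _ [m _ <-]; exact: sqr_ge0].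
have infle m : M m -> inf E <= `|h - m| ^+ 2.
  by move=> Mm; apply: ge_inf; [by have [] := hE|exists m].
have /choice[m hm] : forall n : nat, exists m, M m /\
    `|h - m| ^+ 2 < inf E + n.+1%:R^-1.
  move=> n; have n0 : 0 < n.+1%:R^-1 :> R by [].
  by have [_ [m Mm <-] lm] := inf_adherent n0 hE; exists m.
have dist i j : `|m i - m j| ^+ 2 <= 2 * (i.+1%:R^-1 + j.+1%:R^-1).
  have [Mi hi] := hm i; have [Mj hj] := hm j.
  (* The midpoint, written in the form [a *: u + v] of the closure hypothesis. *)
  have := infle (2^-1 *: m i + (2^-1 *: m j + 0)).
  move=> /(_ (ML _ _ _ Mi (ML _ _ _ Mj M0))); rewrite addr0.
  have -> : h - (2^-1 *: m i + 2^-1 *: m j) =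
      2^-1 *: (h - m i) - 2^-1 *: (m j - h).
    rewrite -scalerBr -scalerDr opprB addrACA -opprD scalerBr; congr (_ - _).
    by rewrite scalerDr -scalerDl (_ : 2^-1 + 2^-1 = 1) ?scale1r//; lra.
  have -> : m i - m j = (h - m j) - (h - m i).
    by rewrite opprB [RHS]addrC addrA subrK.
  rewrite -scalerBr normrZ exprMn ger0_norm// (normB_sq (h - m j)).
  rewrite -(opprB h (m j)) (normB_sq _ (- _)) normrN ipNr (ipC (h - m i)).
  move: hi hj; set a := _ ^+ 2; set b := _ ^+ 2; set c := ip _ _.
  move: (i.+1%:R^-1) (j.+1%:R^-1) => x y; lra.
have small (e : R) : 0 < e -> exists N, forall i j, (N <= i)%N -> (N <= j)%N ->
    `|m i - m j| < e.
  move=> e0; exists (Num.truncn (4 / e ^+ 2)) => i j Ni Nj.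
  rewrite -(ltr_pXn2r (n := 2)) ?nnegrE ?(ltW e0)//.
  apply: le_lt_trans (dist i j) _.
  have e2 : 0 < e ^+ 2 by rewrite exprn_gt0.
  have hk k' : (Num.truncn (4 / e ^+ 2) <= k')%N -> k'.+1%:R^-1 < e ^+ 2 / 4.
    move=> kk; rewrite -[e ^+ 2 / 4]invrK ltf_pV2 ?posrE ?invr_gt0 ?divr_gt0//.
    rewrite invf_div; apply: (lt_le_trans (truncnS_gt _)).
    by rewrite ler_nat.
  have := hk i Ni; have := hk j Nj.
  move: (i.+1%:R^-1) (j.+1%:R^-1) => x y; lra.
have cm : cvgn m by exact: cauchy_seq_cvg.
have ort k w : M w -> ip w (h - m k) ^+ 2 <= `|w| ^+ 2 * k.+1%:R^-1.
  move=> Mw; have [Mk hk] := hm k.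
  have [->|w0] := eqVneq w 0; first by rewrite ip0l normr0 !expr0n/= mul0r.
  have w1 : 0 < `|w| ^+ 2 by rewrite exprn_gt0// normr_gt0.
  (* [t *: w] is the projection of the residue on [w], the best correction in that direction. *)
  pose t := ip w (h - m k) / `|w| ^+ 2.
  have := infle (t *: w + m k) (ML _ _ _ Mw Mk).
  have -> : h - (t *: w + m k) = (h - m k) - t *: w by rewrite opprD addrCA addrC.
  rewrite normB_sq ipZr (ipC (h - m k)) normrZ exprMn real_normK ?num_real//.
  have -> : ip w (h - m k) = t * `|w| ^+ 2 by rewrite /t divfK ?gt_eqF.
  move: hk w1; set a := _ ^+ 2; set b := _ ^+ 2; move: (k.+1%:R^-1) => x.
  move=> h1 h2 h3.
  have h4 : t ^+ 2 * b < x by nra.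
  by rewrite exprMn expr2 mulrA mulrC ler_pM2l// ltW.
have hl : h - limn m = 0.
  apply: Mp => w Mw; apply/eqP; rewrite -sqrf_eq0.
  have c1 : ip w (h - m k) ^+ 2 @[k --> \oo] --> ip w (h - limn m) ^+ 2.
    have c0 : ip w (h - m k) @[k --> \oo] --> ip w (h - limn m).
      by apply: ip_cvgr; apply: cvgB => //; exact: cvg_cst.
    by rewrite expr2; under eq_cvg do rewrite expr2; exact: cvgM.
  apply/eqP/(cvg_unique _ c1) => //.
  apply: (@cvg_harmonic_bound _ _ _ _ (`|w| ^+ 2)) => n.
  by rewrite subr0 ger0_norm ?sqr_ge0// ort.
move=> e e0; have [N hNe] := small _ e0.
have /cvgrPdist_lt/(_ _ e0) := cm.
rewrite -(subr0_eq hl) => -[K _ hK]; exists (m K); first by have [] := hm K.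
by apply: hK => /=.
Qed.

(** * Orthonormal bases, Parseval's identity and the trace *)

Section OrthonormalBasis.
Variable e : nat -> H.
Hypothesis eB : orthonormal_basis ip e.

Let P (b : H) (n : nat) : H := \sum_(k < n) ip b (e k) *: e k.

(** When [e j = 0] both sides vanish, so zero vectors in the family are harmless. *)
Lemma ip_proj b n j : ip (P b n) (e j) = if (j < n)%N then ip b (e j) else 0.
Proof.
have [e1 e0 _] := eB.
rewrite /P ip_suml; under eq_bigr do rewrite ipZl.
case: ifPn => jn.
  rewrite (bigD1 (Ordinal jn))//= big1 ?addr0 => [|i ij].
    by have [->|->] := e1 j; rewrite ?mulr1// !ip0r mulr0.
  rewrite e0 ?mulr0// => E; move/eqP: ij; apply; exact: val_inj.
rewrite big1// => i _; rewrite e0 ?mulr0// => E.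
by move: jn; rewrite -E ltn_ord.
Qed.

Lemma ip_proj_proj b m n : (m <= n)%N ->
  ip (P b n) (P b m) = \sum_(k < m) ip b (e k) ^+ 2.
Proof.
move=> mn; rewrite {2}/P ip_sumr; apply: eq_bigr => k _.
by rewrite ipZr ip_proj (leq_trans (ltn_ord k) mn) expr2.
Qed.

Lemma proj_dist b m n : (m <= n)%N -> `|P b n - P b m| ^+ 2 =
  \sum_(k < n) ip b (e k) ^+ 2 - \sum_(k < m) ip b (e k) ^+ 2.
Proof.
move=> mn; rewrite normB_sq (ip_proj_proj _ mn) -!ip_sq !ip_proj_proj//; ring.
Qed.

Lemma bessel b n : \sum_(k < n) ip b (e k) ^+ 2 <= `|b| ^+ 2.
Proof.
have := sqr_ge0 `|b - P b n|.
rewrite normB_sq -(ip_sq (P b n)) ip_proj_proj//.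
have -> : ip b (P b n) = \sum_(k < n) ip b (e k) ^+ 2.
  by rewrite /P ip_sumr; apply: eq_bigr => k _; rewrite ipZr expr2.
by lra.
Qed.

(** The partial sums are Cauchy by Bessel's inequality, and their limit has the coefficients of [b],
    so totality identifies it. *)
Lemma proj_cvg b : P b n @[n --> \oo] --> b.
Proof.
pose s n := \sum_(k < n) ip b (e k) ^+ 2.
have sn : nondecreasing_seq s.
  apply/nondecreasing_seqP => n; rewrite /s big_ord_recr/= lerDl sqr_ge0//.
have cs : cvgn s.
  apply: nondecreasing_is_cvgn => //; exists (`|b| ^+ 2) => _ [n _ <-].
  exact: bessel.
have cP : cvgn (P b).
  apply: cauchy_seq_cvg => d d0.
  have d2 : 0 < d ^+ 2 / 2 by rewrite divr_gt0// exprn_gt0.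
  have /cvgrPdist_lt/(_ _ d2)[N _ hN'] := cs.
  exists N.
  have key m n : (N <= m)%N -> (m <= n)%N -> `|P b n - P b m| < d.
    move=> Nm mn; rewrite -(ltr_pXn2r (n := 2)) ?nnegrE ?(ltW d0)//.
    rewrite proj_dist//; have := hN' m Nm; have := hN' n (leq_trans Nm mn).
    by rewrite !ltr_norml /s; lra.
  move=> m n Nm Nn; have [mn|nm] := leqP m n; last exact: key Nn (ltnW nm).
  by rewrite distrC; exact: key.
have [_ _ eT] := eB.
suff E : b = limn (P b) by move: cP; rewrite -[limn _]/(limn (P b)) -E.
apply/subr0_eq/eT => j.
have c1 : ip (e j) (b - P b n) @[n --> \oo] --> ip (e j) (b - limn (P b)).
  by apply: ip_cvgr; apply: cvgB => //; exact: cvg_cst.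
rewrite ipC; apply: (cvg_unique _ c1) => //.
apply: (@cvg_trans _ (cst (0 : R) @ \oo)); last exact: cvg_cst.
apply: near_eq_cvg; exists j.+1 => // n /= jn.
by rewrite ipBr (ipC _ (P b n)) ip_proj jn ipC subrr.
Qed.

Lemma parseval a b :
  series (fun k => ip a (e k) * ip b (e k)) @ \oo --> ip a b.
Proof.
have := @ip_cvgr a _ _ (@proj_cvg b); apply: cvg_trans; apply: near_eq_cvg.
near=> n; rewrite /series/= big_mkord /P ip_sumr; apply: eq_bigr => k _.
by rewrite ipZr mulrC.
Unshelve. all: by end_near. Qed.

End OrthonormalBasis.

Section GramSchmidt.
Variable a : nat -> H.
Hypothesis aT : forall h, (forall n, ip h (a n) = 0) -> h = 0.

Let residue (f : nat -> H) n : H := a n - \sum_(k < n) ip (a n) (f k) *: f k.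

(** Stage [n] carries the whole family built so far, since each residue refers to all earlier
    vectors; [e] reads off the diagonal. As [0^-1 = 0], a dependent vector yields the zero vector,
    which [orthonormal_basis] admits. *)
Fixpoint gram_schmidt_rec n : nat -> H :=
  if n is m.+1 then
    let f := gram_schmidt_rec m in
    fun k => if k == m then `|residue f m|^-1 *: residue f m else f k
  else fun=> 0.

Let e k := gram_schmidt_rec k.+1 k.

Lemma gram_schmidt_recE n k : (k < n)%N -> gram_schmidt_rec n k = e k.
Proof.
elim: n => // n IH; rewrite ltnS leq_eqVlt => /predU1P[->//|kn].
by rewrite /= ltn_eqF// IH.
Qed.

Lemma gram_schmidtE n : e n = `|residue e n|^-1 *: residue e n.
Proof.
rewrite /e/= eqxx; congr (_ *: _); first congr (`|_|^-1).
all: congr (_ - _); apply: eq_bigr => k _.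
all: by rewrite gram_schmidt_recE.
Qed.

Lemma gram_schmidt_unit n : ip (e n) (e n) = 1 \/ e n = 0.
Proof.
have [r0|r0] := eqVneq (residue e n) 0.
  by right; rewrite gram_schmidtE r0 scaler0.
left; rewrite ip_sq gram_schmidtE normrZ normfV normr_id mulVf ?expr1n//.
by rewrite normr_eq0.
Qed.

Lemma gram_schmidt_orth n k : (k < n)%N -> ip (e n) (e k) = 0.
Proof.
elim/ltn_ind: n k => n IH k kn.
rewrite gram_schmidtE ipZl; suff -> : ip (residue e n) (e k) = 0 by rewrite mulr0.
rewrite ipBl ip_suml (bigD1 (Ordinal kn))//= big1 ?addr0 => [|i ik].
  rewrite ipZl; have [->|->] := gram_schmidt_unit k.
    by rewrite mulr1 subrr.
  by rewrite !ip0r mulr0 subrr.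
rewrite ipZl; have [ik'|ki|ik'] := ltngtP i k.
- by rewrite ipC (IH k kn i ik') mulr0.
- by rewrite (IH i (ltn_ord i) k ki) mulr0.
- by case/eqP: ik; exact: val_inj.
Qed.

Lemma orthonormal_basis_exists : exists e : nat -> H, orthonormal_basis ip e.
Proof.
exists e; split=> [j|j k jk|h he]; first exact: gram_schmidt_unit.
  have [jk'|kj|/jk//] := ltngtP j k; last exact: gram_schmidt_orth.
  by rewrite ipC gram_schmidt_orth.
apply: aT => n.
have -> : a n = residue e n + \sum_(k < n) ip (a n) (e k) *: e k.
  by rewrite /residue subrK.
rewrite ipDr ip_sumr big1 ?addr0 => [|k _]; last by rewrite ipZr he mulr0.
have [->|r0] := eqVneq (residue e n) 0; first exact: ip0r.
have := he n; rewrite gram_schmidtE ipZr => /eqP.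
by rewrite mulf_eq0 invr_eq0 normr_eq0 (negbTE r0)/= => /eqP.
Qed.

(** Parseval gives the same sum in every basis. The existence of one basis matters: without it every
    real number would satisfy the description from which [trace] chooses. *)
Lemma trace_tensor_sum n (c : 'I_n -> 'I_n -> R) (u v : 'I_n -> H) :
  trace ip (fun h => \sum_(j < n) \sum_(k < n) c j k *: tensor ip (u j) (v k) h) =
  \sum_(j < n) \sum_(k < n) c j k * ip (u j) (v k).
Proof.
set T := (fun h => _); set t := \sum_(j < n) _.
have hT e' : orthonormal_basis ip e' ->
    series (fun k => ip (T (e' k)) (e' k)) @ \oo --> t.
  move=> eB.
  have -> : series (fun k => ip (T (e' k)) (e' k)) = (fun m =>
      \sum_(j < n) \sum_(k < n) c j k *
      series (fun i => ip (u j) (e' i) * ip (v k) (e' i)) m).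
    apply/funext => m; rewrite /series/= /T.
    transitivity (\sum_(0 <= i < m) \sum_(j < n) \sum_(k < n)
        c j k * (ip (u j) (e' i) * ip (v k) (e' i))).
      apply: eq_bigr => i _; rewrite ip_suml; apply: eq_bigr => j _.
      rewrite ip_suml; apply: eq_bigr => k _.
      by rewrite /tensor !ipZl.
    rewrite exchange_big; apply: eq_bigr => j _.
    rewrite exchange_big; apply: eq_bigr => k _.
    by rewrite mulr_sumr.
  rewrite /t; apply: cvg_ord_sum => j; apply: cvg_ord_sum => k.
  by apply: cvgM; [exact: cvg_cst|exact: (parseval eB)].
have [e' eB] := orthonormal_basis_exists.
have xP : [set t' : R | forall e', orthonormal_basis ip e' ->
    series (fun k => ip (T (e' k)) (e' k)) @ \oo --> t'] t by [].
have := xgetPex 0 (ex_intro _ t xP) => /(_ e' eB) h.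
exact: (cvg_unique _ h (hT e' eB)).
Qed.

End GramSchmidt.

End HilbertSpace.

Section Separable.
Context {R : realType} {X : completeNormedModType R}.

Lemma dense_ball (S : set X) : dense S -> forall x (e : R), 0 < e ->
  exists2 y, S y & `|x - y| < e.
Proof.
move=> dS x e e0.
have [||y [By Sy]] := dS (ball x e).
- by exists x; exact: ballxx.
- exact: ball_open.
by exists y => //; rewrite -ball_normE in By.
Qed.

Hypothesis hX : exists2 S : set X, countable S & dense S.

Lemma dense_sequence : exists d : nat -> X, forall x (e : R), 0 < e ->
  exists n, `|x - d n| < e.
Proof.
have [S /countable_injP[f finj] dS] := hX.
exists (fun n => xget 0 [set x | S x /\ f x = n]) => x e e0.
have [y Sy xy] := dense_ball dS x e0; exists (f y).
have hy : [set z | S z /\ f z = f y] y by [].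
have [Sz fz] := xgetPex 0 (ex_intro _ y hy).
by rewrite (finj _ _ _ _ fz) ?inE.
Qed.

(** Functionals norming a dense sequence: if [x] is within [e / 2] of [d n], then [y n x] misses the
    norm of [x] by less than [e]. *)
Lemma norming_sequence : exists y : nat -> dual X,
  (forall n x, `|y n x : R| <= `|x|) /\
  forall x (e : R), 0 < e -> exists n, `|x| - e < (y n x : R).
Proof.
have [d hd] := dense_sequence.
have /choice[y hy] n := norming_functional (d n).
exists y; split=> [n x|x e e0]; first by have [] := hy n.
have e2 : 0 < e / 2 by rewrite divr_gt0.
have [n hn] := hd x _ e2; exists n.
have [h1 h2] := hy n.
have := h1 (x - d n); rewrite dual_subv h2 ler_norml => /andP[h3 _].
have := ler_normD (x - d n) (d n); rewrite subrK; lra.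
Qed.

End Separable.

(** * Density in the reproducing kernel Hilbert space and skewness of [B] *)

Section RKHS.
Context {R : realType} {X H : completeNormedModType R}.
Variables (Q : {linear dual X -> X}) (ip : {dot H for idfun}).
Variables (i : {linear H -> X}) (istar : dual X -> H).
Hypothesis hH : is_RKHS Q ip i istar.
Implicit Types (xs ys : dual X) (h k : H).

Let hN : hilbert_norm ip := RKHS_norm hH.

Lemma istar_linear : linear istar.
Proof.
move=> a xs ys; apply/subr0_eq/(ip_self0 hN); set w := _ - _.
rewrite {1}/w ipBl ipDl ipZl !(RKHS_adjoint hH) dualD dualZ.
by rewrite subrr.
Qed.

Lemma istar0 : istar 0 = 0.
Proof.
have := istar_linear (-1) 0 0; rewrite addr0 scaler0 scaleN1r addNr.
by [].
Qed.

Lemma istarD xs ys : istar (xs + ys) = istar xs + istar ys.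
Proof. by have := istar_linear 1 xs ys; rewrite !scale1r. Qed.

Lemma istarZ (a : R) xs : istar (a *: xs) = a *: istar xs.
Proof. by have := istar_linear a xs 0; rewrite addr0 istar0 addr0. Qed.

Lemma istar_sum n (F : 'I_n -> dual X) : istar (\sum_(j < n) F j) = \sum_(j < n) istar (F j).
Proof. by apply: big_morph; [exact: istarD|exact: istar0]. Qed.

(** Such an [h] is orthogonal to a dense set: by Pythagoras its norm is at most its distance to any
    point of the range. *)
Lemma istar_total h : (forall xs, (xs (i h) : R) = 0) -> h = 0.
Proof.
move=> hh; apply: (ip_self0 hN); rewrite (ip_sq hN).
apply/eqP; rewrite sqrf_eq0 -normr_le0 normr_id.
apply/ler_addgt0Pl => e e0; rewrite addr0.
have [y yE By] := dense_ball (RKHS_dense hH) h e0.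
case: yE => xs _ yE.
apply: le_trans (ltW By).
have := normB_sq hN h y; rewrite -yE ipC (RKHS_adjoint hH) hh mulr0 subr0.
by move=> E; rewrite -(ler_pXn2r (n := 2)) ?nnegrE// E lerDl sqr_ge0.
Qed.

(** Pulls a norming sequence back to [H]. The resulting total sequence is the input of Gram-Schmidt,
    so separability of [X] yields a basis of [H]. *)
Lemma istar_norming_total (y : nat -> dual X) :
  (forall x (e : R), 0 < e -> exists n, `|x| - e < (y n x : R)) ->
  forall h, (forall n, ip h (istar (y n)) = 0) -> h = 0.
Proof.
move=> hy h hh; apply: istar_total => xs.
suff -> : i h = 0 by rewrite linear0.
apply/eqP; rewrite -normr_le0; apply/ler_addgt0Pl => e e0; rewrite addr0.
have [n] := hy (i h) e e0.
by rewrite -(RKHS_adjoint hH) ipC hh subr_lt0 => /ltW.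
Qed.

Variables (S : R -> {linear X -> X}) (DA : set X) (A : X -> X).
Hypotheses (hS : contraction_semigroup S) (hA : is_generator S DA A).

Lemma adj_dom_linear (a : R) xs ys :
  adj_dom DA A xs -> adj_dom DA A ys -> adj_dom DA A (a *: xs + ys).
Proof.
move=> [us hu] [vs hv]; exists (a *: us + vs) => x Dx.
by rewrite !dualD !dualZ hu// hv.
Qed.

Lemma adj_dom0 : adj_dom DA A 0.
Proof. by exists 0 => x _. Qed.

(** The domain of the adjoint separates the points of [X], hence its image in [H] has trivial
    orthogonal complement; [orthogonal_dense] turns this into density. *)
Lemma istar_adj_dom_dense h (e : R) : 0 < e ->
  exists2 xs, adj_dom DA A xs & `|h - istar xs| < e.
Proof.
move=> e0.
have [||k hk|_ [xs Dxs <-] he] :=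
  @orthogonal_dense _ _ ip hN [set istar xs | xs in adj_dom DA A] _ _ _ h e e0.
- by exists 0; [exact: adj_dom0|exact: istar0].
- move=> a _ _ [xs Dxs <-] [ys Dys <-].
  by exists (a *: xs + ys); [exact: adj_dom_linear|rewrite istar_linear].
- apply: istar_total; apply: (adj_dom_separates hS hA) => xs Dxs.
  by rewrite -(RKHS_adjoint hH) hk//; exists xs.
- by exists xs.
Qed.

Hypotheses (hQ_bounded : dual_bounded Q)
  (hQ_sym : forall xs ys : dual X, ys (Q xs) = xs (Q ys)).
Variables (Qt : R -> dual X -> X) (Qinf : dual X -> X).
Hypotheses (hQt : forall t, 0 < t -> forall xs,
     is_weak_integral 0 t (fun s => S s (Q (adj setT (S s) xs))) (Qt t xs))
  (hQinf : forall xs ys : dual X, ys (Qt t xs) @[t --> +oo] --> ys (Qinf xs))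
  (hQinf_sym : forall xs ys : dual X, (ys (Qinf xs) : R) = xs (Qinf ys)).
Variable B : {linear H -> H}.
Hypotheses (hB_cont : continuous B)
  (hB : forall xs, adj_dom DA A xs -> i (B (istar xs)) = Qinf (adj DA A xs)).

(** On [istar xs] this is the Lyapunov equation, after exchanging [xs] and [A^* xs] by the symmetry
    of [Qinf]; density and continuity extend it to [H]. *)
Lemma B_quadratic h : ip (B h) h = - (2^-1 * `|h| ^+ 2).
Proof.
have key xs : adj_dom DA A xs ->
    ip (B (istar xs)) (istar xs) + 2^-1 * `|istar xs| ^+ 2 = 0.
  move=> Dxs; rewrite ipC (RKHS_adjoint hH) hB// hQinf_sym -(ip_sq hN).
  rewrite (RKHS_product hH).
  by rewrite (lyapunov_quadratic hQ_bounded hQ_sym hS hA Dxs hQt hQinf); lra.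
pose F k := ip (B k) k + 2^-1 * `|k| ^+ 2.
have /choice[xs hxs] : forall n : nat, exists xs,
    adj_dom DA A xs /\ `|h - istar xs| < n.+1%:R^-1.
  by move=> n; have [|xs Dxs hh] := @istar_adj_dom_dense h n.+1%:R^-1; [|exists xs].
have ch : istar (xs n) @[n --> \oo] --> h.
  apply: (@cvg_harmonic_bound _ _ _ _ 1) => n.
  by rewrite mul1r distrC ltW//; exact: (hxs n).2.
have cF : F (istar (xs n)) @[n --> \oo] --> F h.
  apply: cvgD; first by apply: (ip_cvg hN) => //; apply: (cvg_comp _ _ ch); exact: hB_cont.
  apply: cvgM; first exact: cvg_cst.
  by under eq_fun do rewrite expr2; rewrite expr2; apply: cvgM; exact: cvg_norm.
have F0 : F h = 0.
  apply: (cvg_unique _ cF) => //.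
  rewrite /= (_ : (fun n => F (istar (xs n))) = cst 0); first exact: cvg_cst.
  by apply/funext => n; exact: key (hxs n).1.
by move: F0; rewrite /F; lra.
Qed.

Lemma B_skew h k : ip (B h) k + ip h (B k) = - ip h k.
Proof.
have := B_quadratic (h + k); have := B_quadratic h; have := B_quadratic k.
rewrite -!(ip_sq hN) (linearD B) !ipDl !ipDr (ipC ip k h) (ipC ip (B k) h); lra.
Qed.

End RKHS.

(** * Square-integrable functions and one-dimensional Gaussian integrals *)

Section Density.
Context d (T : measurableType d) (R : realType).
Variables (mu nu : {measure set T -> \bar R}) (rho : T -> R).
Hypotheses (mrho : measurable_fun [set: T] rho) (rho0 : forall x, 0 <= rho x).
Hypothesis nuE : forall V, measurable V -> nu V = (\int[mu]_(x in V) (rho x)%:E)%E.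

Import HBNNSimple.
Local Open Scope ereal_scope.

(** Simple functions reduce to [nuE]; monotone convergence does the rest. *)
Lemma ge0_integral_density (f : T -> \bar R) : (forall x, 0 <= f x) ->
  measurable_fun [set: T] f -> \int[nu]_x f x = \int[mu]_x (f x * (rho x)%:E).
Proof.
move=> f0 mf; have mE := @measurableT _ T.
have mg : measurable_fun [set: T] (fun x => (rho x)%:E) by exact/measurable_EFinP.
have g0 x : 0 <= (rho x)%:E by rewrite lee_fin.
pose h := nnsfun_approx mE mf.
have -> : \int[nu]_x f x = lim (\int[nu]_x (EFin \o h n) x @[n --> \oo]).
  have fE x : f x = lim ((EFin \o h n) x @[n --> \oo]).
    by apply/esym/cvg_lim => //; exact: cvg_nnsfun_approx.
  under eq_integral do rewrite fE.
  apply: monotone_convergence => //.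
  - by move=> n; apply/measurable_EFinP.
  - by move=> n x _ //=; rewrite lee_fin.
  - by move=> x Ex a b ab; rewrite lee_fin; exact/lefP/nd_nnsfun_approx.
have -> : \int[mu]_x (f x * (rho x)%:E) =
    lim (\int[mu]_x ((EFin \o h n) x * (rho x)%:E) @[n --> \oo]).
  have fg x : f x * (rho x)%:E = lim ((EFin \o h n) x * (rho x)%:E @[n --> \oo]).
    by apply/esym/cvg_lim => //; apply: cvgeZr => //; exact: cvg_nnsfun_approx.
  under eq_integral do rewrite fg.
  apply: monotone_convergence => [//| | |].
  - by move=> n; apply/emeasurable_funM => //; exact/measurable_EFinP.
  - by move=> n x _ /=; rewrite mule_ge0 ?lee_fin.
  - by move=> x _ a b ab/=; rewrite lee_wpmul2r ?lee_fin//; exact/lefP/nd_nnsfun_approx.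
suff suf n : \int[mu]_x ((EFin \o h n) x * (rho x)%:E) =
    \int[nu]_x (EFin \o h n) x.
  by congr (lim _); under eq_fun do rewrite -suf.
transitivity (\int[nu]_x
   (\sum_(y \in range (h n)) (y * \1_(h n @^-1` [set y]) x)%:E)); last first.
  by apply: eq_integral => t tE; rewrite /= fimfunE -fsumEFin.
have indich m r : measurable_fun [set: T] (fun x => (r * \1_(h m @^-1` [set r]) x)%:E).
  by apply: (measurable_comp measurableT) => //; exact: measurable_funM.
rewrite ge0_integral_fsum//; last by move=> m y Ey; exact: nnfun_muleindic_ge0.
transitivity (\int[mu]_x (\sum_(y \in range (h n))
    (y * \1_(h n @^-1` [set y]) x)%:E * (rho x)%:E)).
  under [RHS]eq_integral => x xE.
    rewrite -ge0_mule_fsuml => [|y]; last exact: nnfun_muleindic_ge0.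
    rewrite fsumEFin // -(fimfunE _ x); over.
  by [].
rewrite ge0_integral_fsum//; last 2 first.
  - by move=> y; apply: emeasurable_funM.
  - by move=> m y Ey; rewrite mule_ge0// nnfun_muleindic_ge0.
apply: eq_fsbigr => r rhn.
under [RHS]eq_integral do rewrite EFinM.
rewrite integralZl_indic_nnsfun => //.
under eq_integral do rewrite EFinM -muleA.
rewrite ge0_integralZl//.
- under eq_integral do rewrite muleC.
  rewrite (eq_integral ((EFin \o rho) \_ (h n @^-1` [set r]))); last first.
    by move=> x xE; rewrite epatch_indic.
  by rewrite -integral_mkcondr setTI -nuE// integral_indic// setIT.
- by apply: emeasurable_funM => //; exact/measurable_EFinP.
- by move=> x _; rewrite mule_ge0// lee_fin.
- by move: rhn; rewrite inE => -[t _ <-]; rewrite lee_fin.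
Qed.

Lemma integrable_density (f : T -> R) : measurable_fun [set: T] f ->
  nu.-integrable [set: T] (EFin \o f) <->
  mu.-integrable [set: T] (EFin \o (fun x => f x * rho x)%R).
Proof.
move=> mf.
have E : \int[nu]_x `|(f x)%:E| = \int[mu]_x `|(f x * rho x)%:E|.
  rewrite ge0_integral_density//; last first.
    by apply: measurableT_comp => //; exact/measurable_EFinP.
  by apply: eq_integral => x _; rewrite EFinM abseM (gee0_abs (_ : 0 <= (rho x)%:E)) ?lee_fin.
split=> /integrableP[_ i1]; apply/integrableP; split.
- by apply/measurable_EFinP; exact: measurable_funM.
- by move: i1; rewrite /comp E.
- exact/measurable_EFinP.
- by rewrite /comp E.
Qed.

Lemma Rintegral_density (f : T -> R) : measurable_fun [set: T] f ->
  (\int[nu]_x f x = \int[mu]_x (f x * rho x))%R.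
Proof.
move=> mf; rewrite /Rintegral; congr fine.
rewrite integralE [RHS]integralE !ge0_integral_density//.
- congr (_ - _); apply: eq_integral => x _; rewrite ?funeposE ?funenegE/=.
  + by rewrite -[0]/(0%:E) -!EFin_max -EFinM maxr_pMl// mul0r.
  + by rewrite -[0]/(0%:E) -!EFin_max -EFinM maxr_pMl// mul0r mulNr.
- by apply: measurable_funeneg; exact/measurable_EFinP.
- by apply: measurable_funepos; exact/measurable_EFinP.
Qed.

End Density.

Section DominatedConvergence.
Context d (T : measurableType d) (R : realType) (mu : {measure set T -> \bar R}).

Lemma dominated_Rintegral_cvg (f_ : nat -> T -> R) (f g : T -> R) :
  (forall n, measurable_fun [set: T] (f_ n)) ->
  (forall x, f_ n x @[n --> \oo] --> f x) ->
  mu.-integrable [set: T] (EFin \o g) ->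
  (forall n x, `|f_ n x| <= g x) ->
  mu.-integrable [set: T] (EFin \o f) /\
  \int[mu]_x f_ n x @[n --> \oo] --> \int[mu]_x f x.
Proof.
move=> mf_ f_f ig f_g.
have mf : measurable_fun [set: T] f by exact: measurable_fun_cvg.
have [|||||iF _ h] := @dominated_convergence _ _ _ mu setT measurableT
  (fun n => EFin \o f_ n) (EFin \o f) (EFin \o g).
- by move=> n; exact/measurable_EFinP.
- exact/measurable_EFinP.
- by apply: aeW => x _; apply: cvg_EFin (f_f x); apply: nearW.
- exact: ig.
- by apply: aeW => x n _; rewrite lee_fin.
split => //; apply: fine_cvg.
by rewrite /Rintegral fineK//; exact: integrable_fin_num iF.
Qed.

End DominatedConvergence.

(** * Square-integrable functions *)

Section SquareIntegrable.
Context d (T : measurableType d) (R : realType) (mu : {measure set T -> \bar R}).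
Implicit Types f g : T -> R.

(** Membership in L^2, stated through the integral of the square so that products and limits are
    computed with real integrals. *)
Definition sqint f := measurable_fun [set: T] f /\
  mu.-integrable [set: T] (EFin \o (fun x => f x ^+ 2)).

Lemma integrable_le f g : measurable_fun [set: T] f ->
  (forall x, `|f x| <= g x) -> mu.-integrable [set: T] (EFin \o g) ->
  mu.-integrable [set: T] (EFin \o f).
Proof.
move=> mf fg; apply: le_integrable => //; first exact/measurable_EFinP.
by move=> x _ /=; rewrite lee_fin (le_trans (fg x))// ler_norm.
Qed.

Lemma RintegrableD f g : mu.-integrable [set: T] (EFin \o f) ->
  mu.-integrable [set: T] (EFin \o g) ->
  mu.-integrable [set: T] (EFin \o (fun x => f x + g x)).
Proof. by move=> i1 i2; have := integrableD measurableT i1 i2. Qed.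

Lemma RintegrableZ (a : R) f : mu.-integrable [set: T] (EFin \o f) ->
  mu.-integrable [set: T] (EFin \o (fun x => a * f x)).
Proof. by move=> i1; have := integrableZl measurableT a i1. Qed.

Lemma Rintegrable0 : mu.-integrable [set: T] (EFin \o (fun=> 0 : R)).
Proof. exact: integrable0. Qed.

Lemma Rintegrable_sum n (F : 'I_n -> T -> R) :
  (forall i, mu.-integrable [set: T] (EFin \o F i)) ->
  mu.-integrable [set: T] (EFin \o (fun x => \sum_(i < n) F i x)).
Proof.
move=> iF; have -> : (fun x => \sum_(i < n) F i x) = \sum_(i < n) F i.
  by apply/funext => x; rewrite fct_sumE.
elim/big_ind: _ => //; first exact: Rintegrable0.
by move=> f g i1 i2; exact: RintegrableD.
Qed.

Lemma Rintegral_sum n (F : 'I_n -> T -> R) :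
  (forall i, mu.-integrable [set: T] (EFin \o F i)) ->
  \int[mu]_x \sum_(i < n) F i x = \sum_(i < n) \int[mu]_x F i x.
Proof.
elim: n F => [|n IH] F iF.
  by under eq_Rintegral do rewrite big_ord0; rewrite big_ord0 Rintegral_cst// mul0r.
under eq_Rintegral do rewrite big_ord_recr/=.
by rewrite RintegralD//; [rewrite IH// big_ord_recr|exact: Rintegrable_sum].
Qed.

Lemma sqint_mul f g : sqint f -> sqint g ->
  mu.-integrable [set: T] (EFin \o (fun x => f x * g x)).
Proof.
move=> [mf i1] [mg i2].
apply: (@integrable_le _ (fun x => f x ^+ 2 + g x ^+ 2)).
- exact: measurable_funM.
- move=> x; rewrite normrM -(real_normK (num_real (f x))).
  rewrite -(real_normK (num_real (g x))).
  by have := sqr_ge0 (`|f x| - `|g x|); have := sqr_ge0 (`|f x| + `|g x|); nra.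
- exact: RintegrableD.
Qed.

Lemma sqint_le f g : measurable_fun [set: T] f -> (forall x, `|f x| <= `|g x|) ->
  sqint g -> sqint f.
Proof.
move=> mf fg [mg ig]; split => //.
apply: (@integrable_le _ (fun x => g x ^+ 2)) => //; first exact: measurable_funX.
move=> x; rewrite normrX -(real_normK (num_real (g x))).
by rewrite ler_pXn2r ?nnegrE.
Qed.

Lemma sqintZ (a : R) f : sqint f -> sqint (fun x => a * f x).
Proof.
move=> [mf i1]; split; first exact: measurable_funM.
by under eq_fun do rewrite exprMn; exact: RintegrableZ.
Qed.

Lemma sqintD f g : sqint f -> sqint g -> sqint (fun x => f x + g x).
Proof.
move=> sf sg; have [mf i1] := sf; have [mg i2] := sg.
split; first exact: measurable_funD.
under eq_fun do rewrite sqrrD -mulr_natl.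
apply: RintegrableD => //; apply: RintegrableD => //.
by apply: RintegrableZ; exact: sqint_mul.
Qed.

Lemma sqintB f g : sqint f -> sqint g -> sqint (fun x => f x - g x).
Proof.
move=> sf sg; have := sqintD sf (sqintZ (-1) sg).
by under eq_fun do rewrite mulN1r.
Qed.

Lemma sqint0 : sqint (fun=> 0).
Proof.
by split => //; under eq_fun do rewrite expr0n/=; exact: Rintegrable0.
Qed.

Lemma sqint_sum n (F : 'I_n -> T -> R) : (forall i, sqint (F i)) ->
  sqint (fun x => \sum_(i < n) F i x).
Proof.
move=> iF; have -> : (fun x => \sum_(i < n) F i x) = \sum_(i < n) F i.
  by apply/funext => x; rewrite fct_sumE.
elim/big_ind: _ => //; first exact: sqint0.
by move=> f g i1 i2; exact: sqintD.
Qed.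

Lemma sqint_bounded f g (C : R) : measurable_fun [set: T] f ->
  (forall x, `|f x| <= C) -> sqint g -> sqint (fun x => f x * g x).
Proof.
move=> mf fC sg; apply: (@sqint_le _ (fun x => C * g x)).
- by apply: measurable_funM => //; exact: sg.1.
- move=> x; rewrite !normrM ler_wpM2r// (le_trans (fC x))//.
  exact: ler_norm.
- exact: sqintZ.
Qed.

Lemma amgm_weighted (a b t : R) : 0 < t ->
  `|a * b| <= (2 * t)^-1 * a ^+ 2 + t / 2 * b ^+ 2.
Proof.
move=> t0; have t2 : 0 < 2 * t by rewrite mulr_gt0.
rewrite -(ler_pM2l t2) mulrDr mulVKf ?gt_eqF// normrM.
rewrite -(real_normK (num_real a)) -(real_normK (num_real b)).
by have := sqr_ge0 (`|a| - t * `|b|); lra.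
Qed.

(** [amgm_weighted] takes the place of Cauchy-Schwarz; the weight [t = e / (K + 1)] makes each of
    its two terms at most [e / 2]. *)
Lemma sqint_cvg0 (F G : nat -> T -> R) (K : R) :
  (forall n, sqint (F n)) -> (forall n, sqint (G n)) ->
  (forall n, \int[mu]_x G n x ^+ 2 <= K) ->
  \int[mu]_x F n x ^+ 2 @[n --> \oo] --> 0 ->
  \int[mu]_x (F n x * G n x) @[n --> \oo] --> 0.
Proof.
move=> sF sG GK F0.
have K0 : 0 <= K by rewrite (le_trans _ (GK 0%N))// Rintegral_ge0// => x _; exact: sqr_ge0.
apply/cvgrPdist_le => e e0.
pose t := e / (K + 1).
have t0 : 0 < t by rewrite divr_gt0// ltr_wpDl.
have et : 0 < e * t by rewrite mulr_gt0.
move/cvgrPdist_le/(_ _ et) : F0 => F0; near=> n.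
have h1 : \int[mu]_x F n x ^+ 2 <= e * t.
  rewrite -[leLHS]ger0_norm; last by rewrite Rintegral_ge0// => x _; exact: sqr_ge0.
  by rewrite -[leLHS]normrN -sub0r; near: n.
rewrite sub0r normrN (le_trans (le_normr_Rintegral _ (sqint_mul (sF n) (sG n))))//.
have iFn := (sF n).2; have iGn := (sG n).2.
have iq : mu.-integrable [set: T]
    (EFin \o (fun x => (2 * t)^-1 * F n x ^+ 2 + t / 2 * G n x ^+ 2)).
  by apply: RintegrableD; exact: RintegrableZ.
have iN : mu.-integrable [set: T] (EFin \o (fun x => `|F n x * G n x|)).
  apply: (@integrable_le _ _ _ _ iq) => [|x]; last first.
    by rewrite normr_id; exact: amgm_weighted.
  apply: measurableT_comp => //; apply: measurable_funM.
    exact: (sF n).1.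
  exact: (sG n).1.
apply: (@le_trans _ _ (\int[mu]_x ((2 * t)^-1 * F n x ^+ 2 + t / 2 * G n x ^+ 2))).
  by apply: le_Rintegral => // x _; exact: amgm_weighted.
rewrite RintegralD//; [|exact: RintegrableZ..].
rewrite !RintegralZl//.
have h2 := GK n.
have h3 : (2 * t)^-1 * \int[mu]_x F n x ^+ 2 <= e / 2.
  have t2 : 0 < 2 * t by rewrite mulr_gt0.
  by rewrite -(ler_pM2l t2) mulVKf ?gt_eqF// (le_trans h1)//; lra.
have h4 : t / 2 * \int[mu]_x G n x ^+ 2 <= e / 2.
  apply: (@le_trans _ _ (t / 2 * K)); first by rewrite ler_pM2l// divr_gt0.
  rewrite mulrAC ler_pM2r ?invr_gt0// /t mulrAC ler_pdivrMr ?ltr_wpDl//.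
  by rewrite ler_pM2l// lerDl.
by rewrite [e]splitr lerD.
Unshelve. all: by end_near. Qed.

End SquareIntegrable.

(** * The one-dimensional normal law *)

Section NormalLaw.
Context {R : realType} (s : R).
Hypothesis s0 : 0 < s.
Local Notation mu := (@lebesgue_measure R).
Local Notation n := (normal_pdf 0 s).

Lemma sqr_le_expR (x : R) : x ^+ 2 <= 2 * expR `|x|.
Proof.
have := expR_ge1Dxn 1 (normr_ge0 x).
rewrite (_ : 2`!%:R = 2 :> R) // real_normK ?num_real//; lra.
Qed.

Lemma abs_le_expR (x : R) : `|x| <= expR `|x|.
Proof. by have := expR_ge1Dx `|x|; lra. Qed.

Lemma expR_abs_le (x : R) : expR `|x| <= expR x + expR (- x).
Proof.
have [x0|x0] := leP 0 x; first by rewrite ger0_norm// lerDl expR_ge0.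
by rewrite ltr0_norm// lerDr expR_ge0.
Qed.

Let sN0 : s != 0. Proof. by rewrite gt_eqF. Qed.

Lemma normal_pdf0E (x : R) :
  n x = normal_peak s * expR (- (x ^+ 2 / (s ^+ 2 *+ 2))).
Proof. by rewrite normal_pdfE// /normal_fun subr0 mulNr. Qed.

(** Doubling the standard deviation leaves room for the linear exponent: with [u = x / s] and
    [v = t s], one has [v u - u^2 / 2 <= v^2 - u^2 / 8]. *)
Lemma expR_normal_le (t x : R) : expR (t * x) * n x <=
  (normal_peak s * expR (t ^+ 2 * s ^+ 2) / normal_peak (2 * s)) * normal_pdf 0 (2 * s) x.
Proof.
have s20 : 2 * s != 0 by rewrite mulf_neq0.
rewrite normal_pdf0E normal_pdfE// /normal_fun subr0.
have p2 := normal_peak_gt0 s20.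
rewrite [leRHS](_ : _ = normal_peak s *
    (expR (t ^+ 2 * s ^+ 2) * expR (- x ^+ 2 / ((2 * s) ^+ 2 *+ 2)))); last first.
  by field; rewrite gt_eqF.
rewrite mulrCA ler_pM2l ?normal_peak_gt0// -!expRD ler_expR.
pose u := x / s; pose v := t * s.
have -> : t * x = v * u by rewrite /u /v; field.
have -> : x ^+ 2 / (s ^+ 2 *+ 2) = u ^+ 2 / 2 by rewrite /u; field.
have -> : - x ^+ 2 / ((2 * s) ^+ 2 *+ 2) = - (u ^+ 2 / 8) by rewrite /u; field.
have -> : t ^+ 2 * s ^+ 2 = v ^+ 2 by rewrite /v; ring.
by have := sqr_ge0 (v - u / 2); have := sqr_ge0 u; nra.
Qed.

Lemma integrable_expR_normal (t : R) :
  mu.-integrable [set: R] (EFin \o (fun x => expR (t * x) * n x)).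
Proof.
have i2 := integrable_normal_pdf 0 (2 * s).
apply: (integrable_le (mu := mu) _ _ (RintegrableZ
  (normal_peak s * expR (t ^+ 2 * s ^+ 2) / normal_peak (2 * s)) i2)).
- apply: measurable_funM; last exact: measurable_normal_pdf.
  by apply: measurableT_comp => //; exact: measurable_funM.
- move=> x; rewrite ger0_norm; first exact: expR_normal_le.
  by rewrite mulr_ge0 ?expR_ge0 ?normal_pdf_ge0.
Qed.

(** [exp |x|] is at most [exp x + exp (- x)]. This growth class contains the powers, trigonometric
    functions and exponentials integrated below. *)
Lemma integrable_normal_growth (f : R -> R) (K : R) : measurable_fun [set: R] f ->
  (forall x, `|f x| <= K * expR `|x|) ->
  mu.-integrable [set: R] (EFin \o (fun x => f x * n x)).
Proof.
move=> mf fK.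
have iE : mu.-integrable [set: R] (EFin \o (fun x =>
    K * (expR (1 * x) * n x + expR (- 1 * x) * n x))).
  by apply: RintegrableZ; apply: RintegrableD; exact: integrable_expR_normal.
apply: (integrable_le (mu := mu) _ _ iE).
  by apply: measurable_funM => //; exact: measurable_normal_pdf.
move=> x; rewrite normrM [X in _ * X]ger0_norm ?normal_pdf_ge0//.
rewrite -mulrDl mulrA ler_wpM2r ?normal_pdf_ge0// mul1r mulN1r (le_trans (fK x))//.
rewrite ler_wpM2l ?expR_abs_le//.
by have := le_trans (normr_ge0 _) (fK 0); rewrite pmulr_lge0// expR_gt0.
Qed.

Lemma normal_pdf_is_derive (x : R) : is_derive x 1 n (- (x / s ^+ 2 * n x)).
Proof.
have -> : n = (fun x => normal_peak s * expR (- (x ^+ 2 / (s ^+ 2 *+ 2)))).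
  by apply/funext => y; exact: normal_pdf0E.
apply: is_derive_eq; rewrite /GRing.scale/=.
move: (expR _) (normal_peak s) => a b; field.
by rewrite sN0.
Qed.

(* The derivative of [f * n] has integral 0 over the line. *)
Lemma normal_stein (f f' : R -> R) (K : R) :
  (forall x : R, is_derive x (1 : R) f (f' x)) -> continuous f' ->
  (forall x, `|f x| <= K * (1 + `|x|)) -> (forall x, `|f' x| <= K) ->
  \int[mu]_x (x * f x * n x) = s ^+ 2 * \int[mu]_x (f' x * n x).
Proof.
move=> df cf' fK f'K.
have K0 : 0 <= K by have := le_trans (normr_ge0 _) (f'K 0).
have cf : continuous f.
  by move=> x; have [d _] := df x; exact/differentiable_continuous/derivable1_diffP.
have mf := continuous_measurable_fun cf; have mf' := continuous_measurable_fun cf'.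
have mid : measurable_fun [set: R] (fun x : R => x) by [].
have i1 : mu.-integrable [set: R] (EFin \o (fun x => x * f x * n x)).
  apply: (@integrable_normal_growth _ (3 * K)); first exact: measurable_funM.
  move=> x; rewrite normrM.
  have := sqr_le_expR x; have := abs_le_expR x; have := fK x.
  rewrite -(real_normK (num_real x)); set u := `|f x|; set v := `|x|; set w := expR v.
  move=> h1 h2 h3; have v0 : 0 <= v by exact: normr_ge0.
  have := ler_wpM2l v0 h1; have := ler_wpM2l K0 h2; have := ler_wpM2l K0 h3.
  by lra.
have i2 : mu.-integrable [set: R] (EFin \o (fun x => f' x * n x)).
  apply: (@integrable_normal_growth _ K) => // x; rewrite (le_trans (f'K x))//.
  by rewrite ler_peMr// -expR0 ler_expR.
pose g x := f' x * n x - (s ^+ 2)^-1 * (x * f x * n x).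
have ig : mu.-integrable [set: R] (EFin \o g).
  by rewrite /g; under eq_fun do rewrite -mulNr; apply: RintegrableD => //;
    exact: RintegrableZ.
suff g0 : \int[mu]_x g x = 0.
  have : \int[mu]_x (f' x * n x) - (s ^+ 2)^-1 * \int[mu]_x (x * f x * n x) = 0.
    by rewrite -RintegralZl// -RintegralB//; exact: RintegrableZ.
  move=> /eqP; rewrite subr_eq0 => /eqP ->.
  by rewrite mulVKf// expf_neq0.
pose G x := f x * n x.
have dG (x : R) : is_derive x (1 : R) G (g x).
  have dn := normal_pdf_is_derive x; have dfx := df x.
  apply: (is_derive_eq (is_deriveM dfx dn)); rewrite /g /GRing.scale/=; field.
  by rewrite sN0.
have cn : continuous n by exact: continuous_normal_pdf.
have cg : continuous g.
  move=> x; apply: cvgB; apply: cvgM => //; first exact: cf'.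
  - exact: cn.
  - exact: cvg_cst.
  - by apply: cvgM; [apply: cvgM => //; exact: cf|exact: cn].
have mg := continuous_measurable_fun cg.
pose A (k : nat) : set R := [set` `[- k.+1%:R : R, k.+1%:R]].
have intA k : \int[mu]_(x in A k) g x = G k.+1%:R - G (- k.+1%:R).
  rewrite /Rintegral (@continuous_FTC2 R g G) ?gtrN//.
  - exact: continuous_subspaceT.
  - split.
    + by move=> x _; have [] := dG x.
    + apply: cvg_at_right_filter; have [d _] := dG (- k.+1%:R).
      exact/differentiable_continuous/derivable1_diffP.
    + apply: cvg_at_left_filter; have [d _] := dG k.+1%:R.
      exact/differentiable_continuous/derivable1_diffP.
  - by move=> x _; rewrite derive1E; have [_ ->] := dG x.
have lim1 : \int[mu]_(x in A k) g x @[k --> \oo] --> \int[mu]_x g x.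
  under eq_fun do rewrite Rintegral_mkcond.
  have iN : mu.-integrable [set: R] (EFin \o (fun x => `|g x|)).
    exact: (integrable_norm ig).
  apply: (dominated_Rintegral_cvg _ _ iN _).2.
  - by move=> k; apply/(measurable_restrictT _ _).1;
      [exact: measurable_itv|exact: measurable_funTS].
  - move=> x; apply: (@cvg_trans _ (cst (g x) @ \oo)); last exact: cvg_cst.
    apply: near_eq_cvg; near=> k.
    have xA : A k x.
      rewrite /A/= in_itv/= -ler_norml (@le_trans _ _ k%:R)// ?ler_nat//.
      by near: k; exact: nbhs_infty_ger.
    by rewrite patchE mem_set.
  - by move=> k x; rewrite patchE; case: ifP => // _; rewrite normr0.
have lim2 : \int[mu]_(x in A k) g x @[k --> \oo] --> (0 : R).
  (* The boundary terms decay like [1 / |y|]: [exp w >= w] bounds the density by the peak times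
     [2 s^2 / y^2], and [|f y| <= 2 K |y|] once [|y| >= 1]. Each endpoint contributes a factor 4. *)
  pose C := K * 8 * normal_peak s * s ^+ 2.
  apply: (@cvg_harmonic_bound _ _ _ _ C) => k; rewrite subr0 intA.
  have bG (y : R) : 1 <= `|y| -> `|G y| <= C / 2 / `|y|.
    move=> y1; have y0 : 0 < `|y| by exact: lt_le_trans y1.
    rewrite /G normrM [X in _ * X]ger0_norm ?normal_pdf_ge0//.
    have y2 : 0 < y ^+ 2 by rewrite -(real_normK (num_real y)) exprn_gt0.
    have h1 : n y <= normal_peak s * (2 * s ^+ 2 / y ^+ 2).
      rewrite normal_pdf0E ler_pM2l ?normal_peak_gt0// expRN.
      have w0 : 0 < y ^+ 2 / (s ^+ 2 *+ 2).
        by rewrite divr_gt0// mulrn_wgt0// exprn_gt0.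
      have -> : 2 * s ^+ 2 / y ^+ 2 = (y ^+ 2 / (s ^+ 2 *+ 2))^-1.
        by rewrite invf_div mulr_natl.
      rewrite lef_pV2 ?posrE ?expR_gt0//.
      by have := expR_ge1Dx (y ^+ 2 / (s ^+ 2 *+ 2)); lra.
    have h2 : `|f y| <= K * (2 * `|y|).
      by apply: (le_trans (fK y)); rewrite ler_wpM2l//; lra.
    apply: (le_trans (ler_pM (normr_ge0 _) (normal_pdf_ge0 _ _ _) h2 h1)).
    rewrite /C -(real_normK (num_real y)) le_eqVlt; apply/orP; left; apply/eqP.
    by field; rewrite gt_eqF.
  have k1 : 1 <= k.+1%:R :> R by rewrite ler1n.
  have h1 := bG k.+1%:R; have h2 := bG (- k.+1%:R).
  have kk : `|k.+1%:R : R| = k.+1%:R by rewrite ger0_norm.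
  rewrite kk in h1; rewrite normrN kk in h2.
  rewrite (le_trans (ler_normB _ _))// [C]splitr mulrDl lerD//.
    exact: h1.
  exact: h2.
exact: (cvg_unique _ lim1 lim2).
Unshelve. all: by end_near. Qed.

End NormalLaw.

Lemma is_derive_Rintegral {R : realType} d (T : measurableType d)
    (mu : {measure set T -> \bar R}) (f f' : R -> T -> R) (G : T -> R) (a : R) :
  (forall t y, is_derive t (1 : R) (f^~ y) (f' t y)) ->
  (forall t, mu.-integrable [set: T] (EFin \o f t)) ->
  mu.-integrable [set: T] (EFin \o G) ->
  (forall t y, `|f' t y| <= G y) ->
  is_derive a (1 : R) (fun t => \int[mu]_y f t y) (\int[mu]_y f' a y).
Proof.
move=> df intf iG fG.
have Ia : `]a - 1, a + 1[%classic a by rewrite /= in_itv/=; apply/andP; split; lra.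
have G0 y : 0 <= G y by exact: le_trans (normr_ge0 _) (fG a y).
have dE t y : partial1of2 f t y = f' t y.
  by rewrite partial1of2E; have [_ ->] := df t y.
have df1 t y : `]a - 1, a + 1[%classic t -> setT y -> derivable (f^~ y) t 1.
  by move=> _ _; have [] := df t y.
have fG1 t y : `]a - 1, a + 1[%classic t -> setT y -> `|partial1of2 f t y| <= G y.
  by move=> _ _; rewrite dE.
apply: DeriveDef.
  exact: (derivable_under_integral measurableT Ia (fun t _ => intf t) df1 G0 iG fG1).
rewrite -derive1E.
rewrite (differentiation_under_integral measurableT Ia (fun t _ => intf t) df1 G0 iG fG1).
by apply: eq_Rintegral => y _; rewrite dE.
Qed.

Section NormalMoments.
Context {R : realType} (s : R).
Hypothesis s0 : 0 < s.
Local Notation mu := (@lebesgue_measure R).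
Local Notation n := (normal_pdf 0 s).

Lemma normal_second_moment : \int[mu]_x (x ^+ 2 * n x) = s ^+ 2.
Proof.
have h := @normal_stein _ _ s0 (fun x => x) (cst 1) 1.
transitivity (\int[mu]_x (x * x * n x)).
  by apply: eq_Rintegral => x _; rewrite expr2.
rewrite h.
- under eq_Rintegral do rewrite mul1r.
  by rewrite /Rintegral integral_normal_pdf/= mulr1.
- exact: cst_continuous.
- by move=> x; rewrite mul1r; lra.
- by move=> x; rewrite normr1.
Qed.

(** Differentiating in [t] under the integral and applying [normal_stein] to a sine gives
    [c' = - t s^2 c]; hence [c] times [exp ((t s)^2 / 2)] is constant. *)
Lemma normal_cos (a t : R) :
  \int[mu]_x (cos (t * x + a) * n x) = cos a * expR (- ((t * s) ^+ 2 / 2)).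
Proof.
pose c t := \int[mu]_x (cos (t * x + a) * n x).
have mlin (u : R) : continuous (fun x : R => u * x + a).
  by move=> x; apply: cvgD; [apply: cvgM; [exact: cvg_cst|exact: cvg_id]|exact: cvg_cst].
have ccos (u : R) : continuous (fun x : R => cos (u * x + a)).
  by move=> x; apply: (@continuous_comp _ _ _ (fun x => u * x + a) cos);
    [exact: mlin|exact: continuous_cos].
have csin (u : R) : continuous (fun x : R => sin (u * x + a)).
  by move=> x; apply: (@continuous_comp _ _ _ (fun x => u * x + a) sin);
    [exact: mlin|exact: continuous_sin].
have iabs : mu.-integrable [set: R] (EFin \o (fun x => `|x| * n x)).
  apply: (@integrable_normal_growth _ _ s0 _ 1) => //.
  by move=> x; rewrite normr_id mul1r abs_le_expR.
have icos u : mu.-integrable [set: R] (EFin \o (fun x => cos (u * x + a) * n x)).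
  apply: (@integrable_normal_growth _ _ s0 _ 1).
    exact: continuous_measurable_fun.
  by move=> x; rewrite mul1r (le_trans (cos_max _))// -expR0 ler_expR.
have isin u : mu.-integrable [set: R] (EFin \o (fun x => x * sin (u * x + a) * n x)).
  apply: (@integrable_normal_growth _ _ s0 _ 1).
    by apply: measurable_funM => //; exact: continuous_measurable_fun.
  move=> x; rewrite mul1r normrM (le_trans _ (abs_le_expR x))//.
  by rewrite ler_piMr// sin_max.
have lin (u x : R) : is_derive x (1 : R) (fun x : R => u * x + a) u.
  by apply: is_derive_eq; rewrite /GRing.scale/=; ring.
have dc u : is_derive u (1 : R) c (- (u * s ^+ 2) * c u).
  have -> : - (u * s ^+ 2) * c u = \int[mu]_x (- (x * sin (u * x + a) * n x)).
    transitivity (- \int[mu]_x (x * sin (u * x + a) * n x)).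
      have df (x : R) : is_derive x (1 : R) (fun x : R => sin (u * x + a))
          (u * cos (u * x + a)).
        by rewrite mulrC; exact: is_derive1_comp.
      rewrite (normal_stein s0 (K := 1 + `|u|) df).
      - have -> : \int[mu]_x (u * cos (u * x + a) * n x) = u * c u.
          by rewrite /c -RintegralZl//; apply: eq_Rintegral => x _; ring.
        by ring.
      - by move=> x; apply: cvgM; [exact: cvg_cst|exact: ccos].
      - move=> x; rewrite (le_trans (sin_max _))//.
        by have := normr_ge0 u; have := normr_ge0 x; nra.
      - move=> x; rewrite normrM (@le_trans _ _ `|u|)//; last by rewrite lerDr.
        by rewrite ler_piMr// cos_max.
    rewrite -mulN1r -RintegralZl//.
    by apply: eq_Rintegral => x _; rewrite mulN1r.
  apply: (@is_derive_Rintegral _ _ _ mu (fun t x => cos (t * x + a) * n x)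
    (fun t x => - (x * sin (t * x + a) * n x)) (fun x => `|x| * n x)).
  - move=> v y.
    have dv : is_derive v (1 : R) (fun v : R => v * y + a) y.
      by apply: is_derive_eq; rewrite /GRing.scale/=; ring.
    have dcv := @is_derive1_comp _ cos (fun v : R => v * y + a) v _ _ (is_derive_cos _) dv.
    apply: (is_derive_eq (is_deriveM dcv (is_derive_cst (n y) v 1))).
    by rewrite /GRing.scale/=; ring.
  - exact: icos.
  - exact: iabs.
  - move=> v y; rewrite normrN normrM [X in _ * X]ger0_norm ?normal_pdf_ge0//.
    by rewrite ler_wpM2r ?normal_pdf_ge0// normrM ler_piMr// sin_max.
have cst0 u : c u * expR ((u * s) ^+ 2 / 2) = c 0 * expR ((0 * s) ^+ 2 / 2).
  apply: (@is_derive_0_is_cst _ (fun u => c u * expR ((u * s) ^+ 2 / 2))) => v.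
  have de : is_derive v (1 : R) (fun u : R => (u * s) ^+ 2 / 2) (v * s ^+ 2).
    by apply: is_derive_eq; rewrite /GRing.scale/=; field.
  have dE := @is_derive1_comp _ expR (fun u : R => (u * s) ^+ 2 / 2) v _ _ (is_derive_expR _) de.
  apply: (is_derive_eq (is_deriveM (dc v) dE)).
  by rewrite /GRing.scale/=; ring.
have c0 : c 0 = cos a.
  rewrite /c; under eq_Rintegral do rewrite mul0r add0r.
  rewrite RintegralZl//; last exact: integrable_normal_pdf.
  by rewrite /Rintegral integral_normal_pdf/= mulr1.
have := cst0 t; rewrite c0 mul0r expr0n/= mul0r expR0 mulr1 => <-.
by rewrite -mulrA -expRD subrr expR0 mulr1.
Qed.

End NormalMoments.

(** * One-dimensional images of a Gaussian measure *)

Section GaussianMeasure.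
Context {R : realType} {X : completeNormedModType R}.

Lemma borel_measurable_continuous (f : X -> R) : continuous f ->
  measurable_fun [set: borel X] (f : borel X -> R).
Proof.
move=> /continuousP cf; apply: (measurability _ (RGenOpens.measurableE R)).
move=> _ [_ [a [b ->] <-]]; rewrite setTI; apply: sub_sigma_algebra.
exact/cf/interval_open.
Qed.

Lemma dual_measurable (xs : dual X) : measurable_fun [set: borel X] (xs : borel X -> R).
Proof. by apply: borel_measurable_continuous; exact: dual_continuous. Qed.

Variable gamma : probability (borel X) R.
Hypothesis hgamma : centred_gaussian gamma.

(** Change of variables along [xs]. A degenerate functional has a Dirac law without density, hence
    the separate clause for [s = 0]. *)
Lemma gaussian_transfer (xs : dual X) : exists2 s : R, 0 <= s &
  forall f : R -> R, measurable_fun [set: R] f ->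
  (s = 0 -> gamma.-integrable [set: borel X] (fun x : borel X => (f (xs x))%:E) /\
    \int[gamma]_x f (xs x) = f 0) /\
  (0 < s -> lebesgue_measure.-integrable [set: R] (EFin \o (fun x => f x * normal_pdf 0 s x)) ->
    gamma.-integrable [set: borel X] (fun x : borel X => (f (xs x))%:E) /\
    \int[gamma]_x f (xs x) = \int[lebesgue_measure]_x (f x * normal_pdf 0 s x)).
Proof.
have [s s0 hs] := hgamma xs; exists s => // f mf.
have mxs := dual_measurable xs.
have mEf : measurable_fun [set: R] (EFin \o f) by exact/measurable_EFinP.
have mEfx : measurable_fun [set: borel X] (fun x : borel X => (f (xs x))%:E).
  by apply/measurable_EFinP; exact: measurableT_comp.
have pE : ((fun x : borel X => (f (xs x))%:E)^\+ = (fun x => (EFin \o f)^\+ (xs x)))%E.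
  by apply/funext => x; rewrite !funeposE.
have nE : ((fun x : borel X => (f (xs x))%:E)^\- = (fun x => (EFin \o f)^\- (xs x)))%E.
  by apply/funext => x; rewrite !funenegE.
split=> [s00|sp].
- have E (g : R -> \bar R) : measurable_fun [set: R] g -> (forall x, 0 <= g x)%E ->
      (\int[gamma]_x g (xs x) = g 0%R)%E.
    move=> mg g0.
    rewrite -[LHS](ge0_integral_pushforward mxs gamma (D := setT))//.
    rewrite (eq_measure_integral \d_(0 : R)); last first.
      by move=> V mV _; rewrite -[LHS]/(gamma (xs @^-1` V)) (hs _ mV) /centred_normal s00 eqxx.
    by rewrite integral_dirac// diracT mul1e.
  split.
    apply/integrableP; split => //.
    by rewrite (E (fun x => `|(f x)%:E|%E)) ?ltry//; exact: measurableT_comp.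
  rewrite /Rintegral integralE.
  rewrite pE nE (E (EFin \o f)^\+%E)//; last exact: measurable_funepos.
  rewrite (E (EFin \o f)^\-%E)//; last exact: measurable_funeneg.
  by have /= <- := congr1 (@^~ (0 : R)) (funeposneg (EFin \o f)).
- move=> i1.
  have E (g : R -> \bar R) : measurable_fun [set: R] g -> (forall x, 0 <= g x)%E ->
      (\int[gamma]_x g (xs x) = \int[lebesgue_measure]_x (g x * (normal_pdf 0 s x)%:E))%E.
    move=> mg g0.
    have mxs' : measurable_fun [set: borel X] (xs : borel X -> measurableTypeR R) := mxs.
    rewrite -[LHS](ge0_integral_pushforward mxs' gamma (D := setT))//.
    transitivity (\int[normal_prob 0 s]_x g x)%E.
      apply: eq_measure_integral => V mV _.
      by rewrite -[LHS]/(gamma (xs @^-1` V)) (hs _ mV) /centred_normal gt_eqF.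
    by rewrite (@ge0_integral_density _ _ _ lebesgue_measure _ (normal_pdf 0 s))//;
      [exact: measurable_normal_pdf|exact: normal_pdf_ge0].
  split.
    apply/integrableP; split => //.
    rewrite (E (fun x => `|(f x)%:E|%E))//; last exact: measurableT_comp.
    move/integrableP : i1 => [_]; congr (_ < _)%E; apply: eq_integral => x _.
    by rewrite /= normrM EFinM (ger0_norm (normal_pdf_ge0 _ _ _)).
  rewrite /Rintegral integralE [in RHS]integralE.
  rewrite pE nE (E (EFin \o f)^\+%E)//; last exact: measurable_funepos.
  rewrite (E (EFin \o f)^\-%E)//; last exact: measurable_funeneg.
  congr fine; congr (_ - _)%E; apply: eq_integral => x _; rewrite ?funeposE ?funenegE/=.
  + by rewrite -[0%E]/(0%:E) -!EFin_max -EFinM maxr_pMl ?normal_pdf_ge0// mul0r.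
  + by rewrite -[0%E]/(0%:E) -!EFin_max -EFinM maxr_pMl ?normal_pdf_ge0// mul0r mulNr.
Qed.

Lemma gaussian_integrable (xs : dual X) (f : R -> R) (K : R) :
  measurable_fun [set: R] f -> (forall x, `|f x| <= K * expR `|x|) ->
  gamma.-integrable [set: borel X] (fun x : borel X => (f (xs x))%:E).
Proof.
move=> mf fK; have [s s0 hs] := gaussian_transfer xs.
have [h1 h2] := hs f mf; move: s0; rewrite le_eqVlt => /predU1P[/esym s0|s0].
  by have [] := h1 s0.
by have [] := h2 s0 (integrable_normal_growth s0 mf fK).
Qed.

Variable C : dual X -> X.
Hypothesis hC : covariance_operator gamma C.

(** The parameter [s ^+ 2] is identified with [xs (C xs)] through the second moment; the phase [a]
    provides sines as well as cosines. *)
Lemma gaussian_cos (xs : dual X) (a : R) :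
  \int[gamma]_x cos ((xs x : R) + a) = cos a * expR (- ((xs (C xs) : R) / 2)).
Proof.
have [s s0 hs] := gaussian_transfer xs.
have E : (xs (C xs) : R) = s ^+ 2.
  rewrite hC; transitivity (\int[gamma]_x ((xs x : R) ^+ 2)).
    by apply: eq_Rintegral => x _; rewrite expr2.
  have [|h1 h2] := hs (fun x => x ^+ 2); first exact: exprn_measurable.
  move: s0; rewrite le_eqVlt => /predU1P[/esym s0|s0].
    by have [_ ->] := h1 s0; rewrite s0 expr0n.
  have [|_ ->] := h2 s0; last exact: normal_second_moment.
  apply: (@integrable_normal_growth _ _ s0 _ 2); first exact: exprn_measurable.
  by move=> x; rewrite ger0_norm ?sqr_ge0// sqr_le_expR.
have cc : continuous (fun x : R => cos (x + a)).
  move=> x; apply: (@continuous_comp _ _ _ (fun x => x + a) cos).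
    by apply: cvgD; [exact: cvg_id|exact: cvg_cst].
  exact: continuous_cos.
have mc := continuous_measurable_fun cc.
have [h1 h2] := hs (fun x => cos (x + a)) mc.
move: s0; rewrite le_eqVlt => /predU1P[/esym s0|s0].
  by have [_ ->] := h1 s0; rewrite E s0 expr0n/= mul0r oppr0 expR0 mulr1 add0r.
have [|_ ->] := h2 s0.
  apply: (@integrable_normal_growth _ _ s0 _ 1) => // x.
  by rewrite mul1r (le_trans (cos_max _))// -expR0 ler_expR.
have := normal_cos s0 a 1; rewrite mul1r E => <-.
by apply: eq_Rintegral => x _; rewrite mul1r.
Qed.

End GaussianMeasure.

(** * Smooth cylinder functions *)

(** The difference quotients on both sides coincide, [v'] being the image of [v] under the linear
    part of [L]. Only directional derivatives are involved. *)
Lemma is_derive_affine {R : realType} {V W U : normedModType R} (f : V -> U)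
    (L : W -> V) (x v : W) (v' : V) d :
  (forall h : R, L (h *: v + x) = h *: v' + L x) ->
  is_derive (L x) v' f d -> is_derive x v (f \o L) d.
Proof.
move=> hL [df fE].
have E : (fun h : R => h^-1 *: (((f \o L) \o shift x) (h *: v) - (f \o L) x)) =
    (fun h : R => h^-1 *: ((f \o shift (L x)) (h *: v') - f (L x))).
  by apply/funext => h /=; rewrite hL.
by apply: DeriveDef; rewrite ?/derivable ?/derive E.
Qed.

(** For a factor that does not depend on the coordinate being differentiated. *)
Lemma is_derive_dir0 {R : realType} {V U : normedModType R} (f : V -> U) (x : V) :
  is_derive x 0 f 0.
Proof.
have E : (fun h : R => h^-1 *: ((f \o shift x) (h *: 0) - f x)) = cst 0.
  by apply/funext => h /=; rewrite scaler0 add0r subrr scaler0.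
by apply: DeriveDef; rewrite ?/derivable ?/derive E; [exact: is_cvg_cst|exact: lim_cst].
Qed.

Lemma is_derive_lineP {R : realType} {V U : normedModType R} (f : V -> U) (x v : V) d :
  is_derive (0 : R) (1 : R) (fun h : R => f (h *: v + x)) d <-> is_derive x v f d.
Proof.
pose u (h : R) := f (h *: v + x).
have E : (fun h : R => h^-1 *: ((u \o shift (0 : R)) (h *: 1) - u 0)) =
    (fun h : R => h^-1 *: ((f \o shift x) (h *: v) - f x)).
  by apply/funext => h; rewrite /u /= addr0 scale0r add0r /GRing.scale/= mulr1.
split=> [[]|[]]; rewrite /derivable /derive.
  by rewrite E => h1 h2; apply: DeriveDef; rewrite ?/derivable ?/derive.
by rewrite -E => h1 h2; apply: DeriveDef; rewrite ?/derivable ?/derive.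
Qed.

Lemma is_derive_chain1 {R : realType} {V : normedModType R} (g : R -> R) (f : V -> R)
    (x v : V) (dg df : R) :
  is_derive (f x) (1 : R) g dg -> is_derive x v f df ->
  is_derive x v (g \o f) (dg * df).
Proof.
move=> hg hf; apply/is_derive_lineP.
apply: (@is_derive1_comp _ g (fun h : R => f (h *: v + x))).
  by rewrite scale0r add0r.
exact/is_derive_lineP.
Qed.

Section Rows.
Context {R : realType}.

Lemma cvg_row {T : Type} (F : set_system T) {FF : Filter F} n (f : T -> 'rV[R]_n)
    (l : 'rV[R]_n) :
  (forall j, f x 0 j @[x --> F] --> l 0 j) -> f x @[x --> F] --> l.
Proof.
move=> fl A [P hP PA].
have h : \forall x \near F, forall i j, P i j (f x i j).
  by apply: filter_forall => i; apply: filter_forall => j; rewrite (ord1 i) in hP *;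
    apply: fl; exact: hP.
by apply: filterS h => x hx; exact: PA.
Qed.

Lemma bounded_continuous_cst n (a : R) : bounded_continuous (fun _ : 'rV[R]_n => a).
Proof. by split; [exact: cst_continuous|exists `|a|]. Qed.

Lemma bounded_continuousM n (f g : 'rV[R]_n -> R) : bounded_continuous f ->
  bounded_continuous g -> bounded_continuous (fun x => f x * g x).
Proof.
move=> [cf [M fM]] [cg [N gN]]; split; first by move=> x; exact: (continuousM (cf x) (cg x)).
by exists (M * N) => x; rewrite normrM ler_pM.
Qed.

Lemma bounded_continuous_comp m n (f : 'rV[R]_n -> R) (L : 'rV[R]_m -> 'rV[R]_n) :
  continuous L -> bounded_continuous f -> bounded_continuous (f \o L).
Proof.
move=> cL [cf [M fM]]; split; last by exists M => x; exact: fM.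
by move=> x; apply: continuous_comp; [exact: cL|exact: cf].
Qed.

Lemma Cb1_intro n (phi : 'rV[R]_n -> R) (dphi : 'I_n -> 'rV[R]_n -> R) :
  bounded_continuous phi ->
  (forall j xi, is_derive xi (delta_mx 0 j) phi (dphi j xi)) ->
  (forall j, bounded_continuous (dphi j)) ->
  Cb 1 phi /\ forall j, partial j phi = dphi j.
Proof.
move=> bphi dphiE bdphi.
have E j : partial j phi = dphi j.
  by apply/funext => xi; have [_] := dphiE j xi.
split => //; split => // j; split; last by rewrite E.
by move=> xi; have [] := dphiE j xi.
Qed.

Lemma Cb1_elim n (phi : 'rV[R]_n -> R) : Cb 1 phi ->
  [/\ bounded_continuous phi,
    (forall j xi, is_derive xi (delta_mx 0 j) phi (partial j phi xi)) &
    forall j, bounded_continuous (partial j phi)].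
Proof.
move=> [bphi h]; split => // j; last by have [_ []] := h j.
by move=> xi; have [hd _] := h j; apply: DeriveDef.
Qed.

Lemma CbS n k (phi : 'rV[R]_n -> R) : Cb k.+1 phi -> Cb k phi.
Proof.
elim: k phi => [|k IH] phi [b h]; first by split.
split=> // j; have [hd hC] := h j; split => //; exact: IH.
Qed.

Lemma Cb2_partial n (phi : 'rV[R]_n -> R) j : Cb 2 phi -> Cb 1 (partial j phi).
Proof. by move=> [_ h]; have [] := h j. Qed.

End Rows.

Section CylinderAlgebra.
Context {R : realType} {X : normedModType R}.
Implicit Types c : cylinder X.

(** The derivative of the cylinder function as an element of the dual; [istar] maps it to [D_H], and
    its value at [i h] is the inner product of [D_H] with [h]. *)
Definition cyl_grad c (x : X) : dual X := \sum_(j < cyl_dim c) cyl_d c j x *: cyl_xs c j.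

Lemma cyl_coord_continuous c : continuous (cyl_coord c).
Proof.
move=> x; apply: cvg_row => j; rewrite mxE.
by under eq_fun do rewrite mxE; exact: dual_continuous.
Qed.

(** The lists of functionals are concatenated, so a functional common to both factors occurs
    twice. *)
Definition cyl_mul c1 c2 : cylinder X := @Cylinder R X (cyl_dim c1 + cyl_dim c2)
  (fun xi => cyl_phi c1 (lsubmx xi) * cyl_phi c2 (rsubmx xi))
  (fun j => match fintype.split j with inl i => cyl_xs c1 i | inr i => cyl_xs c2 i end).

Lemma cyl_mul_lsubmx c1 c2 x : lsubmx (cyl_coord (cyl_mul c1 c2) x) = cyl_coord c1 x.
Proof. by apply/rowP => j; rewrite !mxE /= (unsplitK (inl j)). Qed.

Lemma cyl_mul_rsubmx c1 c2 x : rsubmx (cyl_coord (cyl_mul c1 c2) x) = cyl_coord c2 x.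
Proof. by apply/rowP => j; rewrite !mxE /= (unsplitK (inr j)). Qed.

Lemma cyl_funM c1 c2 x : cyl_fun (cyl_mul c1 c2) x = cyl_fun c1 x * cyl_fun c2 x.
Proof. by rewrite /cyl_fun /= cyl_mul_lsubmx cyl_mul_rsubmx. Qed.

Lemma lsubmx_delta n1 n2 (j : 'I_(n1 + n2)) :
  lsubmx (delta_mx 0 j : 'rV[R]_(n1 + n2)) =
  match fintype.split j with inl i => delta_mx 0 i | inr i => 0 end.
Proof.
case: splitP => i ji; apply/rowP => k; rewrite !mxE eqxx /=.
  by rewrite -!val_eqE /= ji.
by rewrite (_ : _ == _ = false)//; apply/eqP => /(congr1 val)/= E;
  have := ltn_ord k; rewrite E ji ltnNge leq_addr.
Qed.

Lemma rsubmx_delta n1 n2 (j : 'I_(n1 + n2)) :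
  rsubmx (delta_mx 0 j : 'rV[R]_(n1 + n2)) =
  match fintype.split j with inl i => 0 | inr i => delta_mx 0 i end.
Proof.
case: splitP => i ji; apply/rowP => k; rewrite !mxE eqxx /=; last first.
  by rewrite -!val_eqE /= ji eqn_add2l.
by rewrite (_ : _ == _ = false)//; apply/eqP => /(congr1 val)/= E;
  have := ltn_ord i; rewrite -ji -E ltnNge leq_addr.
Qed.

Lemma Cb1_mul c1 c2 : Cb 1 (cyl_phi c1) -> Cb 1 (cyl_phi c2) ->
  Cb 1 (cyl_phi (cyl_mul c1 c2)) /\
  forall x, cyl_grad (cyl_mul c1 c2) x =
    cyl_fun c2 x *: cyl_grad c1 x + cyl_fun c1 x *: cyl_grad c2 x.
Proof.
move=> /Cb1_elim[b1 d1 p1] /Cb1_elim[b2 d2 p2].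
pose L1 (xi : 'rV[R]_(cyl_dim c1 + cyl_dim c2)) := lsubmx xi.
pose L2 (xi : 'rV[R]_(cyl_dim c1 + cyl_dim c2)) := rsubmx xi.
have cL1 : continuous L1 by exact: continuous_lsubmx.
have cL2 : continuous L2 by exact: continuous_rsubmx.
pose dphi (j : 'I_(cyl_dim c1 + cyl_dim c2)) xi := match fintype.split j with
  | inl i => partial i (cyl_phi c1) (L1 xi) * cyl_phi c2 (L2 xi)
  | inr i => cyl_phi c1 (L1 xi) * partial i (cyl_phi c2) (L2 xi) end.
have [||j|hC hE] := @Cb1_intro _ _ (cyl_phi (cyl_mul c1 c2)) dphi.
- by apply: bounded_continuousM; exact: bounded_continuous_comp.
- move=> j xi; rewrite /dphi.
  have e1 (h : R) : L1 (h *: delta_mx 0 j + xi) = h *: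
      (match fintype.split j with inl i => delta_mx 0 i | inr i => 0 end) + L1 xi.
    by rewrite -lsubmx_delta /L1 linearP.
  have e2 (h : R) : L2 (h *: delta_mx 0 j + xi) = h *:
      (match fintype.split j with inl i => 0 | inr i => delta_mx 0 i end) + L2 xi.
    by rewrite -rsubmx_delta /L2 linearP.
  case: (fintype.split j) e1 e2 => i e1 e2.
  + have h1 := is_derive_affine e1 (d1 i (L1 xi)).
    have h2 := is_derive_affine e2 (is_derive_dir0 (cyl_phi c2) (L2 xi)).
    apply: (is_derive_eq (is_deriveM h1 h2)).
    by rewrite /GRing.scale/= mulr0 add0r mulrC.
  + have h1 := is_derive_affine e1 (is_derive_dir0 (cyl_phi c1) (L1 xi)).
    have h2 := is_derive_affine e2 (d2 i (L2 xi)).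
    apply: (is_derive_eq (is_deriveM h1 h2)).
    by rewrite /GRing.scale/= mulr0 addr0.
- rewrite /dphi; case: (fintype.split j) => i; apply: bounded_continuousM;
    by apply: bounded_continuous_comp => //.
split=> // x; rewrite /cyl_grad big_split_ord /= !scaler_sumr; congr (_ + _).
- apply: eq_bigr => i _; rewrite /cyl_d hE /dphi (unsplitK (inl i)) /=.
  by rewrite /L1 /L2 cyl_mul_lsubmx cyl_mul_rsubmx scalerA mulrC.
- apply: eq_bigr => i _; rewrite /cyl_d hE /dphi (unsplitK (inr i)) /=.
  by rewrite /L1 /L2 cyl_mul_lsubmx cyl_mul_rsubmx scalerA.
Qed.

Definition cyl_comp (g : R -> R) c : cylinder X :=
  @Cylinder R X (cyl_dim c) (fun xi => g (cyl_phi c xi)) (cyl_xs c).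

Definition C1b (g g' : R -> R) := [/\ (forall t : R, is_derive t (1 : R) g (g' t)),
  continuous g', (exists M : R, forall t, `|g t| <= M) & exists M : R, forall t, `|g' t| <= M].

Lemma C1b_continuous g g' : C1b g g' -> continuous g.
Proof.
by move=> [dg _ _ _] x; have [d _] := dg x;
  exact/differentiable_continuous/derivable1_diffP.
Qed.

Lemma Cb1_comp g g' c : C1b g g' -> Cb 1 (cyl_phi c) ->
  Cb 1 (cyl_phi (cyl_comp g c)) /\
  forall x, cyl_grad (cyl_comp g c) x = g' (cyl_fun c x) *: cyl_grad c x.
Proof.
move=> hg /Cb1_elim[b1 d1 p1]; have cg := C1b_continuous hg.
have [dg cg' [M gM] [M' gM']] := hg; have [cphi _] := b1.
have [||j|hC hE] := @Cb1_intro _ _ (cyl_phi (cyl_comp g c))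
  (fun j xi => g' (cyl_phi c xi) * partial j (cyl_phi c) xi).
- split; last by exists M => xi; exact: gM.
  by move=> xi; apply: (@continuous_comp _ _ _ (cyl_phi c) g); [exact: cphi|exact: cg].
- by move=> j xi; exact: is_derive_chain1 (dg _) (d1 _ _).
- apply: bounded_continuousM => //; split; last by exists M' => xi; exact: gM'.
  by move=> xi; apply: (@continuous_comp _ _ _ (cyl_phi c) g'); [exact: cphi|exact: cg'].
split=> // x; rewrite /cyl_grad scaler_sumr; apply: eq_bigr => j _.
by rewrite /cyl_d hE scalerA.
Qed.

Definition cyl_ridge (g : R -> R) (y : dual X) : cylinder X :=
  @Cylinder R X 1 (fun xi => g (xi 0 0)) (fun=> y).

Lemma cyl_fun_ridge g y x : cyl_fun (cyl_ridge g y) x = g (y x).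
Proof. by rewrite /cyl_fun /= mxE. Qed.

Lemma is_derive_coord n (i j : 'I_n) (xi : 'rV[R]_n) :
  is_derive xi (delta_mx 0 j) (fun xi : 'rV[R]_n => xi 0 i) (i == j)%:R.
Proof.
apply/is_derive_lineP.
have -> : (fun h : R => (h *: delta_mx 0 j + xi) 0 i) = (fun h : R => h * (i == j)%:R + xi 0 i).
  by apply/funext => h; rewrite !mxE eqxx.
by apply: is_derive_eq; rewrite /GRing.scale/=; ring.
Qed.

Lemma Cb1_ridge g g' y : C1b g g' -> Cb 1 (cyl_phi (cyl_ridge g y)) /\
  forall x, cyl_grad (cyl_ridge g y) x = g' (y x) *: y.
Proof.
move=> hg; have cg := C1b_continuous hg; have [dg cg' [M gM] [M' gM']] := hg.
have cc := @coord_continuous R 1 1 0 0.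
have [||j|hC hE] := @Cb1_intro _ _ (cyl_phi (cyl_ridge g y)) (fun j xi => g' (xi 0 0)).
- split; last by exists M => xi; exact: gM.
  by move=> xi; apply: (@continuous_comp _ _ _ (fun xi : 'rV[R]_1 => xi 0 0) g);
    [exact: cc|exact: cg].
- move=> j xi; rewrite -[X in is_derive _ _ _ X]mulr1.
  have h := is_derive_coord (0 : 'I_1) j xi.
  rewrite (_ : (0 == j) = true) in h; last by rewrite (ord1 j) eqxx.
  exact: (@is_derive_chain1 _ _ g (fun xi : 'rV[R]_1 => xi 0 0) _ _ _ _ (dg _) h).
- split; last by exists M' => xi; exact: gM'.
  by move=> xi; apply: (@continuous_comp _ _ _ (fun xi : 'rV[R]_1 => xi 0 0) g');
    [exact: cc|exact: cg'].
split=> // x; rewrite /cyl_grad /= big_ord_recl big_ord0 addr0.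
by rewrite /cyl_d hE mxE.
Qed.

Definition cyl_partial c (j : 'I_(cyl_dim c)) : cylinder X :=
  @Cylinder R X (cyl_dim c) (partial j (cyl_phi c)) (cyl_xs c).

Definition cyl_const (a : R) : cylinder X :=
  @Cylinder R X 0 (fun=> a) (fun=> 0).

Lemma Cb1_const a : Cb 1 (cyl_phi (cyl_const a)).
Proof. by split; [exact: bounded_continuous_cst|case]. Qed.

Lemma cyl_fun_bounded c : bounded_continuous (cyl_phi c) ->
  continuous (cyl_fun c) /\ exists M : R, forall x, `|cyl_fun c x| <= M.
Proof.
move=> [cphi [M hM]]; split; last by exists M => x; exact: hM.
by move=> x; apply: (@continuous_comp _ _ _ (cyl_coord c) (cyl_phi c));
  [exact: cyl_coord_continuous|exact: cphi].
Qed.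

Lemma cyl_d_bounded c j : Cb 1 (cyl_phi c) ->
  continuous (cyl_d c j : X -> R) /\ exists M : R, forall x, `|cyl_d c j x| <= M.
Proof. by move=> /Cb1_elim[_ _ /(_ j)]; exact: (@cyl_fun_bounded (cyl_partial j)). Qed.

End CylinderAlgebra.

(** * Symmetry of mixed second derivatives *)

Lemma is_derive_lineD {R : realType} {V U : normedModType R} (f : V -> U) (x v : V)
    (s : R) d :
  is_derive (s *: v + x) v f d -> is_derive s (1 : R) (fun h : R => f (h *: v + x)) d.
Proof.
apply: (@is_derive_affine _ _ _ _ f (fun h : R => h *: v + x)) => h.
have -> : (h%:A : R) = h by rewrite /GRing.scale/= mulr1.
by rewrite scalerDl addrA.
Qed.

Lemma is_derive_itv_continuous {R : realType} (g dg : R -> R) (D : set R) :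
  (forall t : R, is_derive t (1 : R) g (dg t)) -> {within D, continuous g}.
Proof.
move=> h; apply: continuous_subspaceT => x; have [d _] := h x.
exact/differentiable_continuous/derivable1_diffP.
Qed.

(** The mean value theorem in each of the two directions. The second difference is symmetric in [a]
    and [b], which is what allows the order of derivatives to be exchanged. *)
Lemma second_difference {R : realType} {V : normedModType R} (f fa fab : V -> R)
    (a b x : V) (h : R) : 0 < h ->
  (forall y, is_derive y a f (fa y)) -> (forall y, is_derive y b fa (fab y)) ->
  exists y, `|y - x| <= h * (`|a| + `|b|) /\
    f (h *: a + (h *: b + x)) - f (h *: a + x) - f (h *: b + x) + f x = fab y * h ^+ 2.
Proof.
move=> h0 dfa dfab.
pose g (s : R) := f (s *: a + (h *: b + x)) - f (s *: a + x).
pose g' (s : R) := fa (s *: a + (h *: b + x)) - fa (s *: a + x).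
have dg (s : R) : is_derive s (1 : R) g (g' s).
  by apply: is_deriveB; exact: is_derive_lineD.
have [s] := MVT h0 (fun s _ => dg s) (is_derive_itv_continuous dg).
rewrite in_itv/= => /andP[s0 sh] gE.
have dk (t : R) : is_derive t (1 : R) (fun t : R => fa (t *: b + (s *: a + x)))
    (fab (t *: b + (s *: a + x))) by exact: is_derive_lineD.
have [t] := MVT h0 (fun s _ => dk s) (is_derive_itv_continuous dk).
rewrite in_itv/= => /andP[t0 th] kE.
exists (t *: b + (s *: a + x)); split.
  rewrite addrA addrK (le_trans (ler_normD _ _))// !normrZ !gtr0_norm// addrC mulrDr.
  by apply: lerD; rewrite ler_wpM2r// ltW.
move: gE; rewrite /g /g' !scale0r !add0r !subr0 => gE.
transitivity (f (h *: a + (h *: b + x)) - f (h *: a + x) - (f (h *: b + x) - f x)).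
  by ring.
rewrite gE; move: kE; rewrite scale0r add0r subr0 addrCA => ->; ring.
Qed.

(** The same second difference, with step [1 / (n + 1)], equals either mixed derivative at a point
    tending to [x], up to the common factor. *)
Lemma mixed_derivatives {R : realType} {V : normedModType R}
    (f fa fb fab fba : V -> R) (a b x : V) :
  (forall y, is_derive y a f (fa y)) -> (forall y, is_derive y b fa (fab y)) ->
  (forall y, is_derive y b f (fb y)) -> (forall y, is_derive y a fb (fba y)) ->
  {for x, continuous fab} -> {for x, continuous fba} -> fab x = fba x.
Proof.
move=> dfa dfab dfb dfba cab cba.
have h0 (n : nat) : 0 < (n.+1%:R^-1 : R) by rewrite invr_gt0.
have /choice[y yP] n := second_difference x (h0 n) dfa dfab.
have /choice[z zP] n := second_difference x (h0 n) dfb dfba.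
have yx : y @ \oo --> x.
  apply: (@cvg_harmonic_bound _ _ _ _ (`|a| + `|b|)) => n.
  by rewrite mulrC; have [] := yP n.
have zx : z @ \oo --> x.
  apply: (@cvg_harmonic_bound _ _ _ _ (`|b| + `|a|)) => n.
  by rewrite mulrC; have [] := zP n.
have E n : fab (y n) = fba (z n).
  have [_ E1] := yP n; have [_ E2] := zP n.
  apply: (@mulIf _ (n.+1%:R^-1 ^+ 2)); first by rewrite expf_neq0// gt_eqF.
  by rewrite -E1 -E2 addrCA; ring.
have h1 : fab (y n) @[n --> \oo] --> fab x by apply: continuous_cvg.
have h2 : fba (z n) @[n --> \oo] --> fba x by apply: continuous_cvg.
move: h1; under eq_fun do rewrite E.
by move=> h1; rewrite -(cvg_lim _ h1)// -(cvg_lim _ h2).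
Qed.

Lemma Cb2_partialC {R : realType} n (phi : 'rV[R]_n -> R) j k : Cb 2 phi ->
  partial j (partial k phi) = partial k (partial j phi).
Proof.
move=> h; have /Cb1_elim[_ d _] := CbS h.
have /Cb1_elim[_ dj pj] := Cb2_partial j h; have /Cb1_elim[_ dk pk] := Cb2_partial k h.
apply/funext => x.
have [c1 _] := pk j; have [c2 _] := pj k.
exact: (mixed_derivatives (d k) (dk j) (d j) (dj k) (c1 x) (c2 x)).
Qed.

(** * Gaussian integration by parts *)

(** Bernstein's operator [sum_m C(n, m) s^m (1 - s)^(n - m) g m], by de Casteljau's recursion. *)
Fixpoint bernstein {R : realType} (n : nat) (g : nat -> R) (s : R) : R :=
  if n is n'.+1 then (1 - s) * bernstein n' g s + s * bernstein n' (g \o S) s else g 0.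

(** The derivative of [bernstein n g]. *)
Fixpoint bernstein_d {R : realType} (n : nat) (g : nat -> R) (s : R) : R :=
  if n is n'.+1 then (1 - s) * bernstein_d n' g s - bernstein n' g s +
    (s * bernstein_d n' (g \o S) s + bernstein n' (g \o S) s) else 0.

Section Bernstein.
Context {R : realType}.
Implicit Types (g w : nat -> R) (s : R).

Lemma bernsteinB n g1 g2 s :
  bernstein n (fun m => g1 m - g2 m) s = bernstein n g1 s - bernstein n g2 s.
Proof.
elim: n g1 g2 => [//|n IH] g1 g2 /=.
rewrite IH (_ : _ \o S = fun m => (g1 \o S) m - (g2 \o S) m)// IH; ring.
Qed.

(** First two moments of the binomial law. Arbitrary coefficients are kept so that the shift
    [_ \o S] in the recursion stays in the class. *)
Lemma bernstein_quadratic n (a b c : R) s :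
  bernstein n (fun m => a + b * m%:R + c * m%:R ^+ 2) s =
  a + b * (n%:R * s) + c * (n%:R * s + n%:R * (n%:R - 1) * s ^+ 2).
Proof.
elim: n a b c => [|n IH] a b c /=; first by ring.
rewrite IH (_ : _ \o S = fun m => (a + b + c) + (b + c *+ 2) * m%:R + c * m%:R ^+ 2).
  by rewrite IH -natr1; ring.
by apply/funext => m /=; rewrite -natr1; ring.
Qed.

Lemma bernstein_cst n (a s : R) : bernstein n (fun=> a) s = a.
Proof.
rewrite (_ : (fun=> a) = fun m => a + 0 * m%:R + 0 * m%:R ^+ 2).
  by rewrite bernstein_quadratic; ring.
by apply/funext => m; ring.
Qed.

(** The operator is positive on [[0, 1]] and preserves constants, so bounds at the nodes pass to the
    average. *)
Lemma bernstein_le n g w s l : 0 <= s <= 1 -> (forall m, `|g m - l| <= w m) ->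
  `|bernstein n g s - l| <= bernstein n w s.
Proof.
move=> /andP[s0 s1]; elim: n g w => [|n IH] g w h /=; first exact: h.
have -> : (1 - s) * bernstein n g s + s * bernstein n (g \o S) s - l =
  (1 - s) * (bernstein n g s - l) + s * (bernstein n (g \o S) s - l) by ring.
rewrite (le_trans (ler_normD _ _))// !normrM (ger0_norm s0) ger0_norm ?subr_ge0//.
by apply: lerD; apply: ler_wpM2l; rewrite ?subr_ge0//; apply: IH => // m; exact: h.
Qed.

Lemma bernstein_bound n g s (M : R) : 0 <= s <= 1 -> (forall m, `|g m| <= M) ->
  `|bernstein n g s| <= M.
Proof.
move=> s01 h; rewrite -(subr0 (bernstein n g s)) -(bernstein_cst n M s).
by apply: bernstein_le => // m; rewrite subr0.
Qed.

Lemma bernsteinZ n (c : R) g s :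
  bernstein n (fun m => c * g m) s = c * bernstein n g s.
Proof.
elim: n g => [//|n IH] g /=.
rewrite IH (_ : _ \o S = fun m => c * (g \o S) m)// IH; ring.
Qed.

(** The derivative is the degree times the operator applied to forward differences, which the mean
    value theorem will turn into values of a derivative. *)
Lemma bernstein_dE n g s :
  bernstein_d n.+1 g s = n.+1%:R * bernstein n (fun m => g m.+1 - g m) s.
Proof.
elim: n g => [|n IH] g; first by rewrite /=; ring.
have -> : bernstein_d n.+2 g s = (1 - s) * bernstein_d n.+1 g s - bernstein n.+1 g s +
  (s * bernstein_d n.+1 (g \o S) s + bernstein n.+1 (g \o S) s) by [].
rewrite IH (IH (g \o S)).
have E : bernstein n.+1 (fun m => g m.+1 - g m) s =
  (1 - s) * bernstein n (fun m => g m.+1 - g m) s +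
  s * bernstein n (fun m => (g \o S) m.+1 - (g \o S) m) s by [].
have E' : bernstein n.+1 (fun m => g m.+1 - g m) s =
  bernstein n.+1 (g \o S) s - bernstein n.+1 g s by rewrite -bernsteinB.
have -> : n.+2%:R * bernstein n.+1 (fun m => g m.+1 - g m) s =
  n.+1%:R * bernstein n.+1 (fun m => g m.+1 - g m) s +
  bernstein n.+1 (fun m => g m.+1 - g m) s by rewrite -natr1 mulrDl mul1r.
rewrite {2}E' E /=; ring.
Qed.

(** Nodes may be displaced by [1 / (N + 1)] and the degree may be [N] or [N + 1]: differentiation
    lowers the degree by one, and its nodes are intermediate points of the mean value theorem. *)
Lemma bernstein_cvg (h : R -> R) s (M : R) (n : nat -> nat) (xi : nat -> nat -> R) :
  0 <= s <= 1 -> (forall u, `|h u| <= M) -> {for s, continuous h} ->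
  (forall N, n N = N \/ n N = N.+1) ->
  (forall N m, `|xi N m - m%:R / N.+1%:R| <= N.+1%:R^-1) ->
  bernstein (n N) (fun m => h (xi N m)) s @[N --> \oo] --> h s.
Proof.
move=> /[dup] s01 /andP[s0 s1] hM ch nN xiN; apply/cvgrPdist_le => e e0.
have e20 : 0 < e / 2 by rewrite divr_gt0.
have M0 : 0 <= M by rewrite (le_trans _ (hM 0)).
have [d /= d0 hd] : exists2 d : R, 0 < d & forall u, `|u - s| < d + d -> `|h u - h s| <= e / 2.
  move/cvgrPdist_le/(_ _ e20)/nbhs_ballP: ch => [d /= d0 hd].
  exists (d / 2); first by rewrite divr_gt0.
  by move=> u; rewrite -splitr => us; rewrite distrC; apply: hd; rewrite /ball/= distrC.
near=> N.
have N0 : 0 < N.+1%:R :> R by [].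
have Nd : N.+1%:R^-1 < d.
  rewrite invf_plt ?posrE// (@lt_trans _ _ N%:R)// ?ltr_nat//; near: N.
  exact: nbhs_infty_gtr.
have NM : 2 * M / d ^+ 2 / N.+1%:R <= e / 2.
  rewrite ler_pdivrMr// -ler_pdivrMl// (@le_trans _ _ N%:R)// ?ler_nat//.
  by near: N; exact: nbhs_infty_ger.
(* Chebyshev's inequality: at nodes farther than [d] from [s], the crude bound [2 M] is at most [K]
   times the squared distance. *)
set K := 2 * M / d ^+ 2 in NM *.
have K0 : 0 <= K by rewrite /K !mulr_ge0// invr_ge0 exprn_ge0// ltW.
rewrite distrC (le_trans (@bernstein_le _ _
  (fun m => e / 2 + K * (m%:R / N.+1%:R - s) ^+ 2) s _ s01 _))//.
  move=> m; have [dm|dm] := ltP `|m%:R / N.+1%:R - s| d.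
    apply: (@le_trans _ _ (e / 2)); last by rewrite lerDl mulr_ge0// sqr_ge0.
    apply: hd.
    have -> : xi N m - s = (xi N m - m%:R / N.+1%:R) + (m%:R / N.+1%:R - s) by ring.
    by rewrite (le_lt_trans (ler_normD _ _))// ltrD// (le_lt_trans (xiN N m)).
  apply: (@le_trans _ _ (2 * M)).
    by rewrite (le_trans (ler_normB _ _))// mulr2n mulrDl !mul1r lerD.
  apply: (@le_trans _ _ (K * (m%:R / N.+1%:R - s) ^+ 2)); last by rewrite lerDr ltW.
  rewrite -real_normK ?num_real// /K -mulrA ler_peMr// ?mulr_ge0//.
  rewrite mulrC ler_pdivlMr ?exprn_gt0// mul1r lerXn2r// nnegrE//; exact: ltW.
have -> : (fun m : nat => e / 2 + K * (m%:R / N.+1%:R - s) ^+ 2) = (fun m : nat =>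
   (e / 2 + K * s ^+ 2) + (- (2 * K * s / N.+1%:R)) * m%:R + (K / N.+1%:R ^+ 2) * m%:R ^+ 2).
  by apply/funext => m; field; rewrite gt_eqF.
rewrite bernstein_quadratic.
(* The mean squared distance of [m / (N + 1)] to [s]: the binomial variance plus the squared bias
   when the degree is [N] instead of [N + 1]. *)
suff h1 : s ^+ 2 - 2 * s / N.+1%:R * ((n N)%:R * s) + (N.+1%:R ^- 2) *
   ((n N)%:R * s + (n N)%:R * ((n N)%:R - 1) * s ^+ 2) <= N.+1%:R^-1.
  rewrite [leRHS](splitr e).
  apply: (le_trans _ (lerD (lexx (e / 2)) NM)).
  apply: (le_trans _ (lerD (lexx (e / 2)) (ler_wpM2l K0 h1))).
  by rewrite le_eqVlt; apply/orP; left; apply/eqP; field; rewrite gt_eqF.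
have -> : s ^+ 2 - 2 * s / N.+1%:R * ((n N)%:R * s) + (N.+1%:R ^- 2) *
   ((n N)%:R * s + (n N)%:R * ((n N)%:R - 1) * s ^+ 2) =
   ((n N)%:R * s * (1 - s) + (N.+1%:R - (n N)%:R) ^+ 2 * s ^+ 2) / N.+1%:R ^+ 2.
  by field; rewrite gt_eqF.
rewrite ler_pdivrMr ?exprn_gt0// [leRHS](_ : _ = N.+1%:R); last by field; rewrite gt_eqF.
case: (nN N) => ->; last first.
  rewrite subrr expr0n mul0r addr0; have := ler0n R N; rewrite -natr1.
  set t := N%:R => t0; nra.
rewrite -natr1; have := ler0n R N; set t := N%:R => t0.
have -> : t + 1 - t = 1 by ring.
by nra.
Unshelve. all: by end_near. Qed.

End Bernstein.

Section Insertion.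
Context {R : realType} {n : nat}.

Definition ins (u : R) (xi : 'rV[R]_n) : 'rV[R]_n.+1 :=
  \row_j oapp (xi 0) u (unlift ord0 j).

Lemma ins_linear (a u v : R) (xi eta : 'rV[R]_n) :
  ins (a * u + v) (a *: xi + eta) = a *: ins u xi + ins v eta.
Proof. by apply/rowP => j; rewrite !mxE; case: unliftP => [k _|_] /=; rewrite ?mxE. Qed.

Lemma ins_delta0 : ins 1 0 = delta_mx 0 0.
Proof.
apply/rowP => j; rewrite !mxE; case: unliftP => [k ->|->] /=; [by rewrite mxE|by []].
Qed.

Lemma ins_delta j : ins 0 (delta_mx 0 j) = delta_mx 0 (lift ord0 j).
Proof.
apply/rowP => k; rewrite !mxE; case: unliftP => [l ->|->] /=;
[by rewrite mxE !eqxx /= ?(inj_eq lift_inj)|by []].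
Qed.

Lemma ins_continuous (T : topologicalType) (f : T -> R) (g : T -> 'rV[R]_n) :
  continuous f -> continuous g -> continuous (fun x => ins (f x) (g x)).
Proof.
move=> cf cg x; apply: cvg_row => j; rewrite mxE; under eq_fun do rewrite mxE.
case: unliftP => [k _|_] /=; last exact: cf.
by apply: (@continuous_comp _ _ _ g (fun xi : 'rV[R]_n => xi 0 k));
  [exact: cg|exact: coord_continuous].
Qed.

Lemma is_derive_ins0 (phi : 'rV[R]_n.+1 -> R) (u : R) xi d :
  is_derive (ins u xi) (delta_mx 0 0) phi d ->
  is_derive u (1 : R) (fun u => phi (ins u xi)) d.
Proof.
apply: (@is_derive_affine _ _ _ _ phi (ins^~ xi)) => h.
by rewrite -ins_delta0 -ins_linear scaler0 add0r.
Qed.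

Lemma Cb1_ins (phi : 'rV[R]_n.+1 -> R) u : Cb 1 phi -> Cb 1 (phi \o ins u) /\
  forall j, partial j (phi \o ins u) = partial (lift ord0 j) phi \o ins u.
Proof.
move=> /Cb1_elim[b d p].
have ci : continuous (ins u).
  by apply: ins_continuous; [exact: cst_continuous|move=> x; exact: cvg_id].
apply: Cb1_intro => [|j xi|j]; [exact: bounded_continuous_comp| |exact: bounded_continuous_comp].
apply: is_derive_affine (d _ _) => h.
by rewrite -ins_delta -ins_linear mulr0 add0r.
Qed.

End Insertion.

(** * Integration by parts along [C y] for smooth cylinder functions *)

Section GaussianIntegrationByParts.
Context {R : realType} {X : completeNormedModType R}.
Variable gamma : probability (borel X) R.
Hypothesis hgamma : centred_gaussian gamma.
Variable C : dual X -> X.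
Hypothesis hC : covariance_operator gamma C.
Variable y : dual X.
Local Notation k := (C y).
Implicit Types (F G : X -> R) (z w : dual X).

Definition bcont F := continuous F /\ exists M : R, forall x, `|F x| <= M.

Lemma bcontM F G : bcont F -> bcont G -> bcont (fun x => F x * G x).
Proof.
move=> [cf [M fM]] [cg [N gN]]; split; first by move=> x; exact: (continuousM (cf x) (cg x)).
by exists (M * N) => x; rewrite normrM ler_pM.
Qed.

Lemma bcontD F G : bcont F -> bcont G -> bcont (fun x => F x + G x).
Proof.
move=> [cf [M fM]] [cg [N gN]]; split; first by move=> x; exact: (continuousD (cf x) (cg x)).
by exists (M + N) => x; rewrite (le_trans (ler_normD _ _))// lerD.
Qed.

Lemma bcont_cst (a : R) : bcont (fun=> a).
Proof. by split; [exact: cst_continuous|exists `|a|]. Qed.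

Lemma bcontZ (a : R) F : bcont F -> bcont (fun x => a * F x).
Proof. by move=> hF; apply: bcontM => //; exact: bcont_cst. Qed.

Lemma bcontB F G : bcont F -> bcont G -> bcont (fun x => F x - G x).
Proof.
move=> hF hG; have := bcontD hF (bcontZ (-1) hG).
by under eq_fun do rewrite mulN1r.
Qed.

Lemma bcont_sum n (F : 'I_n -> X -> R) : (forall j, bcont (F j)) ->
  bcont (fun x => \sum_(j < n) F j x).
Proof.
elim: n F => [|n IH] F hF.
  by under eq_fun do rewrite big_ord0; exact: bcont_cst.
by under eq_fun do rewrite big_ord_recr/=; apply: bcontD => //; exact: IH.
Qed.

Lemma bcont_integrable F : bcont F ->
  gamma.-integrable [set: borel X] (EFin \o (F : borel X -> R)).
Proof.
move=> [cF [M FM]].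
apply: (@integrable_le _ (borel X) R gamma F (fun=> M)) => //.
  exact: borel_measurable_continuous.
exact: finite_measure_integrable_cst.
Qed.

Lemma bcont_integrable_dual F : bcont F ->
  gamma.-integrable [set: borel X] (EFin \o ((fun x => (y x : R) * F x) : borel X -> R)).
Proof.
move=> [cF [M FM]].
apply: (@integrable_le _ (borel X) R gamma (fun x => (y x : R) * F x) (fun x => M * `|y x|)) => //.
- by apply: measurable_funM; [exact: dual_measurable|exact: borel_measurable_continuous].
- by move=> x; rewrite normrM mulrC ler_wpM2r.
- apply: RintegrableZ; apply: (gaussian_integrable hgamma y (f := fun t => `|t|) (K := 1)).
    exact: measurableT_comp.
  by move=> x; rewrite normr_id mul1r (le_trans (abs_le_expR _))// ler_expR ler_norm.
Qed.

(** [F'] is meant as the derivative of [F] along [k], but only the integral identity is recorded, so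
    that it passes to bounded pointwise limits. *)
Definition ibp F F' := \int[gamma]_(x in [set: borel X]) ((y x : R) * F x) =
  \int[gamma]_(x in [set: borel X]) F' x.

Lemma ibpD F F' G G' : bcont F -> bcont F' -> bcont G -> bcont G' ->
  ibp F F' -> ibp G G' -> ibp (fun x => F x + G x) (fun x => F' x + G' x).
Proof.
move=> hF hF' hG hG' h1 h2; rewrite /ibp.
rewrite (RintegralD _ (bcont_integrable hF') (bcont_integrable hG'))// -h1 -h2.
rewrite -(RintegralD _ (bcont_integrable_dual hF) (bcont_integrable_dual hG))//.
by apply: eq_Rintegral => x _; rewrite mulrDr.
Qed.

Lemma ibpZ (a : R) F F' : bcont F -> bcont F' ->
  ibp F F' -> ibp (fun x => a * F x) (fun x => a * F' x).
Proof.
move=> hF hF' h; rewrite /ibp (RintegralZl _ _ (bcont_integrable hF'))// -h.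
rewrite -(RintegralZl _ _ (bcont_integrable_dual hF))//.
by apply: eq_Rintegral => x _; rewrite mulrCA.
Qed.

Lemma ibp_lim (F F' : X -> R) (F_ F'_ : nat -> X -> R) (M M' : R) :
  (forall n, continuous (F_ n)) -> (forall n, continuous (F'_ n)) ->
  (forall n x, `|F_ n x| <= M) -> (forall n x, `|F'_ n x| <= M') ->
  (forall x, F_ n x @[n --> \oo] --> F x) -> (forall x, F'_ n x @[n --> \oo] --> F' x) ->
  (forall n, ibp (F_ n) (F'_ n)) -> ibp F F'.
Proof.
move=> cF cF' bF bF' lF lF' h.
have iM (K : R) : gamma.-integrable [set: borel X] (EFin \o ((fun=> K) : borel X -> R)).
  exact: finite_measure_integrable_cst.
have [||||_ h1] := @dominated_Rintegral_cvg _ (borel X) R gamma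
  (fun n x => (y x : R) * F_ n x) (fun x => (y x : R) * F x) (fun x => `|(y x : R)| * M).
- by move=> n; apply: measurable_funM;
    [exact: dual_measurable|exact: borel_measurable_continuous].
- by move=> x; apply: cvgZr; exact: lF.
- under eq_fun do rewrite mulrC.
  apply: RintegrableZ; apply: (gaussian_integrable hgamma y (f := fun t => `|t|) (K := 1)).
    exact: measurableT_comp.
  by move=> x; rewrite normr_id mul1r (le_trans (abs_le_expR _))// ler_expR ler_norm.
- by move=> n x; rewrite normrM ler_wpM2l.
have [|||//|_ h2] := @dominated_Rintegral_cvg _ (borel X) R gamma F'_ F' (fun=> M').
- by move=> n; exact: borel_measurable_continuous.
- exact: lF'.
- exact: iM.
move: h1; under eq_fun do rewrite h; move=> h1.
by rewrite /ibp -(cvg_lim _ h1)// -(cvg_lim _ h2).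
Qed.

Lemma bcont_cos z (a : R) : bcont (fun x => cos ((z x : R) + a)).
Proof.
split; last by exists 1 => x; exact: cos_max.
move=> x; apply: (@continuous_comp _ _ _ (fun x => (z x : R) + a) cos);
  last exact: continuous_cos.
by apply: cvgD; [exact: dual_continuous|exact: cvg_cst].
Qed.

Lemma bcont_sin z (a : R) : bcont (fun x => sin ((z x : R) + a)).
Proof.
split; last by exists 1 => x; exact: sin_max.
move=> x; apply: (@continuous_comp _ _ _ (fun x => (z x : R) + a) sin);
  last exact: continuous_sin.
by apply: cvgD; [exact: dual_continuous|exact: cvg_cst].
Qed.

(** Integration by parts for [F] with derivative [F'] along [k], and for its products
    with all cosines of affine functionals: these survive multiplication of [F] by
    [sin w], which is what the Bernstein recursion needs. *)
Definition stable_ibp F F' := [/\ bcont F, bcont F' & forall z (a : R),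
  ibp (fun x => cos ((z x : R) + a) * F x)
      (fun x => cos ((z x : R) + a) * F' x - sin ((z x : R) + a) * (z k : R) * F x)].

Lemma bcont_trig z (a : R) F F' : bcont F -> bcont F' ->
  bcont (fun x => cos ((z x : R) + a) * F x) /\
  bcont (fun x => cos ((z x : R) + a) * F' x - sin ((z x : R) + a) * (z k : R) * F x).
Proof.
move=> hF hF'; have hc := bcont_cos z a; have hs := bcont_sin z a.
split; first exact: bcontM.
apply: bcontB; first exact: bcontM.
by do 2 (apply: bcontM => //); exact: bcont_cst.
Qed.

Lemma stable_ibpB F F' G G' : stable_ibp F F' -> stable_ibp G G' ->
  stable_ibp (fun x => F x - G x) (fun x => F' x - G' x).
Proof.
move=> [hF hF' h1] [hG hG' h2]; split=> [||z a]; [exact: bcontB|exact: bcontB|].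
have [b1 b2] := bcont_trig z a hF hF'; have [b3 b4] := bcont_trig z a hG hG'.
have := ibpD b1 b2 (bcontZ (-1) b3) (bcontZ (-1) b4) (h1 z a) (ibpZ (-1) b3 b4 (h2 z a)).
by congr ibp; apply/funext => x; ring.
Qed.

(** A cosine times [sin w] is a combination of sines at [z + w] and [z - w], so the class is
    preserved. The factor is affine in the sine with values in [[0, 1]], where the Bernstein
    operator is positive. *)
Lemma stable_ibp_mul w F F' : stable_ibp F F' ->
  stable_ibp (fun x => (1 + sin (w x : R)) / 2 * F x)
    (fun x => cos (w x : R) * (w k : R) / 2 * F x + (1 + sin (w x : R)) / 2 * F' x).
Proof.
move=> [hF hF' h].
have hsw : bcont (fun x => sin (w x : R)).
  by have := bcont_sin w 0; under eq_fun do rewrite addr0.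
have hcw : bcont (fun x => cos (w x : R)).
  by have := bcont_cos w 0; under eq_fun do rewrite addr0.
have hs : bcont (fun x => (1 + sin (w x : R)) / 2).
  by apply: bcontM; [apply: bcontD|]; rewrite //; exact: bcont_cst.
split=> [||z a]; first exact: bcontM.
  apply: bcontD; apply: bcontM => //.
  by do 2 (apply: bcontM; last exact: bcont_cst).
(* The phase shift by [pi / 2] turns the cosines of the class into the sines produced by the product
   formula. *)
pose a' : R := a - pi / 2.
have [b1 b2] := bcont_trig z a hF hF'; have [b3 b4] := bcont_trig (z + w) a' hF hF'.
have [b5 b6] := bcont_trig (z - w) a' hF hF'.
have i1 := ibpZ (2^-1) b1 b2 (h z a); have i2 := ibpZ (4^-1) b3 b4 (h (z + w) a').
have i3 := ibpZ (- 4^-1) b5 b6 (h (z - w) a').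
have := ibpD (bcontZ _ b1) (bcontZ _ b2) (bcontD (bcontZ _ b3) (bcontZ _ b5))
  (bcontD (bcontZ _ b4) (bcontZ _ b6)) i1
  (ibpD (bcontZ _ b3) (bcontZ _ b4) (bcontZ _ b5) (bcontZ _ b6) i2 i3).
have cE (t : R) : cos (t + a') = sin (t + a).
  by rewrite /a' addrA cosB cos_pihalf sin_pihalf mulr0 add0r mulr1.
have sE (t : R) : sin (t + a') = - cos (t + a).
  by rewrite /a' addrA sinB cos_pihalf sin_pihalf mulr0 sub0r mulr1.
have e1 x : ((z + w) x : R) + a = ((z x : R) + a) + (w x : R) by rewrite dualD addrAC.
have e2 x : ((z - w) x : R) + a = ((z x : R) + a) - (w x : R) by rewrite dualB addrAC.
congr ibp; apply/funext => x; rewrite !cE ?sE e1 e2.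
  rewrite (sinD ((z x : R) + a)) (sinB ((z x : R) + a)).
  have key (c s cw sw f : R) : 2^-1 * (c * f) + (4^-1 * ((s * cw + c * sw) * f) +
    - 4^-1 * ((s * cw - c * sw) * f)) = c * ((1 + sw) / 2 * f) by field.
  exact: key.
rewrite (sinD ((z x : R) + a)) (sinB ((z x : R) + a)).
rewrite (cosD ((z x : R) + a)) (cosB ((z x : R) + a)) dualD dualB.
have key (c s cw sw zk wk f f' : R) : 2^-1 * (c * f' - s * zk * f) +
  (4^-1 * ((s * cw + c * sw) * f' - - (c * cw - s * sw) * (zk + wk) * f) +
   - 4^-1 * ((s * cw - c * sw) * f' - - (c * cw + s * sw) * (zk - wk) * f)) =
  c * (cw * wk / 2 * f + (1 + sw) / 2 * f') - s * zk * ((1 + sw) / 2 * f) by field.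
exact: key.
Qed.

Lemma stable_ibp_lim (F F' : X -> R) (F_ F'_ : nat -> X -> R) (M M' : R) :
  bcont F -> bcont F' -> (forall n, stable_ibp (F_ n) (F'_ n)) ->
  (forall n x, `|F_ n x| <= M) -> (forall n x, `|F'_ n x| <= M') ->
  (forall x, F_ n x @[n --> \oo] --> F x) -> (forall x, F'_ n x @[n --> \oo] --> F' x) ->
  stable_ibp F F'.
Proof.
move=> hF hF' h hM hM' lF lF'; split=> // z a.
have hb n := let: And3 b1 b2 _ := h n in bcont_trig z a b1 b2.
apply: (@ibp_lim _ _ (fun n x => cos ((z x : R) + a) * F_ n x)
  (fun n x => cos ((z x : R) + a) * F'_ n x - sin ((z x : R) + a) * (z k : R) * F_ n x)
  M (M' + `|z k : R| * M)).
- by move=> n; have [[]] := hb n.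
- by move=> n; have [_ []] := hb n.
- move=> n x; rewrite normrM -(mul1r M).
  by apply: ler_pM => //; exact: cos_max.
- move=> n x; rewrite (le_trans (ler_normB _ _))//; apply: lerD.
    by rewrite normrM -(mul1r M'); apply: ler_pM => //; exact: cos_max.
  rewrite !normrM; apply: ler_pM => //.
  by rewrite -[leRHS]mul1r; apply: ler_wpM2r => //; exact: sin_max.
- by move=> x; apply: cvgZr; exact: lF.
- by move=> x; apply: cvgB; apply: cvgZr; [exact: lF'|exact: lF].
- by move=> n; have [_ _] := h n; exact.
Qed.

Lemma stable_ibp_bernstein w N (G G' : nat -> X -> R) :
  (forall m, stable_ibp (G m) (G' m)) ->
  stable_ibp (fun x => bernstein N (G^~ x) ((1 + sin (w x : R)) / 2))
    (fun x => cos (w x : R) * (w k : R) / 2 *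
       bernstein_d N (G^~ x) ((1 + sin (w x : R)) / 2) +
     bernstein N (G'^~ x) ((1 + sin (w x : R)) / 2)).
Proof.
elim: N G G' => [|N IH] G G' h.
  have := h 0%N; congr stable_ibp; apply/funext => x /=.
  by rewrite mulr0 add0r.
have h1 := IH _ _ h; have h2 := IH (fun m => G m.+1) (fun m => G' m.+1) (fun m => h m.+1).
(* Addition is expressed by differences: [(F - s F) - ((F - F) - s G)] is [(1 - s) F + s G]. *)
have := stable_ibpB (stable_ibpB h1 (stable_ibp_mul w h1))
  (stable_ibpB (stable_ibpB h1 h1) (stable_ibp_mul w h2)).
congr stable_ibp; apply/funext => x /=.
  by rewrite (_ : G^~ x \o S = fun m => G m.+1 x)//; ring.
rewrite (_ : G^~ x \o S = fun m => G m.+1 x)// (_ : G'^~ x \o S = fun m => G' m.+1 x)//.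
by ring.
Qed.

Lemma covariance_sym z w : (w (C z) : R) = z (C w).
Proof. by rewrite !hC; apply: eq_Rintegral => x _; rewrite mulrC. Qed.

(** The derivative at [t = 0] of the integral of [cos (z + t y + c)] is computed twice: under the
    integral sign, and from the closed Gaussian formula, where the covariance [z k] appears in the
    linear coefficient of [q]. *)
Lemma stable_ibp_cst (b : R) : stable_ibp (fun=> b) (fun=> 0).
Proof.
split=> [||z a]; [exact: bcont_cst|exact: bcont_cst|].
suff h (c : R) : \int[gamma]_(x in [set: borel X]) ((y x : R) * sin ((z x : R) + c)) =
    (z k : R) * \int[gamma]_(x in [set: borel X]) cos ((z x : R) + c).
  have cE (t : R) : cos (t + a) = sin (t + (a + pi / 2)).
    by rewrite addrA sinD cos_pihalf sin_pihalf mulr0 add0r mulr1.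
  have sE (t : R) : sin (t + a) = - cos (t + (a + pi / 2)).
    by rewrite addrA cosD cos_pihalf sin_pihalf mulr0 sub0r mulr1 opprK.
  have b1 := bcont_cos z (a + pi / 2); have b2 := bcont_sin z (a + pi / 2).
  have : ibp (fun x => sin ((z x : R) + (a + pi / 2)))
      (fun x => (z k : R) * cos ((z x : R) + (a + pi / 2))).
    by rewrite /ibp h (RintegralZl _ _ (bcont_integrable b1)).
  move=> /(ibpZ b b2 (bcontZ _ b1)).
  by congr ibp; apply/funext => x; rewrite ?cE ?sE; ring.
pose f (t : R) (x : borel X) := cos (((z + t *: y) x : R) + c).
pose f' (t : R) (x : borel X) := - sin ((z x : R) + t * (y x : R) + c) * (y x : R).
have d1 : is_derive (0 : R) (1 : R) (fun t => \int[gamma]_x f t x) (\int[gamma]_x f' 0 x).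
  apply: (@is_derive_Rintegral _ _ (borel X) gamma f f' (fun x => `|y x|)).
  - move=> t x; rewrite /f /f'.
    under eq_fun do rewrite dualD dualZ.
    have h : is_derive t (1 : R) (fun t => (z x : R) + t * (y x : R) + c) (y x : R).
      by apply: is_derive_eq; rewrite /GRing.scale/= /cst; ring.
    by rewrite /GRing.scale/=; exact: (@is_derive1_comp _ cos _ t _ _ _ h).
  - by move=> t; exact/bcont_integrable/bcont_cos.
  - apply: (gaussian_integrable hgamma y (f := fun t => `|t|) (K := 1)).
      exact: measurableT_comp.
    by move=> x; rewrite normr_id mul1r (le_trans (abs_le_expR _))// ler_expR ler_norm.
  - move=> t x; rewrite /f' normrM normrN -[leRHS]mul1r; apply: ler_wpM2r => //.
    exact: sin_max.
pose q (t : R) : R := (z (C z) : R) + 2 * t * (z k : R) + t ^+ 2 * (y k : R).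
have fE t : \int[gamma]_x f t x = cos c * expR (- (q t / 2)).
  rewrite (gaussian_cos hgamma hC); congr (_ * expR (- (_ / 2))).
  set z' := z + t *: y; rewrite {1}/z' dualD dualZ (covariance_sym z' z) (covariance_sym z' y).
  by rewrite /z' !dualD !dualZ (covariance_sym z y) /q; ring.
have d2 : is_derive (0 : R) (1 : R) (fun t => \int[gamma]_x f t x)
    (- (z k : R) * (cos c * expR (- ((z (C z) : R) / 2)))).
  under eq_fun do rewrite fE.
  have key (u v w b' : R) : is_derive (0 : R) (1 : R)
      (fun t => b' * expR (- ((u + 2 * t * v + t ^+ 2 * w) / 2))) (- v * (b' * expR (- (u / 2)))).
    have dq : is_derive (0 : R) (1 : R) (fun t => - ((u + 2 * t * v + t ^+ 2 * w) / 2)) (- v).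
      by apply: is_derive_eq; rewrite /GRing.scale/= /cst; field.
    have de := @is_derive1_comp _ expR _ 0 _ _ (is_derive_expR _) dq.
    have h := is_deriveZ b' de.
    by apply: (is_derive_eq h); rewrite /GRing.scale/= mulr0 mul0r addr0 expr0n mul0r addr0; ring.
  exact: key.
have [_ E1] := d1; have [_] := d2; rewrite E1 => E.
have E2 : \int[gamma]_x f' 0 x =
    - \int[gamma]_(x in [set: borel X]) ((y x : R) * sin ((z x : R) + c)).
  rewrite -mulN1r -(RintegralZl _ _ (bcont_integrable_dual (bcont_sin z c)))//.
  by apply: eq_Rintegral => x _; rewrite /f' mul0r addr0; ring.
by rewrite (gaussian_cos hgamma hC); move: E; rewrite E2 mulNr => /oppr_inj.
Qed.

(** The cylinder function is a limit of Bernstein polynomials in [sin (x_1 / L)], for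
    which the identity reduces to cylinder functions of one variable less. *)
Lemma stable_ibp_cyl n (phi : 'rV[R]_n -> R) (xs : 'I_n -> dual X) : Cb 1 phi ->
  let c := Cylinder R X n phi xs in
  stable_ibp (cyl_fun c) (fun x => cyl_grad c x k).
Proof.
elim: n phi xs => [|n IH] phi xs hphi /=.
  have := stable_ibp_cst (phi 0); congr stable_ibp; apply/funext => x.
    by rewrite /cyl_fun; congr phi; apply/rowP => -[].
  by rewrite /cyl_grad big_ord0.
have /Cb1_elim[[cphi [M0 hM0]] dphi pphi] := hphi.
have /choice[Mj hMj] j := (pphi j).2.
pose xs' j := xs (lift ord0 j); pose x1 := xs ord0.
pose c' u := Cylinder R X n (phi \o ins u) xs'.
pose T' (x : X) : 'rV[R]_n := \row_j xs' j x.
have TE x : cyl_coord (Cylinder R X n.+1 phi xs) x = ins (x1 x) (T' x).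
  by apply/rowP => j; rewrite !mxE /=; case: unliftP => [l ->|->] //=; rewrite mxE.
have cT' : continuous T'.
  move=> x; apply: cvg_row => j; rewrite mxE; under eq_fun do rewrite mxE.
  exact: dual_continuous.
have pE u j := (Cb1_ins u hphi).2 j.
(* With the first variable frozen, the induction hypothesis applies to the remaining functionals. *)
have slice u : stable_ibp (fun x => phi (ins u (T' x)))
    (fun x => \sum_(j < n) partial (lift ord0 j) phi (ins u (T' x)) * (xs' j k : R)).
  have := IH _ xs' (Cb1_ins u hphi).1.
  congr stable_ibp; apply/funext => x.
  rewrite /cyl_grad dual_sum; apply: eq_bigr => j _.
  by rewrite dualZ /cyl_d /= pE.
pose D0 := partial ord0 phi.
pose grad' u x := \sum_(j < n) partial (lift ord0 j) phi (ins u (T' x)) * (xs' j k : R).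
pose K' := \sum_(j < n) Mj (lift ord0 j) * `|xs' j k : R|.
have grad'_le u x : `|grad' u x| <= K'.
  apply: (le_trans (ler_norm_sum _ _ _)); apply: ler_sum => j _.
  by rewrite normrM ler_wpM2r// hMj.
have cins (T : topologicalType) (g : 'rV[R]_n.+1 -> R) (f : T -> R) (v : T -> X) :
    continuous g -> continuous f -> continuous v -> continuous (fun t => g (ins (f t) (T' (v t)))).
  move=> cg cf cv t; apply: (@continuous_comp _ _ _ (fun t => ins (f t) (T' (v t))) g);
    last exact: cg.
  apply: ins_continuous => // t'.
  by apply: (@continuous_comp _ _ _ v T'); [exact: cv|exact: cT'].
have cgrad' (T : topologicalType) (f : T -> R) (v : T -> X) :
    continuous f -> continuous v -> continuous (fun t => grad' (f t) (v t)).
  move=> cf cv t; apply: cvg_ord_sum => j.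
  by apply: cvgM; [exact: (cins _ _ f v (pphi (lift ord0 j)).1 cf cv t)|exact: cvg_cst].
have cid : continuous (id : X -> X) by move=> x; exact: cvg_id.
have sin01 (t : R) : 0 <= (1 + sin t) / 2 <= 1.
  have := sin_max t; rewrite ler_norml => /andP[h1 h2]; apply/andP; split; lra.
have stL (L : R) : 0 < L -> stable_ibp (fun x => phi (ins (L * sin ((x1 x : R) / L)) (T' x)))
    (fun x => D0 (ins (L * sin ((x1 x : R) / L)) (T' x)) * (cos ((x1 x : R) / L) * (x1 k : R)) +
       grad' (L * sin ((x1 x : R) / L)) x).
  (* [a] maps [[0, 1]] onto [[- L, L]] and sends [(1 + sin w) / 2] to [L sin (x_1 / L)]. *)
  move=> L0; pose w := L^-1 *: x1; pose a (u : R) := L * (2 * u - 1).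
  have wE x : (w x : R) = (x1 x : R) / L by rewrite /w dualZ mulrC.
  have ca : continuous a.
    move=> u; apply: cvgM; first exact: cvg_cst.
    by apply: cvgB; [apply: cvgM; [exact: cvg_cst|exact: cvg_id]|exact: cvg_cst].
  have aE x : a ((1 + sin (w x : R)) / 2) = L * sin ((x1 x : R) / L).
    by rewrite /a wE; congr (_ * _); field.
  pose G (N m : nat) x := phi (ins (a (m%:R / N.+1%:R)) (T' x)).
  pose G' (N m : nat) x := grad' (a (m%:R / N.+1%:R)) x.
  have stN N := @stable_ibp_bernstein w N.+1 (G N) (G' N) (fun m => slice _).
  have da (x : X) (u : R) : is_derive u (1 : R) (fun u => phi (ins (a u) (T' x)))
      (D0 (ins (a u) (T' x)) * (2 * L)).
    apply: (@is_derive1_comp _ (fun u => phi (ins u (T' x))) a u).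
      exact: (is_derive_ins0 (dphi ord0 _)).
    by rewrite /a; apply: is_derive_eq; rewrite /GRing.scale/= /cst; ring.
  have mvt (x : X) : exists xi : nat -> nat -> R,
      (forall N m, `|xi N m - m%:R / N.+1%:R| <= N.+1%:R^-1) /\
      forall N m, N.+1%:R * (G N m.+1 x - G N m x) = D0 (ins (a (xi N m)) (T' x)) * (2 * L).
    have h N m : exists xi : R, `|xi - m%:R / N.+1%:R| <= N.+1%:R^-1 /\
        N.+1%:R * (G N m.+1 x - G N m x) = D0 (ins (a xi) (T' x)) * (2 * L).
      have N0 : 0 < N.+1%:R :> R by [].
      have mE : m.+1%:R / N.+1%:R - m%:R / N.+1%:R = N.+1%:R^-1 :> R.
        by rewrite -mulrBl -natr1 addrAC subrr add0r mul1r.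
      have mm : m%:R / N.+1%:R < m.+1%:R / N.+1%:R :> R by rewrite ltr_pM2r ?invr_gt0// ltr_nat.
      have [xi] := MVT mm (fun u _ => da x u) (is_derive_itv_continuous (da x)).
      rewrite in_itv/= mE => /andP[x0 xm] E; exists xi; split.
        rewrite ger0_norm; last by rewrite subr_ge0 ltW.
        by rewrite -[leRHS]mE lerD2r ltW.
      by rewrite /G E mulrC mulfVK// gt_eqF.
    have /choice[xi h1] N : exists f : nat -> R, forall m, `|f m - m%:R / N.+1%:R| <= N.+1%:R^-1 /\
        N.+1%:R * (G N m.+1 x - G N m x) = D0 (ins (a (f m)) (T' x)) * (2 * L).
      by have /choice[f hf] := h N; exists f.
    by exists xi; split=> N m; have [] := h1 N m.
  have wE' : (w k : R) = L^-1 * (x1 k : R) by rewrite /w dualZ.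
  have K'0 : 0 <= K' by rewrite (le_trans _ (grad'_le 0 0)).
  have MD0 : 0 <= Mj ord0 by rewrite (le_trans _ (hMj ord0 0)).
  have hh N x : N.+1%:R * bernstein N (fun m => G N m.+1 x - G N m x) ((1 + sin (w x : R)) / 2)
      = bernstein N (fun m => N.+1%:R * (G N m.+1 x - G N m x)) ((1 + sin (w x : R)) / 2).
    by rewrite bernsteinZ.
  have cD : continuous D0 by have [] := pphi ord0.
  have cL : continuous (fun x => L * sin ((x1 x : R) / L)).
    move=> x; apply: cvgM; first exact: cvg_cst.
    apply: (@continuous_comp _ _ _ (fun x => (x1 x : R) / L) sin);
      last exact: continuous_sin.
    by apply: cvgM; [exact: dual_continuous|exact: cvg_cst].
  apply: (stable_ibp_lim (M := M0) (M' := `|w k : R| / 2 * (Mj ord0 * (2 * L)) + K')) stN _ _ _ _.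
  - by split; [exact: (cins _ _ _ id)|exists M0 => x; exact: hM0].
  - apply: bcontD; last first.
      by split; [exact: (cgrad' _ _ id)|exists K' => x; exact: grad'_le].
    apply: bcontM; first by split; [exact: (cins _ _ _ id)|exists (Mj ord0) => x; exact: hMj].
    apply: bcontM; last exact: bcont_cst.
    have := bcont_cos w 0; congr bcont; apply/funext => x; by rewrite addr0 wE.
  - by move=> N x; apply: bernstein_bound => // m; exact: hM0.
  - move=> N x; rewrite (le_trans (ler_normD _ _))//; apply: lerD; last first.
      by apply: bernstein_bound => // m; exact: grad'_le.
    rewrite bernstein_dE hh normrM; apply: ler_pM => //.
      have hb (t u : R) : `|t| <= 1 -> `|t * u / 2| <= `|u| / 2.
        move=> t1; rewrite !normrM (ger0_norm (_ : 0 <= 2^-1 :> R))// ler_wpM2r//.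
        by rewrite -[leRHS]mul1r ler_wpM2r.
      by apply: hb; exact: cos_max.
    apply: bernstein_bound => // m.
    have [xi [_ ->]] := mvt x; rewrite normrM; apply: ler_pM => //; first exact: hMj.
    by rewrite ger0_norm// mulr_ge0// ltW.
  - move=> x; rewrite -aE.
    apply: (@bernstein_cvg _ (fun u => phi (ins (a u) (T' x))) _ M0 succn
      (fun N m => m%:R / N.+1%:R)) => //.
    + by apply: (cins _ _ a (fun=> x)) => //; exact: cst_continuous.
    + by right.
    + by move=> N m; rewrite subrr normr0.
  - move=> x; rewrite -aE; apply: cvgD.
      have [xi [hxi1 hxi2]] := mvt x.
      under eq_fun do rewrite bernstein_dE hh.
      have -> : (fun N => cos (w x : R) * (w k : R) / 2 * bernstein N
          (fun m => N.+1%:R * (G N m.+1 x - G N m x)) ((1 + sin (w x : R)) / 2)) =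
        (fun N => cos (w x : R) * (w k : R) / 2 * bernstein N
          (fun m => D0 (ins (a (xi N m)) (T' x)) * (2 * L)) ((1 + sin (w x : R)) / 2)).
        by apply/funext => N; congr (_ * bernstein _ _ _); apply/funext => m; rewrite hxi2.
      have -> : D0 (ins (a ((1 + sin (w x : R)) / 2)) (T' x)) * (cos ((x1 x : R) / L) * (x1 k : R))
        = cos (w x : R) * (w k : R) / 2 *
          (D0 (ins (a ((1 + sin (w x : R)) / 2)) (T' x)) * (2 * L)).
        rewrite wE' wE; field; exact: lt0r_neq0.
      apply: cvgZr.
      apply: (@bernstein_cvg _ (fun u => D0 (ins (a u) (T' x)) * (2 * L)) _
        (Mj ord0 * (2 * L)) id xi) => //.
      + move=> u; rewrite normrM; apply: ler_pM => //; first exact: hMj.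
        by rewrite ger0_norm// mulr_ge0// ltW.
      + apply: cvgM; last exact: cvg_cst.
        by apply: (cins _ _ a (fun=> x)) => //; exact: cst_continuous.
      + by left.
    apply: (@bernstein_cvg _ (fun u => grad' (a u) x) _ K' succn
      (fun N m => m%:R / N.+1%:R)) => //.
    + by apply: (cgrad' _ a (fun=> x)) => //; exact: cst_continuous.
    + by right.
    + by move=> N m; rewrite subrr normr0.
have lim_sin (t : R) : N.+1%:R * sin (t / N.+1%:R) @[N --> \oo] --> t.
  have d : is_derive (0 : R) (1 : R) (fun s : R => sin (s * t)) t.
    have h : is_derive (0 : R) (1 : R) (fun s : R => s * t) t.
      by apply: is_derive_eq; rewrite /GRing.scale/= /cst; ring.
    apply: (is_derive_eq (@is_derive1_comp _ sin _ 0 _ _ (is_derive_sin _) h)).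
    by rewrite mul0r cos0 mul1r.
  have [dd dE] := d; move: dd; rewrite /derivable => /cvg_ex[l hl].
  have lE : l = t by rewrite -dE /derive; apply/esym/cvg_lim.
  move: hl; rewrite lE => /cvgr_dnbhsP/(_ (fun N => N.+1%:R^-1)).
  move=> h; have /h : (forall N : nat, (N.+1%:R^-1 : R) != 0) /\
      (N.+1%:R^-1 : R) @[N --> \oo] --> (0 : R).
    split=> [N|]; first by rewrite invr_eq0.
    apply: (@cvg_harmonic_bound _ _ _ _ 1) => N.
    by rewrite subr0 mul1r ger0_norm.
  apply: cvg_trans; apply: near_eq_cvg; near=> N.
  by rewrite /= addr0 mul0r sin0 subr0 invrK /GRing.scale/= mulr1 [t / _]mulrC.
have lim_cos (t : R) : cos (t / N.+1%:R) @[N --> \oo] --> (1 : R).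
  rewrite -[X in _ --> X]cos0; apply: continuous_cvg; first exact: continuous_cos.
  apply: (@cvg_harmonic_bound _ _ _ _ `|t|) => N.
  by rewrite subr0 normrM (ger0_norm (_ : 0 <= N.+1%:R^-1 :> R)).
have MD0 : 0 <= Mj ord0 by rewrite (le_trans _ (hMj ord0 0)).
have -> : (fun x => cyl_grad (Cylinder R X n.+1 phi xs) x k) =
    (fun x => D0 (ins (x1 x) (T' x)) * (x1 k : R) + grad' (x1 x) x).
  apply/funext => x; rewrite /cyl_grad dual_sum big_ord_recl dualZ /cyl_d TE.
  by congr (_ + _); apply: eq_bigr => j _; rewrite dualZ /cyl_d TE.
have -> : cyl_fun (Cylinder R X n.+1 phi xs) = (fun x => phi (ins (x1 x) (T' x))).
  by apply/funext => x; rewrite /cyl_fun TE.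
have cx1 : continuous (x1 : X -> R) by exact: dual_continuous.
have cD : continuous D0 by have [] := pphi ord0.
apply: (stable_ibp_lim (M := M0) (M' := Mj ord0 * `|x1 k : R| + K'))
  (fun N => stL N.+1%:R (ltr0Sn R N)) _ _ _ _.
- by split; [exact: (cins _ _ _ id)|exists M0 => x; exact: hM0].
- apply: bcontD; last first.
    by split; [exact: (cgrad' _ _ id)|exists K' => x; exact: grad'_le].
  apply: bcontM; last exact: bcont_cst.
  by split; [exact: (cins _ _ _ id)|exists (Mj ord0) => x; exact: hMj].
- by move=> N x; exact: hM0.
- move=> N x; rewrite (le_trans (ler_normD _ _))//; apply: lerD; last exact: grad'_le.
  rewrite normrM; apply: ler_pM => //; first exact: hMj.
  by rewrite normrM -[leRHS]mul1r ler_wpM2r// cos_max.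
- move=> x.
  apply: (@cvg_comp _ _ _ _ (fun u => phi (ins u (T' x))) _ _ _ (lim_sin (x1 x))).
  by apply: (cins _ _ id (fun=> x)) => //; [by move=> u; exact: cvg_id|exact: cst_continuous].
- move=> x; apply: cvgD.
    rewrite -[X in _ --> D0 _ * X]mul1r; apply: cvgM; last first.
      by apply: cvgM; [exact: lim_cos|exact: cvg_cst].
    apply: (@cvg_comp _ _ _ _ (fun u => D0 (ins u (T' x))) _ _ _ (lim_sin (x1 x))).
    by apply: (cins _ _ id (fun=> x)) => //; [by move=> u; exact: cvg_id|exact: cst_continuous].
  apply: (@cvg_comp _ _ _ _ (fun u => grad' u x) _ _ _ (lim_sin (x1 x))).
  by apply: (cgrad' _ id (fun=> x)) => //; [by move=> u; exact: cvg_id|exact: cst_continuous].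
Unshelve. all: by end_near. Qed.

Lemma gaussian_ibp (c : cylinder X) : Cb 1 (cyl_phi c) ->
  \int[gamma]_(x in [set: borel X]) ((y x : R) * cyl_fun c x) =
  \int[gamma]_(x in [set: borel X]) (cyl_grad c x k : R).
Proof.
case: c => n phi xs /= hphi; have [_ _ /(_ 0 0) h] := stable_ibp_cyl xs hphi.
transitivity (\int[gamma]_(x in [set: borel X])
  ((y x : R) * (cos (((0 : dual X) x : R) + 0) * cyl_fun (Cylinder R X n phi xs) x))).
  by apply: eq_Rintegral => x _; rewrite dual0 addr0 cos0 mul1r.
rewrite h; apply: eq_Rintegral => x _.
by rewrite dual0 addr0 cos0 sin0 !mul0r subr0 mul1r.
Qed.

End GaussianIntegrationByParts.

(** * The weighted measure *)

Section AffineMinorant.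
Context {R : realType} {X : normedModType R} (U : X -> \bar R).
Hypotheses (U_proper : proper_fun U) (U_lsc : lower_semicontinuous U) (U_convex : econvex U).

Let V x := fine (U x).
Let dom : set X := [set x | U x != +oo%E].

Let UE x : dom x -> U x = (V x)%:E.
Proof.
move=> dx; rewrite /V fineK// fin_numE; apply/andP; split=> //.
exact: U_proper.1.
Qed.

Let V_convex x y (t : R) : dom x -> dom y -> 0 <= t -> t <= 1 ->
  dom (t *: x + (1 - t) *: y) /\ V (t *: x + (1 - t) *: y) <= t * V x + (1 - t) * V y.
Proof.
move=> dx dy t0 t1; have := U_convex x y t0 t1.
rewrite (UE dx) (UE dy) -!EFinM -EFinD => h.
have d : dom (t *: x + (1 - t) *: y).
  by apply/eqP => E; move: h; rewrite E leNgt ltry.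
by split=> //; move: h; rewrite (UE d) lee_fin.
Qed.

(** Lower semicontinuity bounds [U] from below on a ball around [x0]. For [y] farther away,
    convexity carries the bound from the point at distance [s] on the segment out to [y], with a
    loss linear in the distance and of slope [s^-1]. *)
Let cone_minorant x0 : dom x0 -> exists C : R, 0 <= C /\
  forall y, dom y -> V x0 - 1 - C * `|y - x0| <= V y.
Proof.
move=> d0.
have [N nN hN] : exists2 N, nbhs x0 N & forall y, N y -> ((V x0 - 1)%:E < U y)%E.
  by apply: U_lsc; rewrite (UE d0) lte_fin ltrBlDr ltrDl.
have /nbhs_ballP[r /= r0 hr] := nN.
pose s := r / 2; have s0 : 0 < s by rewrite divr_gt0.
exists s^-1; split=> [|y dy]; first by rewrite invr_ge0 ltW.
have [ys|ys] := leP `|y - x0| s.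
  have Ny : N y.
    apply: hr; rewrite -ball_normE /= distrC (le_lt_trans ys)//.
    by rewrite /s ltr_pdivrMr// ltr_pMr// ltr1n.
  have := hN y Ny; rewrite (UE dy) lte_fin => h.
  by rewrite lerBlDr (le_trans (ltW h))// lerDl mulr_ge0// invr_ge0 ltW.
have y0 : 0 < `|y - x0| by exact: lt_trans ys.
pose t := s / `|y - x0|.
have t0 : 0 < t by rewrite divr_gt0.
have t1 : t <= 1 by rewrite /t ler_pdivrMr// mul1r ltW.
have [dz hz] := V_convex dy d0 (ltW t0) t1.
set z := t *: y + (1 - t) *: x0 in dz hz.
have Nz : N z.
  apply: hr; rewrite -ball_normE /= distrC.
  have -> : z - x0 = t *: (y - x0).
    by rewrite /z scalerBl scale1r scalerBr (addrC x0) addrA addrK.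
  rewrite normrZ gtr0_norm// /t mulfVK ?gt_eqF//.
  by rewrite /s ltr_pdivrMr// ltr_pMr// ltr1n.
have := hN z Nz; rewrite (UE dz) lte_fin => h.
have : V x0 - 1 <= t * V y + (1 - t) * V x0 := le_trans (ltW h) hz.
have -> : s^-1 * `|y - x0| = t^-1 by rewrite /t [RHS]invf_div mulrC.
move=> h1.
have h2 : t * (V x0 - t^-1) <= t * V y by rewrite mulrBr divff ?gt_eqF//; lra.
rewrite ler_pM2l// in h2; lra.
Qed.

(** The functional is obtained by Hahn-Banach below the inf-convolution of [U] with a
    multiple of the norm, which is finite by lower semicontinuity at one point. *)
Lemma affine_minorant : exists (a : R) (l : dual X), forall x, ((a + (l x : R))%:E <= U x)%E.
Proof.
have [x0 d0] := U_proper.2.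
have [C [C0 hC]] := cone_minorant d0.
pose K_ x := [set V y + C * `|x - y| | y in dom].
pose K x := inf (K_ x).
have K_lb x : lbound (K_ x) (V x0 - 1 - C * `|x - x0|).
  move=> _ [y dy <-]; have := hC y dy.
  have : C * `|y - x0| <= C * `|x - x0| + C * `|x - y|.
    by rewrite -mulrDr; apply: ler_wpM2l => //; rewrite [leRHS]addrC (distrC x y) ler_distD.
  lra.
have hK x : has_inf (K_ x).
  by split; [exists (V x0 + C * `|x - x0|), x0|exists (V x0 - 1 - C * `|x - x0|)].
have K_le x y : dom y -> K x <= V y + C * `|x - y|.
  by move=> dy; apply: ge_inf; [exact: (hK x).2|exists y].
have K_adh x (e : R) : 0 < e -> exists2 y, dom y & V y + C * `|x - y| < K x + e.
  move=> e0; have [_ [y dy <-] h] := inf_adherent e0 (hK x).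
  by exists y.
have K_lip x x' : K x <= K x' + C * `|x - x'|.
  apply/ler_addgt0Pr => e e0; have [y dy h] := K_adh x' e e0.
  apply: (le_trans (K_le x y dy)).
  have : C * `|x - y| <= C * `|x - x'| + C * `|x' - y|.
    by rewrite -mulrDr; apply: ler_wpM2l => //; rewrite ler_distD.
  lra.
have K_convex : rconvex K.
  move=> x x' t t0 t1; apply/ler_addgt0Pr => e e0.
  have [y dy h] := K_adh x e e0; have [y' dy' h'] := K_adh x' e e0.
  have [d hV] := V_convex dy dy' t0 t1.
  apply: (le_trans (K_le _ _ d)).
  have hn : `|t *: x + (1 - t) *: x' - (t *: y + (1 - t) *: y')| <=
      t * `|x - y| + (1 - t) * `|x' - y'|.
    rewrite opprD addrACA -!scalerBr (le_trans (ler_normD _ _))// !normrZ.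
    by rewrite (ger0_norm t0) ger0_norm// subr_ge0.
  have hn' := ler_wpM2l C0 hn.
  have h1 := ler_wpM2l t0 (ltW h); have t1' : 0 <= 1 - t by rewrite subr_ge0.
  have h2 := ler_wpM2l t1' (ltW h').
  move: hV hn' h1 h2; lra.
have [||l ll hl] := @hahn_banach R X (fun x => K x - K 0).
- by move=> x y t t0 t1; have := K_convex x y t t0 t1; lra.
- by rewrite subrr.
(* The Lipschitz constant of the inf-convolution bounds the functional, which makes it
   continuous. *)
have lC x : (l x : R) <= C * `|x|.
  by have := K_lip x 0; have := hl x; rewrite subr0; lra.
have lN x : (l (- x) : R) = - l x.
  have l0 : l 0 = 0 by have := ll (-1) 0 0; rewrite scaler0 addr0 scaleN1r addNr.
  by have := ll (-1) x 0; rewrite l0 !addr0 !scaleN1r.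
have [L LE] : exists L : dual X, forall x, L x = l x.
  apply: (@mk_dual _ _ l C) => // x; rewrite ler_norml lC andbT.
  by rewrite -[leRHS]opprK lerN2 -lN (le_trans (lC _))// normrN.
exists (K 0), L => x.
have [/eqP ->|dx] := boolP (U x == +oo%E); first exact: leey.
rewrite (UE dx) lee_fin LE; have := hl x; have := K_le x x dx.
rewrite subrr normr0 mulr0; lra.
Qed.

End AffineMinorant.

(** * Norms expressed by real integrals *)

Section RealLnorm.
Context d (T : measurableType d) (R : realType) (mu : {measure set T -> \bar R}).
Implicit Types f g : T -> R.

Lemma poweR_norm_nat (r : R) n : (`|r%:E| `^ n%:R = (`|r| ^+ n)%:E)%E.
Proof. by rewrite abse_EFin poweR_EFin powR_mulrn. Qed.

Lemma Lnorm_natE f n : ('N[mu]_(n.+1%:R%:E)[EFin \o f] =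
  (\int[mu]_x (`|f x| ^+ n.+1)%:E) `^ n.+1%:R^-1)%E.
Proof.
rewrite unlock; congr (_ `^ _)%E.
by apply: eq_integral => x _; rewrite -poweR_norm_nat.
Qed.

Lemma Lnorm_nat_lty f n : measurable_fun [set: T] f ->
  ('N[mu]_(n.+1%:R%:E)[EFin \o f] < +oo)%E <->
  mu.-integrable [set: T] (EFin \o (fun x => `|f x| ^+ n.+1)).
Proof.
move=> mf; rewrite Lnorm_natE.
have E : (\int[mu]_x `|(`|f x| ^+ n.+1)%:E| = \int[mu]_x (`|f x| ^+ n.+1)%:E)%E.
  by apply: eq_integral => x _; rewrite abse_EFin ger0_norm ?exprn_ge0.
split=> [h|/integrableP[_]]; last by rewrite E; exact: poweR_lty.
apply/integrableP; split.
  apply/measurable_EFinP; apply: measurable_funX; exact: measurableT_comp.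
rewrite /comp E ltey; apply/eqP => Ey; move: h; by rewrite Ey poweRyr ?ltxx// ?invr_eq0 ?pnatr_eq0.
Qed.

Lemma Lnorm2_lty f : measurable_fun [set: T] f ->
  ('N[mu]_(2%:E)[EFin \o f] < +oo)%E <-> sqint mu f.
Proof.
move=> mf; rewrite (Lnorm_nat_lty 1 mf).
have E : (fun x => `|f x| ^+ 2) = (fun x => f x ^+ 2).
  by apply/funext => x; rewrite real_normK// num_real.
by rewrite E; split=> [h|[]].
Qed.

Lemma Rintegral_sqr_ge0 f : 0 <= \int[mu]_x (f x ^+ 2).
Proof. by apply: Rintegral_ge0 => x _; exact: sqr_ge0. Qed.

Lemma Lnorm2E f : sqint mu f ->
  ('N[mu]_(2%:E)[EFin \o f] = (Num.sqrt (\int[mu]_x (f x ^+ 2)))%:E)%E.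
Proof.
move=> [mf fi]; rewrite (Lnorm_natE f 1).
have -> : (\int[mu]_x (`|f x| ^+ 2)%:E = (\int[mu]_x (f x ^+ 2))%:E)%E.
  rewrite /Rintegral fineK ?integrable_fin_num//.
  by apply: eq_integral => x _; rewrite real_normK// num_real.
by rewrite poweR_EFin powR12_sqrt// Rintegral_sqr_ge0.
Qed.

Lemma Lnorm2_cvg0 (f_ : nat -> T -> R) : (forall n, sqint mu (f_ n)) ->
  'N[mu]_(2%:E)[EFin \o f_ n]%E @[n --> \oo] --> 0%E <->
  \int[mu]_x (f_ n x ^+ 2) @[n --> \oo] --> 0.
Proof.
move=> sf; have E : (fun n => 'N[mu]_(2%:E)[EFin \o f_ n]%E) =
    EFin \o (fun n => Num.sqrt (\int[mu]_x (f_ n x ^+ 2))).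
  by apply/funext => n; rewrite Lnorm2E.
rewrite E; split=> [/fine_cvgP[_]|h].
  rewrite /comp/= => h.
  have -> : (fun n => \int[mu]_x (f_ n x ^+ 2)) = (fun n =>
      Num.sqrt (\int[mu]_x (f_ n x ^+ 2)) * Num.sqrt (\int[mu]_x (f_ n x ^+ 2))).
    by apply/funext => n; rewrite -expr2 sqr_sqrtr// Rintegral_sqr_ge0.
  by rewrite -[X in _ --> X](mulr0 0); apply: cvgM.
apply: cvg_EFin; first by near=> n.
rewrite -sqrtr0; apply: continuous_cvg h; exact: sqrt_continuous.
Unshelve. all: by end_near. Qed.

Lemma Lnorm_ae_eq (f g : T -> \bar R) (p : R) : measurable_fun [set: T] f ->
  measurable_fun [set: T] g -> {ae mu, forall x, f x = g x} ->
  'N[mu]_(p%:E)[f]%E = 'N[mu]_(p%:E)[g]%E.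
Proof.
move=> mf mg fg; rewrite unlock; congr (_ `^ _)%E.
apply: ae_eq_integral => //.
- by apply: (measurableT_comp (f := fun y : \bar R => (y `^ p)%E));
    [exact: measurable_poweR|exact: measurableT_comp].
- by apply: (measurableT_comp (f := fun y : \bar R => (y `^ p)%E));
    [exact: measurable_poweR|exact: measurableT_comp].
- by apply: filterS fg => x -> .
Qed.

End RealLnorm.

Section HilbertGradient.
Context {R : realType} {X H : completeNormedModType R} (ip : {dot H for idfun}).
Variables (Q : {linear dual X -> X}) (i : {linear H -> X}) (istar : dual X -> H).
Hypothesis hH : is_RKHS Q ip i istar.
Let hN : hilbert_norm ip := RKHS_norm hH.
Implicit Types (c : cylinder X) (m : {measure set (borel X) -> \bar R}).

Lemma borel_measurable_map (Y Z : completeNormedModType R) (f : Y -> Z) : continuous f ->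
  measurable_fun [set: borel Y] (f : borel Y -> borel Z).
Proof.
move=> /continuousP cf.
apply: (@measurability _ _ (borel Y) (borel Z) setT f (@open Z)) => //.
move=> _ [G oG <-]; rewrite setTI; apply: sub_sigma_algebra; exact: cf.
Qed.

Lemma D_HE c x : D_H istar c x = istar (cyl_grad c x).
Proof.
rewrite /D_H /cyl_grad (istar_sum hH); apply: eq_bigr => j _.
by rewrite (istarZ hH).
Qed.

Lemma D_H_ip c x h : ip (D_H istar c x) h = (cyl_grad c x (i h) : R).
Proof. by rewrite D_HE (RKHS_adjoint hH). Qed.

Lemma cyl_d_bcont c j : Cb 1 (cyl_phi c) -> bcont (cyl_d c j : X -> R).
Proof. exact: cyl_d_bounded. Qed.

Lemma cyl_fun_bcont c : Cb 1 (cyl_phi c) -> bcont (cyl_fun c : X -> R).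
Proof. by move=> /Cb1_elim[b _ _]; exact: cyl_fun_bounded. Qed.

Lemma D_H_ip_bcont c h : Cb 1 (cyl_phi c) -> bcont (fun x => ip (D_H istar c x) h).
Proof.
move=> hc; under eq_fun do rewrite D_H_ip /cyl_grad dual_sum.
apply: bcont_sum => j; under eq_fun do rewrite dualZ.
by apply: bcontM; [exact: cyl_d_bcont|exact: bcont_cst].
Qed.

Lemma D_H_continuous c : Cb 1 (cyl_phi c) -> continuous (D_H istar c).
Proof.
move=> hc x; apply: cvg_ord_sum => j; apply: cvgZ; last exact: cvg_cst.
exact: (cyl_d_bcont j hc).1.
Qed.

Lemma D_H_norm_bcont c : Cb 1 (cyl_phi c) -> bcont (fun x => `|D_H istar c x|).
Proof.
move=> hc; split=> [x|]; first by apply: cvg_norm; exact: D_H_continuous.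
have /choice[M hM] j := (cyl_d_bcont j hc).2.
exists (\sum_(j < cyl_dim c) M j * `|istar (cyl_xs c j)|) => x.
rewrite normr_id (le_trans (ler_norm_sum _ _ _))//; apply: ler_sum => j _.
by rewrite normrZ ler_wpM2r.
Qed.

Section MeasurableFields.
Variables (F : X -> H).
Hypothesis mF : measurable_fun [set: borel X] (F : borel X -> borel H).

Lemma measurable_field (f : H -> R) : continuous f ->
  measurable_fun [set: borel X] (fun x : borel X => f (F x)).
Proof.
move=> cf; apply: (@measurableT_comp _ _ _ (borel X) (borel H) _ f) => //.
exact: borel_measurable_continuous.
Qed.

Lemma measurable_ip h : measurable_fun [set: borel X] (fun x : borel X => ip (F x) h).
Proof.
apply: (@measurable_field (ip ^~ h)) => k.
by apply: (ip_cvg hN); [exact: cvg_id|exact: cvg_cst].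
Qed.

Lemma measurable_norm_field : measurable_fun [set: borel X] (fun x : borel X => `|F x|).
Proof. by apply: (@measurable_field (fun h => `|h|)) => h; apply: cvg_norm; exact: cvg_id. Qed.

Lemma ip_D_H_sum c x k : ip k (D_H istar c x) =
  \sum_(j < cyl_dim c) cyl_d c j x * ip k (istar (cyl_xs c j)).
Proof. by rewrite /D_H ip_sumr; apply: eq_bigr => j _; rewrite ipZr. Qed.

Lemma measurable_bcont f : bcont f -> measurable_fun [set: borel X] (f : borel X -> R).
Proof. by move=> [cf _]; exact: borel_measurable_continuous. Qed.

Lemma measurable_ip_D_H c (L : H -> H) : Cb 1 (cyl_phi c) -> continuous L ->
  measurable_fun [set: borel X] (fun x : borel X => ip (L (F x)) (D_H istar c x)).
Proof.
move=> hc cL; under eq_fun do rewrite ip_D_H_sum.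
apply: measurable_sum => j.
apply: measurable_funM; first exact: (measurable_bcont (cyl_d_bcont j hc)).
apply: (@measurable_field (fun h => ip (L h) _)) => h.
by apply: (ip_cvg hN); [exact: cL|exact: cvg_cst].
Qed.

(** Expanding the square reduces the claim to scalar functions and avoids the measurability of a
    difference of two maps into [H]. *)
Lemma measurable_norm_D_HB c : Cb 1 (cyl_phi c) ->
  measurable_fun [set: borel X] (fun x : borel X => `|D_H istar c x - F x|).
Proof.
move=> hc; have -> : (fun x : borel X => `|D_H istar c x - F x|) = (fun x =>
    Num.sqrt (`|D_H istar c x| ^+ 2 - 2 * ip (F x) (D_H istar c x) + `|F x| ^+ 2)).
  apply/funext => x; rewrite -(ipC ip (D_H istar c x)) -(normB_sq hN).
  by rewrite sqrtr_sqr normr_id.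
apply: (@measurableT_comp _ _ _ _ _ _ (@Num.sqrt R)).
  by apply: continuous_measurable_fun; exact: sqrt_continuous.
apply: measurable_funD; last exact: (measurable_funX _ measurable_norm_field).
apply: measurable_funB; first exact: (measurable_funX _ (measurable_bcont (D_H_norm_bcont hc))).
by apply: measurable_funM => //; apply: (@measurable_ip_D_H c id) => // h; exact: cvg_id.
Qed.

End MeasurableFields.

End HilbertGradient.

Section SquareIntegrableLimits.
Context d (T : measurableType d) (R : realType) (mu : {measure set T -> \bar R}).
Implicit Types f g : T -> R.

Lemma sqint_norm_le (a b : nat -> T -> R) (L : R) :
  (forall n, sqint mu (a n)) -> (forall n, measurable_fun [set: T] (b n)) ->
  (forall n x, `|b n x| <= L * `|a n x|) ->
  \int[mu]_x (a n x ^+ 2) @[n --> \oo] --> 0 ->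
  (forall n, sqint mu (b n)) /\ \int[mu]_x (b n x ^+ 2) @[n --> \oo] --> 0.
Proof.
move=> sa mb ba a0.
have sb n : sqint mu (b n).
  apply: (@sqint_le _ _ _ _ _ (fun x => L * a n x)) => //; last exact: sqintZ.
  move=> x; rewrite normrM (le_trans (ba n x))// ler_wpM2r// ler_norm.
  done.
split=> //; apply: (@squeeze_cvgr _ _ _ _ (cst 0) (fun n => L ^+ 2 * \int[mu]_x (a n x ^+ 2))).
- near=> n; rewrite Rintegral_sqr_ge0/= -RintegralZl//; last exact: (sa n).2.
  apply: le_Rintegral => //; [exact: (sb n).2|exact/RintegrableZ/(sa n).2|].
  move=> x _; rewrite -(real_normK (num_real (b n x))) -(real_normK (num_real (a n x))).
  rewrite -exprMn lerXn2r// nnegrE ?(le_trans _ (ba n x))//.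
- exact: cvg_cst.
- by rewrite -[X in _ --> X](mulr0 (L ^+ 2)); apply: cvgM => //; exact: cvg_cst.
Unshelve. all: by end_near. Qed.

(** From [F G - f g = (F - f) G + (G - g) f] and a uniform L^2 bound on [G n]. *)
Lemma cvg_Rintegral_mul (F G : nat -> T -> R) (f g : T -> R) (K : R) :
  (forall n, sqint mu (F n)) -> (forall n, sqint mu (G n)) -> sqint mu f -> sqint mu g ->
  \int[mu]_x ((F n x - f x) ^+ 2) @[n --> \oo] --> 0 ->
  \int[mu]_x ((G n x - g x) ^+ 2) @[n --> \oo] --> 0 ->
  (forall n, \int[mu]_x (G n x ^+ 2) <= K) ->
  \int[mu]_x (F n x * G n x) @[n --> \oo] --> \int[mu]_x (f x * g x).
Proof.
move=> sF sG sf sg hF hG GK.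
have c1 := sqint_cvg0 (fun n => sqintB (sF n) sf) sG GK hF.
have c2 := sqint_cvg0 (fun n => sqintB (sG n) sg) (fun=> sf) (fun=> lexx _) hG.
have c3 : (fun=> \int[mu]_x (f x * g x)) n @[n --> \oo] --> \int[mu]_x (f x * g x).
  exact: cvg_cst.
rewrite -[X in _ --> X]add0r -[X in _ --> X + _](addr0 0).
apply: cvg_trans (cvgD (cvgD c1 c2) c3); apply: near_eq_cvg; near=> n => /=.
have i1 := sqint_mul (sqintB (sF n) sf) (sG n).
have i2 := sqint_mul (sqintB (sG n) sg) sf.
rewrite !fctE -(RintegralD _ i1 i2)// -(RintegralD _ (RintegrableD i1 i2) (sqint_mul sf sg))//.
by apply: eq_Rintegral => x _; ring.
Unshelve. all: by end_near. Qed.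

Lemma cvg_Rintegral_mulr (F : nat -> T -> R) (f g : T -> R) :
  (forall n, sqint mu (F n)) -> sqint mu f -> sqint mu g ->
  \int[mu]_x ((F n x - f x) ^+ 2) @[n --> \oo] --> 0 ->
  \int[mu]_x (F n x * g x) @[n --> \oo] --> \int[mu]_x (f x * g x).
Proof.
move=> sF sf sg hF; apply: (cvg_Rintegral_mul sF (fun=> sg) sf sg hF _ (fun=> lexx _)).
under eq_fun do under eq_Rintegral do rewrite subrr expr0n/=.
by under eq_fun do rewrite Rintegral_cst// mul0r; exact: cvg_cst.
Qed.

End SquareIntegrableLimits.

Lemma C1b_lipschitz {R : realType} (g g' : R -> R) : C1b g g' ->
  exists2 L : R, 0 <= L & forall a b, `|g a - g b| <= L * `|a - b|.
Proof.
move=> [dg _ _ [M hM]]; exists M; first by rewrite (le_trans _ (hM 0)).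
have key a b : a < b -> `|g a - g b| <= M * `|a - b|.
  move=> ab; have [c _ E] := MVT ab (fun t _ => dg t) (is_derive_itv_continuous dg).
  by rewrite distrC E normrM (distrC a) ler_wpM2r.
move=> a b; have [ab|ba|->] := ltgtP a b; first exact: key.
  by rewrite distrC (distrC a) key.
by rewrite !subrr normr0 mulr0.
Qed.

(** * A bounded substitute for the exponential weight *)

Section RegularisedExponential.
Context {R : realType} (e : R).
Hypothesis e0 : 0 < e.

(** It increases to [exp (- t)] as [e] decreases to [0], and it solves
    [theta' = - theta + e theta^2], the form in which its derivative is written in [rexp']. *)
Definition rexp (t : R) : R := (expR t + e)^-1.
Definition rexp' (t : R) : R := - rexp t + e * rexp t ^+ 2.

Let D0 t : 0 < expR t + e. Proof. by rewrite addr_gt0 ?expR_gt0. Qed.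

Lemma rexp_gt0 t : 0 < rexp t. Proof. by rewrite invr_gt0. Qed.

Lemma rexp_le t : rexp t <= expR (- t).
Proof. by rewrite expRN lef_pV2 ?posrE ?expR_gt0// lerDl ltW. Qed.

Lemma rexp_le_inv t : rexp t <= e^-1.
Proof. by rewrite lef_pV2 ?posrE// lerDr expR_ge0. Qed.

Lemma rexp'_le t : `|rexp' t| <= rexp t.
Proof.
have h0 := rexp_gt0 t; have h1 : e * rexp t <= 1.
  by rewrite -ler_pdivlMl// mulr1 rexp_le_inv.
have h2 : 0 < e * rexp t by rewrite mulr_gt0.
rewrite (_ : rexp' t = - (rexp t * (1 - e * rexp t))); last by rewrite /rexp'; ring.
by rewrite normrN normrM !ger0_norm ?subr_ge0// ?(ltW h0)// ler_piMr ?(ltW h0)// gerBl ltW.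
Qed.

Lemma rexp_C1b : C1b rexp rexp'.
Proof.
have dr t : is_derive t (1 : R) rexp (rexp' t).
  have h : is_derive t (1 : R) (fun t => expR t + e) (expR t).
    by apply: is_derive_eq; rewrite addr0.
  have [hd hE] := h; have n0 := lt0r_neq0 (D0 t).
  apply: DeriveDef; first exact: derivableV.
  rewrite deriveV// hE.
  by rewrite /rexp' /rexp /GRing.scale/=; field; exact: lt0r_neq0.
have cr : continuous rexp.
  by move=> t; have [d _] := dr t; exact/differentiable_continuous/derivable1_diffP.
split=> //.
- move=> t; apply: cvgD; first by apply: cvgN; exact: cr.
  by apply: cvgM; [exact: cvg_cst|under eq_fun do rewrite expr2; apply: cvgM; exact: cr].
- by exists e^-1 => t; rewrite gtr0_norm ?rexp_gt0// rexp_le_inv.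
- by exists e^-1 => t; rewrite (le_trans (rexp'_le t))// rexp_le_inv.
Qed.

(** The difference is [rexp a - rexp b] times [e * rexp a + e * rexp b - 1], and the latter lies in
    [[-1, 1]]. *)
Lemma rexp'_lipschitz a b : `|rexp' a - rexp' b| <= `|rexp a - rexp b|.
Proof.
have h t : e * rexp t <= 1 by rewrite -ler_pdivlMl// mulr1 rexp_le_inv.
have g t : 0 < e * rexp t by rewrite mulr_gt0// rexp_gt0.
rewrite (_ : rexp' a - rexp' b = (rexp a - rexp b) * (e * rexp a + e * rexp b - 1));
  last by rewrite /rexp'; ring.
rewrite normrM ler_piMr// ler_norml; have := h a; have := h b; have := g a; have := g b.
by move=> g1 g2 h1 h2; apply/andP; split; lra.
Qed.

End RegularisedExponential.

(** * Integration by parts against the weight *)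

Section WeightedIntegrationByParts.
Context {R : realType} {X H : completeNormedModType R} (ip : {dot H for idfun}).
Variables (Q : {linear dual X -> X}) (i : {linear H -> X}) (istar : dual X -> H).
Hypothesis hH : is_RKHS Q ip i istar.
Let hN : hilbert_norm ip := RKHS_norm hH.
Implicit Types (c : cylinder X) (u : X -> R) (F : X -> H).

(** [W1p_grad] for exponent 2 and real-valued [u], with norms replaced by integrals of squares;
    [W1p_grad2P] is the translation. *)
Definition grad2 (m : {measure set (borel X) -> \bar R}) u F :=
  [/\ sqint m u, measurable_fun [set: borel X] (F : borel X -> borel H),
    sqint m (fun x => `|F x|) & exists c : nat -> cylinder X,
    [/\ forall n, Cb 1 (cyl_phi (c n)),
      \int[m]_(x in [set: borel X]) ((cyl_fun (c n) x - u x) ^+ 2) @[n --> \oo] --> 0 &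
      \int[m]_(x in [set: borel X]) (`|D_H istar (c n) x - F x| ^+ 2) @[n --> \oo] --> 0]].

Section FiniteMeasure.
Variable m : {measure set (borel X) -> \bar R}.
Hypothesis m1 : m.-integrable [set: borel X] (EFin \o (fun=> 1 : R)).

Lemma bcont_sqint (f : X -> R) : bcont f -> sqint m (f : borel X -> R).
Proof.
move=> hf; have [cf [M fM]] := hf; split; first exact: measurable_bcont.
apply: (@integrable_le _ (borel X) R m _ (fun x => M ^+ 2 * 1)).
- exact: (measurable_funX _ (measurable_bcont hf)).
- by move=> x; rewrite mulr1 normrX lerXn2r// nnegrE// (le_trans _ (fM x)).
- exact: RintegrableZ.
Qed.

Lemma bcont_integrable_fin (f : X -> R) : bcont f ->
  m.-integrable [set: borel X] (EFin \o (f : borel X -> R)).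
Proof.
move=> hf; have [cf [M fM]] := hf.
apply: (@integrable_le _ (borel X) R m f (fun x => M * 1)).
- exact: measurable_bcont.
- by move=> x; rewrite mulr1.
- exact: RintegrableZ.
Qed.

Lemma norm_D_HB_sqint c F : Cb 1 (cyl_phi c) ->
  measurable_fun [set: borel X] (F : borel X -> borel H) -> sqint m (fun x => `|F x|) ->
  sqint m (fun x => `|D_H istar c x - F x|).
Proof.
move=> hc mF sF.
apply: (@sqint_le _ (borel X) R m _ (fun x => `|D_H istar c x| + `|F x|)).
- exact: (measurable_norm_D_HB hH mF hc).
- move=> x; rewrite normr_id (le_trans (ler_normB _ _))// ler_norm//.
- by apply: sqintD => //; apply: bcont_sqint; exact: D_H_norm_bcont.
Qed.

Lemma W1p_grad2P u F : W1p_grad istar m 2 (EFin \o u) F <-> grad2 m u F.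
Proof.
have sB c : Cb 1 (cyl_phi c) -> sqint m u -> sqint m (fun x => cyl_fun c x - u x).
  by move=> hc su; apply: sqintB => //; apply: bcont_sqint; exact: cyl_fun_bcont.
split=> [[[mu Nu] [mF NF] [c [hc c1 c2]]]|[su mF sF [c [hc c1 c2]]]].
- have mu' : measurable_fun [set: borel X] (u : borel X -> R) by exact/measurable_EFinP.
  have su : sqint m u by exact/(Lnorm2_lty _ mu').
  have sF : sqint m (fun x => `|F x|).
    by apply/(Lnorm2_lty _ (measurable_norm_field mF)).
  split=> //; exists c; split=> //.
    by apply/(@Lnorm2_cvg0 _ (borel X) R m (fun n x => cyl_fun (c n) x - u x)) => // n; exact: sB.
  apply/(@Lnorm2_cvg0 _ (borel X) R m (fun n x => `|D_H istar (c n) x - F x|)) => // n.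
  exact: (norm_D_HB_sqint (hc n) mF sF).
- split.
  + by split; [apply/measurable_EFinP; exact: su.1|apply/(Lnorm2_lty _ su.1)].
  + by split=> //; apply/(Lnorm2_lty _ sF.1).
  + exists c; split=> //.
      by apply/(@Lnorm2_cvg0 _ (borel X) R m (fun n x => cyl_fun (c n) x - u x)) => // n; exact: sB.
    apply/(@Lnorm2_cvg0 _ (borel X) R m (fun n x => `|D_H istar (c n) x - F x|)) => // n.
    exact: (norm_D_HB_sqint (hc n) mF sF).
Qed.

Lemma grad2_cyl c : Cb 1 (cyl_phi c) -> grad2 m (cyl_fun c) (D_H istar c).
Proof.
move=> hc; split.
- exact: (bcont_sqint (cyl_fun_bcont hc)).
- exact: (borel_measurable_map (D_H_continuous hc)).
- exact: (bcont_sqint (D_H_norm_bcont istar hc)).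
- exists (fun=> c); split=> //.
    under eq_fun do under eq_Rintegral do rewrite subrr expr0n/=.
    by under eq_fun do rewrite Rintegral_cst// mul0r; exact: cvg_cst.
  under eq_fun do under eq_Rintegral do rewrite subrr normr0 expr0n/=.
  by under eq_fun do rewrite Rintegral_cst// mul0r; exact: cvg_cst.
Qed.

Lemma ip_sqint F h : measurable_fun [set: borel X] (F : borel X -> borel H) ->
  sqint m (fun x => `|F x|) -> sqint m (fun x => ip (F x) h).
Proof.
move=> mF sF; apply: (@sqint_le _ (borel X) R m _ (fun x => `|h| * `|F x|)).
- exact: (measurable_ip hH mF).
- by move=> x; rewrite [leRHS]ger0_norm ?mulr_ge0// mulrC cauchy_schwarz.
- exact: sqintZ.
Qed.

End FiniteMeasure.

Variable mu : probability (borel X) R.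
Hypothesis hmu : centred_gaussian mu.
Variable C : dual X -> X.
Hypothesis hC : covariance_operator mu C.
Variables (V : X -> R) (F : X -> H).
Hypothesis gV : grad2 mu V F.
Variables (y : dual X) (h : H).
Hypothesis ih : i h = C y.

Let mu1 : mu.-integrable [set: borel X] (EFin \o (fun=> 1 : R)).
Proof. exact: finite_measure_integrable_cst. Qed.

Lemma dual_sqint : sqint mu (y : borel X -> R).
Proof.
split; first exact: dual_measurable.
apply: (gaussian_integrable hmu y (f := fun t => t ^+ 2) (K := 2)).
  exact: measurable_funX.
by move=> x; rewrite ger0_norm ?sqr_ge0// sqr_le_expR.
Qed.

(** Smooth approximants [d n] of [V] are inserted into the Gaussian formula. Since [g] and [g'] are
    Lipschitz, the L^2 convergence of [d n] passes to [g (d n)] and [g' (d n)] without extracting an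
    almost everywhere convergent subsequence. *)
Lemma regularised_ibp (g g' : R -> R) c : C1b g g' ->
  (exists2 L : R, 0 <= L & forall a b, `|g' a - g' b| <= L * `|a - b|) ->
  Cb 1 (cyl_phi c) ->
  \int[mu]_(x in [set: borel X]) ((y x : R) * (cyl_fun c x * g (V x))) =
  \int[mu]_(x in [set: borel X])
    (ip (D_H istar c x) h * g (V x) + cyl_fun c x * (g' (V x) * ip (F x) h)).
Proof.
move=> hg [L' L'0 g'L] hc; have [L L0 gL] := C1b_lipschitz hg.
have [sV mF sF [d [hd d1 d2]]] := gV.
have [_ cg' [M gM] [M' g'M]] := hg; have cg := C1b_continuous hg.
have bw := cyl_fun_bcont hc; have [_ [K wK]] := bw.
have bP := D_H_ip_bcont hH h hc.
have bg n : bcont (fun x => g (cyl_fun (d n) x)).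
  split; last by exists M => x; exact: gM.
  by move=> x; apply: (@continuous_comp _ _ _ (cyl_fun (d n)) g);
    [exact: (cyl_fun_bcont (hd n)).1|exact: cg].
have bg' n : bcont (fun x => g' (cyl_fun (d n) x)).
  split; last by exists M' => x; exact: g'M.
  by move=> x; apply: (@continuous_comp _ _ _ (cyl_fun (d n)) g');
    [exact: (cyl_fun_bcont (hd n)).1|exact: cg'].
have mg (f : R -> R) : continuous f -> measurable_fun [set: borel X] (fun x : borel X => f (V x)).
  move=> cf; apply: (@measurableT_comp _ _ _ _ _ _ f); last exact: sV.1.
  exact: continuous_measurable_fun.
have bs (f : R -> R) (N : R) : continuous f -> (forall t, `|f t| <= N) ->
    sqint mu (fun x => f (V x)).
  move=> cf fN; apply: (@sqint_le _ (borel X) R mu _ (fun=> N)); first exact: mg.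
    by move=> x; rewrite (le_trans (fN _))// ler_norm.
  by apply: bcont_sqint => //; exact: bcont_cst.
have sdV n : sqint mu (fun x => cyl_fun (d n) x - V x).
  by apply: sqintB => //; apply: bcont_sqint => //; exact: cyl_fun_bcont.
have [_ c1] : (forall n, sqint mu (fun x => g (cyl_fun (d n) x) - g (V x))) /\
    \int[mu]_(x in [set: borel X]) ((g (cyl_fun (d n) x) - g (V x)) ^+ 2) @[n --> \oo] --> 0.
  apply: (@sqint_norm_le _ (borel X) R mu (fun n x => cyl_fun (d n) x - V x) _ L) => //.
  by move=> n; apply: measurable_funB; [exact: (measurable_bcont (bg n))|exact: mg].
have [_ c2] : (forall n, sqint mu (fun x => cyl_fun c x * g' (cyl_fun (d n) x) - cyl_fun c x * g' (V x))) /\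
    \int[mu]_(x in [set: borel X])
      ((cyl_fun c x * g' (cyl_fun (d n) x) - cyl_fun c x * g' (V x)) ^+ 2) @[n --> \oo] --> 0.
  apply: (@sqint_norm_le _ (borel X) R mu (fun n x => cyl_fun (d n) x - V x) _ (K * L')) => //.
  - move=> n; apply: measurable_funB; apply: measurable_funM; try exact: (measurable_bcont bw).
      exact: (measurable_bcont (bg' n)).
    exact: mg.
  - by move=> n x; rewrite -mulrBr normrM -mulrA ler_pM.
have [_ c3] : (forall n, sqint mu (fun x => ip (D_H istar (d n) x) h - ip (F x) h)) /\
    \int[mu]_(x in [set: borel X])
      ((ip (D_H istar (d n) x) h - ip (F x) h) ^+ 2) @[n --> \oo] --> 0.
  apply: (@sqint_norm_le _ (borel X) R mu (fun n x => `|D_H istar (d n) x - F x|) _ `|h|) => //.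
  - by move=> n; exact: (norm_D_HB_sqint mu1 (hd n) mF sF).
  - move=> n; apply: measurable_funB; last exact: (measurable_ip hH mF).
    exact: (measurable_bcont (D_H_ip_bcont hH h (hd n))).
  - by move=> n x; rewrite -ipBl normr_id mulrC cauchy_schwarz.
have sip := ip_sqint h mF sF.
have swy : sqint mu (fun x => cyl_fun c x * (y x : R)).
  exact: (sqint_bounded (measurable_bcont bw) wK dual_sqint).
have sP := bcont_sqint mu1 bP.
have l1 := cvg_Rintegral_mulr (fun n => bcont_sqint mu1 (bg n)) (bs g M cg gM) swy c1.
have l2 := cvg_Rintegral_mulr (fun n => bcont_sqint mu1 (bg n)) (bs g M cg gM) sP c1.
have bG n : bcont (fun x => cyl_fun c x * g' (cyl_fun (d n) x)) by exact: bcontM.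
have GK n : \int[mu]_(x in [set: borel X]) ((cyl_fun c x * g' (cyl_fun (d n) x)) ^+ 2) <=
    \int[mu]_(x in [set: borel X]) ((K * M') ^+ 2).
  apply: le_Rintegral => //; [exact: (bcont_sqint mu1 (bG n)).2|
    exact: finite_measure_integrable_cst|].
  move=> x _; rewrite -(real_normK (num_real (_ * _))) lerXn2r// ?nnegrE//.
    by rewrite mulr_ge0// (le_trans _ (wK 0), le_trans _ (g'M 0)).
  by rewrite normrM ler_pM.
have sG : sqint mu (fun x => cyl_fun c x * g' (V x)).
  exact: (sqint_bounded (measurable_bcont bw) wK (bs g' M' cg' g'M)).
have bR n := D_H_ip_bcont hH h (hd n).
have l3 := cvg_Rintegral_mul (fun n => bcont_sqint mu1 (bR n))
  (fun n => bcont_sqint mu1 (bG n)) sip sG c3 c2 GK.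
have E n : \int[mu]_(x in [set: borel X]) (g (cyl_fun (d n) x) * (cyl_fun c x * (y x : R))) =
  \int[mu]_(x in [set: borel X]) (g (cyl_fun (d n) x) * ip (D_H istar c x) h) +
  \int[mu]_(x in [set: borel X])
    (ip (D_H istar (d n) x) h * (cyl_fun c x * g' (cyl_fun (d n) x))).
  have [hC1 gE1] := Cb1_comp hg (hd n).
  have [hC2 gE2] := Cb1_mul hc hC1.
  rewrite -(RintegralD _ (sqint_mul (bcont_sqint mu1 (bg n)) sP)
    (sqint_mul (bcont_sqint mu1 (bR n)) (bcont_sqint mu1 (bG n))))//.
  transitivity (\int[mu]_(x in [set: borel X])
      ((y x : R) * cyl_fun (cyl_mul c (cyl_comp g (d n))) x)).
    by apply: eq_Rintegral => x _; rewrite cyl_funM [RHS]mulrCA [RHS]mulrA mulrC.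
  rewrite (gaussian_ibp hmu hC y hC2); apply: eq_Rintegral => x _.
  rewrite gE2 gE1 dualD !dualZ -ih -!(D_H_ip hH).
  have key (a b u v w : R) : a * u + b * (v * w) = a * u + w * (b * v) by ring.
  exact: key.
have l4 : (fun n => \int[mu]_(x in [set: borel X]) (g (cyl_fun (d n) x) * ip (D_H istar c x) h) +
  \int[mu]_(x in [set: borel X])
    (ip (D_H istar (d n) x) h * (cyl_fun c x * g' (cyl_fun (d n) x)))) n @[n --> \oo] -->
  \int[mu]_(x in [set: borel X])
    (g (V x) * ip (D_H istar c x) h + ip (F x) h * (cyl_fun c x * g' (V x))).
  rewrite (RintegralD _ (sqint_mul (bs g M cg gM) sP) (sqint_mul sip sG))//.
  exact: cvgD.
have {}l1 : (fun n => \int[mu]_(x in [set: borel X]) (g (cyl_fun (d n) x) * ip (D_H istar c x) h) +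
  \int[mu]_(x in [set: borel X])
    (ip (D_H istar (d n) x) h * (cyl_fun c x * g' (cyl_fun (d n) x)))) n @[n --> \oo] -->
  \int[mu]_(x in [set: borel X]) (g (V x) * (cyl_fun c x * (y x : R))).
  by under eq_fun do rewrite -E.
transitivity (\int[mu]_(x in [set: borel X]) (g (V x) * (cyl_fun c x * (y x : R)))).
  by apply: eq_Rintegral => x _; rewrite mulrA mulrC; congr (_ * _); rewrite mulrC.
rewrite -(cvg_lim _ l1)//; transitivity (\int[mu]_(x in [set: borel X])
   (g (V x) * ip (D_H istar c x) h + ip (F x) h * (cyl_fun c x * g' (V x)))).
  by rewrite -(cvg_lim _ l4).
by apply: eq_Rintegral => x _; ring.
Qed.

Hypothesis sexp : sqint mu (fun x => expR (- V x)).

(** Dominated convergence as the parameter of [rexp] tends to [0]. The dominating functions are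
    products of two functions in L^2(mu): the weight, and a constant, [y] or [ip (F x) h]. The sign
    of the last term comes from [rexp'] tending to [- exp (- t)]. *)
Lemma weighted_ibp c : Cb 1 (cyl_phi c) ->
  mu.-integrable [set: borel X] (EFin \o (fun x => (y x : R) * cyl_fun c x * expR (- V x))) /\
  \int[mu]_(x in [set: borel X]) ((y x : R) * cyl_fun c x * expR (- V x)) =
  \int[mu]_(x in [set: borel X])
    ((ip (D_H istar c x) h - cyl_fun c x * ip (F x) h) * expR (- V x)).
Proof.
move=> hc; have [sV mF sF _] := gV.
have bw := cyl_fun_bcont hc; have [_ [K wK]] := bw.
have bP := D_H_ip_bcont hH h hc; have [_ [K' PK]] := bP.
have sip := ip_sqint h mF sF.
pose e n : R := n.+1%:R^-1.
have e0 n : 0 < e n by rewrite invr_gt0.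
have E n : \int[mu]_(x in [set: borel X]) ((y x : R) * (cyl_fun c x * rexp (e n) (V x))) =
  \int[mu]_(x in [set: borel X])
    (ip (D_H istar c x) h * rexp (e n) (V x) + cyl_fun c x * (rexp' (e n) (V x) * ip (F x) h)).
  apply: (regularised_ibp (rexp_C1b (e0 n))) => //.
  have [L L0 hL] := C1b_lipschitz (rexp_C1b (e0 n)); exists L => // a b.
  exact: le_trans (rexp'_lipschitz (e0 n) a b) (hL a b).
have mr n : measurable_fun [set: borel X] (fun x : borel X => rexp (e n) (V x)).
  apply: (@measurableT_comp _ _ _ _ _ _ (rexp (e n))); last exact: sV.1.
  exact: (continuous_measurable_fun (C1b_continuous (rexp_C1b (e0 n)))).
have mr' n : measurable_fun [set: borel X] (fun x : borel X => rexp' (e n) (V x)).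
  apply: (@measurableT_comp _ _ _ _ _ _ (rexp' (e n))); last exact: sV.1.
  by apply: continuous_measurable_fun; have [] := rexp_C1b (e0 n).
have e_cvg : e n @[n --> \oo] --> (0 : R).
  by apply: (@cvg_harmonic_bound _ _ _ _ 1) => n; rewrite subr0 mul1r ger0_norm// ltW.
have r_cvg x : rexp (e n) (V x) @[n --> \oo] --> expR (- V x).
  rewrite expRN; apply: cvgV; first by rewrite gt_eqF ?expR_gt0.
  by rewrite -[X in _ --> X]addr0; apply: cvgD => //; exact: cvg_cst.
have r'_cvg x : rexp' (e n) (V x) @[n --> \oo] --> - expR (- V x).
  rewrite -[X in _ --> X]addr0; apply: cvgD; first exact: cvgN.
  rewrite -[X in _ --> X](mul0r (expR (- V x) * expR (- V x))); apply: cvgM => //.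
  by under eq_fun do rewrite expr2; exact: cvgM.
have [||||i1 l1] := @dominated_Rintegral_cvg _ (borel X) R mu
  (fun n x => (y x : R) * (cyl_fun c x * rexp (e n) (V x)))
  (fun x => (y x : R) * (cyl_fun c x * expR (- V x)))
  (fun x => K * (`|y x : R| * expR (- V x))).
- move=> n; apply: measurable_funM; first exact: dual_measurable.
  by apply: measurable_funM => //; exact: (measurable_bcont bw).
- by move=> x; do 2 apply: cvgZr.
- apply: RintegrableZ; apply: sqint_mul sexp.
  apply: (@sqint_le _ (borel X) R mu _ (fun x => (y x : R))); last exact: dual_sqint.
    by apply: measurableT_comp; last exact: dual_measurable.
  by move=> x; rewrite normr_id.
- move=> n x; rewrite !normrM mulrCA; apply: ler_pM => //.
  by apply: ler_wpM2l => //; rewrite gtr0_norm ?rexp_le ?rexp_gt0.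
have [||||i2 l2] := @dominated_Rintegral_cvg _ (borel X) R mu
  (fun n x => ip (D_H istar c x) h * rexp (e n) (V x) +
     cyl_fun c x * (rexp' (e n) (V x) * ip (F x) h))
  (fun x => ip (D_H istar c x) h * expR (- V x) +
     cyl_fun c x * (- expR (- V x) * ip (F x) h))
  (fun x => K' * (1 * expR (- V x)) + K * (`|ip (F x) h| * expR (- V x))).
- move=> n; apply: measurable_funD; apply: measurable_funM => //.
  + exact: (measurable_bcont bP).
  + exact: (measurable_bcont bw).
  + by apply: measurable_funM => //; exact: sip.1.
- move=> x; apply: cvgD; first exact: cvgZr.
  by apply: cvgZr; apply: cvgM => //; exact: cvg_cst.
- apply: RintegrableD; apply: RintegrableZ; apply: (sqint_mul _ sexp).
    by apply: bcont_sqint => //; exact: bcont_cst.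
  apply: (@sqint_le _ (borel X) R mu _ (fun x => ip (F x) h)) => //.
    by apply: measurableT_comp; last exact: sip.1.
  by move=> x; rewrite normr_id.
- move=> n x; rewrite (le_trans (ler_normD _ _))//; apply: lerD.
    rewrite normrM mul1r; apply: ler_pM => //.
    by rewrite gtr0_norm ?rexp_le ?rexp_gt0.
  rewrite normrM (normrM (rexp' _ _)); apply: ler_pM => //.
  rewrite mulrC; apply: ler_wpM2l => //.
  by rewrite (le_trans (rexp'_le (e0 n) _))// rexp_le.
have F1 : (fun x => (y x : R) * cyl_fun c x * expR (- V x)) =
    (fun x => (y x : R) * (cyl_fun c x * expR (- V x))).
  by apply/funext => x; rewrite mulrA.
rewrite F1; split=> //.
have {}l1 : (fun n => \int[mu]_(x in [set: borel X])
    (ip (D_H istar c x) h * rexp (e n) (V x) + cyl_fun c x * (rexp' (e n) (V x) * ip (F x) h))) n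
  @[n --> \oo] --> \int[mu]_(x in [set: borel X]) ((y x : R) * (cyl_fun c x * expR (- V x))).
  by under eq_fun do rewrite -E.
rewrite -(cvg_lim _ l1)// (cvg_lim _ l2)//.
by apply: eq_Rintegral => x _; ring.
Qed.

End WeightedIntegrationByParts.

(** * Cylinder functions determine integrable functions *)

Section Generation.
Context {R : realType} {X : completeNormedModType R}.
Implicit Types s : seq (dual X * R).

(** A list encodes a finite intersection, so closure under intersection is concatenation. *)
Definition half_spaces s : set X := [set x | all (fun p : dual X * R => p.2 < (p.1 x : R)) s].

Definition half_space_sets : set (set X) := [set half_spaces s | s in [set: seq (dual X * R)]].

Lemma half_space_sets_setI : setI_closed half_space_sets.
Proof.
move=> _ _ [s _ <-] [t _ <-]; exists (s ++ t) => //.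
by apply/seteqP; split=> x; rewrite /half_spaces/= all_cat => /andP.
Qed.

Hypothesis hX : exists2 S : set X, countable S & dense S.

(** A norming sequence writes a closed ball as a countable intersection of complements of open
    half-spaces, and an open set is a countable union of closed balls centred on a dense sequence
    with radii [1 / (k + 1)]. *)
Lemma sigma_half_spaces : <<s @open X >> `<=` <<s half_space_sets >>.
Proof.
have [d hd] := dense_sequence hX; have [y [y1 hy]] := norming_sequence hX.
pose G := <<s half_space_sets >>.
have GC A : G A -> G (~` A).
  by rewrite -setTD; have [_ h _] := smallest_sigma_algebra [set: X] half_space_sets; exact: h.
have GU (A : nat -> set X) : (forall n, G (A n)) -> G (\bigcup_n A n).
  exact: sigma_algebra_bigcup.
have G0 : G set0 by have [] := smallest_sigma_algebra [set: X] half_space_sets.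
have Gball a (r : R) : G [set x | `|x - a| <= r].
  rewrite (_ : mkset _ = ~` \bigcup_n half_spaces [:: (y n, (y n a : R) + r)]).
    apply: GC; apply: GU => n; apply: sub_sigma_algebra; exact: (imageP half_spaces).
  apply/seteqP; split=> x /=.
    move=> xr [n _]; rewrite /half_spaces/= andbT ltNge => /negP; apply.
    rewrite -lerBlDl -dual_subv (le_trans (ler_norm _))//.
    exact: le_trans (y1 n _) xr.
  apply: contra_notP => /negP; rewrite -ltNge => rx.
  have h0 : 0 < `|x - a| - r by rewrite subr_gt0.
  have [n] := hy (x - a) _ h0.
  rewrite subKr dual_subv => h; exists n => //.
  by rewrite /half_spaces/= andbT; move: h; lra.
apply: smallest_sub; first exact: smallest_sigma_algebra.
move=> W oW.
pose B n k := [set x : X | `|x - d n| <= k.+1%:R^-1].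
pose A n k := if pselect (B n k `<=` W) is left _ then B n k else set0.
suff -> : W = \bigcup_n \bigcup_k A n k.
  by apply: (GU) => n; apply: (GU) => k; rewrite /A; case: pselect => // _; exact: Gball.
apply/seteqP; split=> [x Wx|x [n _ [k _]]]; last by rewrite /A; case: pselect => // h; exact: h.
have /nbhs_ballP[e /= e0 he] : nbhs x W by exact: open_nbhs_nbhs.
have [k hk] : exists k : nat, k.+1%:R^-1 < e / 2.
  exists (Num.truncn (e / 2)^-1); rewrite invf_plt ?posrE ?divr_gt0//.
  exact: truncnS_gt.
have [n hn] := hd x k.+1%:R^-1 ltac:(by rewrite invr_gt0).
exists n => //; exists k => //; rewrite /A; case: pselect => [_|]; first exact: ltW.
case=> z /= zn; apply: he; rewrite -ball_normE /= (splitr e).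
rewrite (le_lt_trans (ler_distD (d n) _ _))// ltrD//; first exact: lt_trans hk.
by rewrite distrC (le_lt_trans zn).
Qed.

End Generation.

Section Determining.
Context {R : realType} {X : completeNormedModType R}.
Hypothesis hX : exists2 S : set X, countable S & dense S.
(** A smooth step of slope parameter [k^2] whose threshold is moved to [a + 1 / k]: the limit at
    [t = a] is then [0], as the strict inequality in [half_spaces] requires. *)
Definition logistic (k : nat) (a t : R) : R := rexp 1 (k%:R - k%:R ^+ 2 * (t - a)).

Lemma logistic_C1b k a : exists g', C1b (logistic k a) g'.
Proof.
have [dg cg' [M gM] [M' g'M]] := rexp_C1b (@ltr01 R).
exists (fun t => rexp' 1 (k%:R - k%:R ^+ 2 * (t - a)) * (- k%:R ^+ 2)); split.
- move=> t; apply: (@is_derive1_comp _ (rexp 1) (fun t => k%:R - k%:R ^+ 2 * (t - a))).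
  by apply: is_derive_eq; rewrite /GRing.scale/= /cst; ring.
- move=> t; apply: cvgM; last exact: cvg_cst.
  apply: (@continuous_comp _ _ _ (fun t => k%:R - k%:R ^+ 2 * (t - a)) (rexp' 1)); last exact: cg'.
  apply: cvgB; first exact: cvg_cst.
  by apply: cvgM; [exact: cvg_cst|apply: cvgB; [exact: cvg_id|exact: cvg_cst]].
- by exists M => t; exact: gM.
- by exists (M' * `|- k%:R ^+ 2|) => t; rewrite normrM ler_wpM2r.
Qed.

Lemma logistic_ge0_le1 k a t : 0 <= logistic k a t <= 1.
Proof. by rewrite ltW ?rexp_gt0//= -[leRHS]invr1 rexp_le_inv. Qed.

Lemma expRN_nat_cvg0 : expR (- n%:R) @[n --> \oo] --> (0 : R).
Proof.
apply: (@cvg_harmonic_bound _ _ _ _ 1) => n.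
rewrite subr0 mul1r ger0_norm ?expR_ge0// expRN lef_pV2 ?posrE ?expR_gt0//.
by rewrite -natr1 addrC expR_ge1Dx.
Qed.

Lemma logistic_cvg a t : logistic k a t @[k --> \oo] --> ((a < t)%R%:R : R).
Proof.
have [at_|ta] := ltP a t; apply/cvgrPdist_le => e e0.
  have d0 : 0 < t - a by rewrite subr_gt0.
  near=> k.
  have hk : 2 <= k%:R * (t - a).
    rewrite -ler_pdivrMr//; near: k; exact: nbhs_infty_ger.
  have he : expR (- k%:R) <= e.
    by near: k; have := expRN_nat_cvg0 => /cvgrPdist_le/(_ e e0);
      apply: filterS => k; rewrite sub0r normrN ger0_norm// expR_ge0.
  have /andP[_ h1] := logistic_ge0_le1 k a t.
  rewrite ger0_norm ?subr_ge0//; apply: le_trans he.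
  rewrite /logistic /rexp; set u := _ - _ * (t - a).
  have uk : u <= - k%:R.
    have h := ler_wpM2l (ler0n R k) hk; rewrite /u expr2; lra.
  have eu := expR_gt0 u.
  apply: (@le_trans _ _ (expR u)); last by rewrite ler_expR.
  have -> : 1 - (expR u + 1)^-1 = expR u * (expR u + 1)^-1.
    by field; rewrite gt_eqF// addr_gt0.
  by rewrite ler_piMr ?expR_ge0// invf_le1 ?addr_gt0// lerDr ltW.
near=> k.
have he : expR (- k%:R) <= e.
  by near: k; have := expRN_nat_cvg0 => /cvgrPdist_le/(_ e e0);
    apply: filterS => k; rewrite sub0r normrN ger0_norm// expR_ge0.
have /andP[h0 _] := logistic_ge0_le1 k a t.
rewrite sub0r normrN ger0_norm//; apply: le_trans he.
apply: (le_trans (rexp_le ltr01 _)); rewrite ler_expR.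
have : k%:R ^+ 2 * (t - a) <= 0 by rewrite mulr_ge0_le0// subr_le0.
lra.
Unshelve. all: by end_near. Qed.

Lemma half_spaces_approx s : exists c : nat -> cylinder X,
  [/\ forall k, Cb 1 (cyl_phi (c k)), forall k x, 0 <= cyl_fun (c k) x <= 1 &
    forall x, cyl_fun (c k) x @[k --> \oo] --> (\1_(half_spaces s) x : R)].
Proof.
elim: s => [|[y a] s [c [hc c01 cl]]].
  exists (fun=> cyl_const 1); split=> [k|k x|x]; first exact: Cb1_const.
    by rewrite /cyl_fun/= lexx ler01.
  by rewrite indicE mem_set//; exact: cvg_cst.
exists (fun k => cyl_mul (cyl_ridge (logistic k a) y) (c k)); split=> [k|k x|x].
- have [g' hg'] := logistic_C1b k a.
  by have [] := Cb1_mul (Cb1_ridge y hg').1 (hc k).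
- rewrite cyl_funM cyl_fun_ridge; have /andP[h1 h2] := logistic_ge0_le1 k a (y x).
  by have /andP[h3 h4] := c01 k x; rewrite mulr_ge0//= mulr_ile1.
- under eq_fun do rewrite cyl_funM cyl_fun_ridge.
  have -> : (\1_(half_spaces ((y, a) :: s)) x : R) =
      (a < (y x : R))%R%:R * \1_(half_spaces s) x.
    rewrite !indicE -natrM mulnb; congr (nat_of_bool _)%:R.
    apply/idP/idP => [/set_mem/andP[/= -> h]|/andP[h /set_mem h']]; first exact: mem_set.
    by apply: mem_set; rewrite /half_spaces /= h.
  by apply: cvgM; [exact: logistic_cvg|exact: cl].
Qed.

Variables (m : {measure set (borel X) -> \bar R}) (f : X -> R).
Hypothesis fi : m.-integrable [set: borel X] (EFin \o (f : borel X -> R)).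
Hypothesis f0 : forall c : cylinder X, Cb 1 (cyl_phi c) ->
  \int[m]_(x in [set: borel X]) (f x * cyl_fun c x) = 0.

(** The sets over which [f] integrates to [0] form a lambda-system containing the
    half-space intersections, whose indicators are limits of products of logistic ridges. *)
Lemma cylinders_determining : {ae m, forall x : borel X, f x = 0}.
Proof.
have mf : measurable_fun [set: borel X] (f : borel X -> R).
  by have /measurable_int/measurable_EFinP := fi.
have if1 (A : set (borel X)) : measurable A -> m.-integrable [set: borel X] (EFin \o (fun x => f x * \1_A x)).
  move=> mA; apply: (@integrable_le _ (borel X) R m _ (fun x => `|f x|)).
  - by apply: measurable_funM => //; exact: measurable_indic.
  - move=> x; rewrite normrM ler_piMr// ger0_norm// indicE.
  - exact: (integrable_abse fi).
pose G := [set A : set (borel X) | measurable A /\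
  \int[m]_(x in [set: borel X]) (f x * \1_A x) = 0].
have GT : G setT.
  split=> //; rewrite -[RHS](f0 (Cb1_const (1 : R))); apply: eq_Rintegral => x _.
  by rewrite indicT.
have lG : lambda_system setT G.
  split=> // [A B AB [mA iA] [mB iB]|A ndA GA].
  - split; first exact: measurableD.
    transitivity (\int[m]_(x in [set: borel X]) (f x * \1_A x - f x * \1_B x)).
      apply: eq_Rintegral => x _; rewrite -mulrBr; congr (_ * _).
      rewrite !indicE; have [xB|xB] := boolP (x \in B).
        rewrite (_ : x \in A); last by apply/mem_set/AB/set_mem.
        rewrite (_ : x \in _ = false) ?subrr//.
        by apply/negbTE/negP => /set_mem[_]; apply; exact: set_mem.
      rewrite subr0; congr (nat_of_bool _)%:R; apply/idP/idP => [/set_mem[]/mem_set//|/set_mem xA].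
      by apply/mem_set; split=> // xB'; move: xB; rewrite mem_set.
    by rewrite RintegralB ?iA ?iB ?subrr//; exact: if1.
  - have mA n : measurable (A n) by have [] := GA n.
    split; first exact: bigcup_measurable.
    have [||||_ l1] := @dominated_Rintegral_cvg _ (borel X) R m
      (fun n x => f x * \1_(A n) x) (fun x => f x * \1_(\bigcup_n A n) x) (fun x => `|f x|).
    + by move=> n; apply: measurable_funM => //; exact: measurable_indic.
    + move=> x; apply: cvgM; first exact: cvg_cst.
      have [[N _ xN]|xA] := pselect ((\bigcup_n A n) x).
        rewrite [X in _ --> X]indicE mem_set; last by exists N.
        apply: cvg_near_cst; near=> n; rewrite indicE mem_set//.
        have /ndA/subsetPset : (N <= n)%N by near: n; exact: nbhs_infty_ge.
        exact.
      rewrite [X in _ --> X]indicE memNset//.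
      apply: cvg_near_cst; near=> n; rewrite indicE memNset// => h.
      by apply: xA; exists n.
    + exact: (integrable_abse fi).
    + by move=> n x; rewrite normrM ler_piMr// ger0_norm// indicE.
    rewrite -(cvg_lim _ l1)//; apply: cvg_lim => //.
    by under eq_fun do rewrite (GA _).2; exact: cvg_cst.
have sG : @half_space_sets R X `<=` G.
  move=> _ [s _ <-]; split.
    elim: s => [|[y a] s IH].
      by rewrite (_ : half_spaces _ = setT)//; apply/seteqP; split.
    rewrite (_ : half_spaces _ = (y : borel X -> R) @^-1` `]a, +oo[ `&` half_spaces s).
      apply: measurableI => //; rewrite -[X in measurable X]setTI.
      exact: dual_measurable.
    by apply/seteqP; split=> x /=; rewrite in_itv/= andbT => /andP.
  have [c [hc c01 cl]] := half_spaces_approx s.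
  have [||||_ l1] := @dominated_Rintegral_cvg _ (borel X) R m
    (fun n x => f x * cyl_fun (c n) x) (fun x => f x * \1_(half_spaces s) x) (fun x => `|f x|).
  - by move=> n; apply: measurable_funM => //; exact: (measurable_bcont (cyl_fun_bcont (hc n))).
  - by move=> x; apply: cvgM; [exact: cvg_cst|exact: cl].
  - exact: (integrable_abse fi).
  - move=> n x; have /andP[h1 h2] := c01 n x.
    by rewrite normrM ler_piMr// ger0_norm.
  rewrite -(cvg_lim _ l1)//; apply: cvg_lim => //.
  by under eq_fun do rewrite f0//; exact: cvg_cst.
have G_all (A : set (borel X)) : measurable A -> G A.
  move=> /(sigma_half_spaces hX); apply: lambda_system_subset => //.
  exact: half_space_sets_setI.
have h : ae_eq m setT (EFin \o (f : borel X -> R)) (cst 0%E).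
  apply: integral_ae_eq => // E _ mE; rewrite integral0 integral_mkcond.
  have [_ iE] := G_all E mE.
  transitivity (\int[m]_(x in [set: borel X]) (f x * \1_E x)%:E)%E.
    apply: eq_integral => x _; rewrite patchE indicE; case: (x \in E) => /=.
      by rewrite mulr1.
    by rewrite mulr0.
  by rewrite -[LHS]fineK ?integrable_fin_num//; [congr EFin|exact: if1].
by apply: filterS h => x /(_ I)[].
Unshelve. all: by end_near. Qed.

End Determining.

(** * The perturbed Ornstein-Uhlenbeck operator *)

Section PerturbedOperator.
Context {R : realType} {X H : completeNormedModType R} (ip : {dot H for idfun}).
Hypothesis hX : exists2 S : set X, countable S & dense S.
Variables (Q : {linear dual X -> X}) (i : {linear H -> X}) (istar : dual X -> H).
Hypothesis hH : is_RKHS Q ip i istar.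
Let hN : hilbert_norm ip := RKHS_norm hH.
Variables (DA : set X) (A : X -> X) (Qinf : dual X -> X) (B : {linear H -> H}).
Hypothesis hB_cont : continuous B.
Hypothesis hB : forall xs, adj_dom DA A xs -> i (B (istar xs)) = Qinf (adj DA A xs).
Hypothesis B_skew : forall h k, ip (B h) k + ip h (B k) = - ip h k.
Hypothesis istar_dense : forall h (e : R), 0 < e ->
  exists2 xs, adj_dom DA A xs & `|h - istar xs| < e.
Variables (nu : {measure set (borel X) -> \bar R}) (F : X -> H).
Hypothesis nu1 : nu.-integrable [set: borel X] (EFin \o (fun=> 1 : R)).
Hypothesis mF : measurable_fun [set: borel X] (F : borel X -> borel H).
Hypothesis sF : sqint nu (fun x => `|F x|).
Hypothesis sdual : forall y : dual X, sqint nu (y : borel X -> R).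
Hypothesis nu_ibp : forall (y : dual X) h (c : cylinder X), i h = Qinf y -> Cb 1 (cyl_phi c) ->
  \int[nu]_(x in [set: borel X]) ((y x : R) * cyl_fun c x) =
  \int[nu]_(x in [set: borel X]) (ip (D_H istar c x) h - cyl_fun c x * ip (F x) h).

Lemma trace_D2_H c x : trace ip (D2_H ip istar c x) =
  \sum_(j < cyl_dim c) \sum_(k < cyl_dim c)
    cyl_d2 c j k x * ip (istar (cyl_xs c j)) (istar (cyl_xs c k)).
Proof.
have [y [_ hy]] := norming_sequence hX.
exact: (trace_tensor_sum hN (a := fun n => istar (y n)) (istar_norming_total hH hy)).
Qed.

Lemma cyl_d2_bcont c j k : Cb 2 (cyl_phi c) -> bcont (cyl_d2 c j k : X -> R).
Proof. by move=> hc; exact: (@cyl_d_bcont _ _ (cyl_partial k) j (Cb2_partial k hc)). Qed.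

(** The candidate for [L_2 u], with [F] in the place of the gradient of [U]. *)
Definition generator_fun c x : R := 2^-1 * trace ip (D2_H ip istar c x) +
  adj_D DA A c x x + ip (B (D_H istar c x)) (F x).

Section Generator.
Variable c : cylinder X.
Hypotheses (hc : Cb 2 (cyl_phi c)) (cA : cyl_in_adj_dom DA A c).
Local Notation y j := (adj DA A (cyl_xs c j)).
Local Notation e j := (istar (cyl_xs c j)).

Lemma B_D_HE x k : ip (B (D_H istar c x)) k =
  \sum_(j < cyl_dim c) cyl_d c j x * ip (B (e j)) k.
Proof.
rewrite /D_H linear_sum ip_suml; apply: eq_bigr => j _.
by rewrite linearZ_LR ipZl.
Qed.

Let generator_funE x : generator_fun c x = 2^-1 * \sum_(j < cyl_dim c) \sum_(k < cyl_dim c)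
    cyl_d2 c j k x * ip (e j) (e k) +
  \sum_(j < cyl_dim c) cyl_d c j x * ((y j x : R) + ip (F x) (B (e j))).
Proof.
rewrite /generator_fun trace_D2_H -addrA; congr (_ + _).
have -> : (adj_D DA A c x x : R) = \sum_(j < cyl_dim c) cyl_d c j x * (y j x : R).
  by rewrite /adj_D dual_sum; apply: eq_bigr => j _; rewrite dualZ.
rewrite B_D_HE -big_split; apply: eq_bigr => j _ /=.
by rewrite (ipC ip (F x)) mulrDr.
Qed.

Lemma generator_fun_sqint : sqint nu (generator_fun c).
Proof.
rewrite (funext generator_funE); apply: sqintD.
  apply/sqintZ/(bcont_sqint nu1).
  do 2 apply: bcont_sum => ?; apply: bcontM; last exact: bcont_cst.
  exact: cyl_d2_bcont.
apply: sqint_sum => j; have bj := cyl_d_bcont j (CbS hc); have [_ [K hK]] := bj.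
apply: (sqint_bounded (measurable_bcont bj) hK); apply: sqintD; first exact: sdual.
exact: (ip_sqint hH (B (e j)) mF sF).
Qed.

(** Exchanging the indices, which the symmetry of the second derivatives permits, moves [B] to the
    other factor; the two expressions add up through [B + B^* = - 1], whence the factor one half. *)
Let second_order x : \sum_(j < cyl_dim c) \sum_(k < cyl_dim c)
    cyl_d2 c k j x * ip (e k) (B (e j)) =
  - (2^-1 * \sum_(j < cyl_dim c) \sum_(k < cyl_dim c) cyl_d2 c j k x * ip (e j) (e k)).
Proof.
have d2C j k : cyl_d2 c j k x = cyl_d2 c k j x by rewrite /cyl_d2 Cb2_partialC.
set L := LHS.
have LE : L = \sum_(j < cyl_dim c) \sum_(k < cyl_dim c) cyl_d2 c j k x * ip (B (e k)) (e j).
  rewrite /L exchange_big/=; apply: eq_bigr => j _; apply: eq_bigr => k _.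
  by rewrite ipC.
have E : L + L = - \sum_(j < cyl_dim c) \sum_(k < cyl_dim c) cyl_d2 c j k x * ip (e j) (e k).
  rewrite {2}LE /L -big_split -sumrN; apply: eq_bigr => j _.
  rewrite -big_split -sumrN; apply: eq_bigr => k _ /=.
  by rewrite d2C -mulrDr addrC B_skew mulrN (ipC ip (e k)).
by rewrite -[LHS]mul1r -mulrN -E; lra.
Qed.

Lemma generator_form (v : cylinder X) : Cb 1 (cyl_phi v) ->
  \int[nu]_(x in [set: borel X]) ip (B (D_H istar c x)) (D_H istar v x) =
  \int[nu]_(x in [set: borel X]) (generator_fun c x * cyl_fun v x).
Proof.
move=> hv; have hc1 := CbS hc.
pose w (j : 'I_(cyl_dim c)) := cyl_mul (cyl_partial j) v.
have hw j := Cb1_mul (Cb2_partial j hc : Cb 1 (cyl_phi (cyl_partial j))) hv.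
pose a (j : 'I_(cyl_dim c)) x := (y j x : R) * cyl_fun (w j) x.
pose b (j : 'I_(cyl_dim c)) x := ip (D_H istar (w j) x) (B (e j)) -
  cyl_fun (w j) x * ip (F x) (B (e j)).
have ab j : \int[nu]_(x in [set: borel X]) a j x = \int[nu]_(x in [set: borel X]) b j x.
  by apply: nu_ibp; [exact: hB|exact: (hw j).1].
have bw j := cyl_fun_bcont (hw j).1.
have ia j : nu.-integrable [set: borel X] (EFin \o a j).
  exact: (sqint_mul (sdual _) (bcont_sqint nu1 (bw j))).
have ib j : nu.-integrable [set: borel X] (EFin \o b j).
  have i1 := bcont_integrable_fin nu1 (D_H_ip_bcont hH (B (e j)) (hw j).1).
  have i2 := sqint_mul (bcont_sqint nu1 (bw j)) (ip_sqint hH (B (e j)) mF sF).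
  have := RintegrableD i1 (RintegrableZ (-1) i2).
  by congr (_.-integrable _ (EFin \o _)); apply/funext => x; rewrite mulN1r.
have iv : nu.-integrable [set: borel X] (EFin \o (fun x => generator_fun c x * cyl_fun v x)).
  exact: (sqint_mul generator_fun_sqint (bcont_sqint nu1 (cyl_fun_bcont hv))).
have iB : nu.-integrable [set: borel X]
    (EFin \o (fun x => ip (B (D_H istar c x)) (D_H istar v x))).
  apply: (bcont_integrable_fin nu1); under eq_fun do rewrite B_D_HE.
  apply: bcont_sum => j; apply: bcontM; first exact: cyl_d_bcont.
  by under eq_fun do rewrite ipC; exact: (D_H_ip_bcont hH _ hv).
have wE j x : cyl_fun (w j) x = cyl_d c j x * cyl_fun v x by rewrite cyl_funM.
have DwE j x h : ip (D_H istar (w j) x) h =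
    cyl_fun v x * \sum_(k < cyl_dim c) cyl_d2 c k j x * ip (e k) h +
    cyl_d c j x * ip (D_H istar v x) h.
  rewrite !(D_H_ip hH) (hw j).2 dualD !dualZ; congr (_ * _ + _ * _).
  rewrite -(D_H_ip hH) /D_H ip_suml; apply: eq_bigr => k _.
  by rewrite ipZl.
(* Pointwise, the difference of the two integrands is the sum over [j] of the two sides of the
   integration by parts for [w j], so it integrates to zero. *)
have key x : generator_fun c x * cyl_fun v x - ip (B (D_H istar c x)) (D_H istar v x) =
    \sum_(j < cyl_dim c) a j x - \sum_(j < cyl_dim c) b j x.
  rewrite generator_funE B_D_HE.
  have -> : \sum_(j < cyl_dim c) b j x =
      cyl_fun v x * \sum_(j < cyl_dim c) \sum_(k < cyl_dim c) cyl_d2 c k j x * ip (e k) (B (e j)) +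
      \sum_(j < cyl_dim c) cyl_d c j x * ip (B (e j)) (D_H istar v x) -
      cyl_fun v x * \sum_(j < cyl_dim c) cyl_d c j x * ip (F x) (B (e j)).
    rewrite !mulr_sumr -big_split -sumrB; apply: eq_bigr => j _ /=.
    by rewrite /b DwE wE (ipC ip (B (e j))); ring.
  have -> : \sum_(j < cyl_dim c) a j x =
      cyl_fun v x * \sum_(j < cyl_dim c) cyl_d c j x * (y j x : R).
    by rewrite mulr_sumr; apply: eq_bigr => j _; rewrite /a wE; ring.
  rewrite second_order.
  have -> : \sum_(j < cyl_dim c) cyl_d c j x * ((y j x : R) + ip (F x) (B (e j))) =
      \sum_(j < cyl_dim c) cyl_d c j x * (y j x : R) +
      \sum_(j < cyl_dim c) cyl_d c j x * ip (F x) (B (e j)).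
    by rewrite -big_split; apply: eq_bigr => j _ /=; rewrite mulrDr.
  ring.
apply/esym/eqP; rewrite -subr_eq0 -(RintegralB _ iv iB)//; apply/eqP.
under eq_Rintegral do rewrite key.
rewrite (RintegralB _ (Rintegrable_sum ia) (Rintegrable_sum ib))//.
rewrite (Rintegral_sum ia) (Rintegral_sum ib) -sumrB.
by apply: big1 => j _; rewrite ab subrr.
Qed.

Lemma generator_in_dom : L2_graph ip istar B nu (cyl_fun c) (generator_fun c).
Proof.
have sg := generator_fun_sqint; split.
  by split; [apply/measurable_EFinP; exact: sg.1|apply/(Lnorm2_lty _ sg.1)].
exists (D_H istar c).
  by apply/(W1p_grad2P hH nu1); exact: (grad2_cyl istar nu1 (CbS hc)).
by move=> v hv; rewrite /OU_form generator_form.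
Qed.

End Generator.

(** A vector [k] orthogonal to the range satisfies [- |k|^2 = 2 [B k, k] = 0]. *)
Lemma range_B_dense h (eps : R) : 0 < eps ->
  exists2 xs, adj_dom DA A xs & `|h - B (istar xs)| < eps.
Proof.
move=> eps0.
have [||k hk|_ [xs Dxs <-] he] :=
  @orthogonal_dense _ _ ip hN [set B (istar xs) | xs in adj_dom DA A] _ _ _ h eps eps0.
- by exists 0; [exact: adj_dom0|rewrite (istar0 hH) linear0].
- move=> a _ _ [xs Dxs <-] [ys Dys <-].
  exists (a *: xs + ys); first exact: adj_dom_linear.
  by rewrite (istar_linear hH) linearP.
- have Bk l : ip (B l) k = 0.
    have /choice[xs hxs] (n : nat) : exists xs, adj_dom DA A xs /\ `|l - istar xs| < n.+1%:R^-1.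
      by have [|xs Dxs hl] := @istar_dense l n.+1%:R^-1; [rewrite invr_gt0|exists xs].
    have cl : istar (xs n) @[n --> \oo] --> l.
      apply: (@cvg_harmonic_bound _ _ _ _ 1) => n.
      by rewrite mul1r distrC ltW//; exact: (hxs n).2.
    have c1 : ip (B (istar (xs n))) k @[n --> \oo] --> ip (B l) k.
      by apply: (ip_cvg hN); [apply: continuous_cvg cl; exact: hB_cont|exact: cvg_cst].
    rewrite -(cvg_lim _ c1)//; apply: cvg_lim => //.
    have -> : (fun n => ip (B (istar (xs n))) k) = cst 0.
      by apply/funext => n; apply: hk; exists (xs n) => //; exact: (hxs n).1.
    exact: cvg_cst.
  apply: (ip_self0 hN); have := B_skew k k.
  by rewrite (ipC ip k (B k)) Bk addr0 => /esym/eqP; rewrite oppr_eq0 => /eqP.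
- by exists xs.
Qed.

(** * Uniqueness of the gradient of a smooth cylinder function *)

Section Closability.
Variables (c : cylinder X) (Du : X -> H).
Hypotheses (hc : Cb 1 (cyl_phi c)) (gDu : grad2 istar nu (cyl_fun c) Du).
Let G x := Du x - D_H istar c x.

Let mDu : measurable_fun [set: borel X] (Du : borel X -> borel H).
Proof. by have [] := gDu. Qed.

Let sDu : sqint nu (fun x => `|Du x|).
Proof. by have [] := gDu. Qed.

(** For smooth [f], integration by parts applied to [f v] moves the derivative off [f] and leaves a
    fixed factor in L^2(nu), as recorded in [E]. The right-hand side is thus continuous in [f], and
    convergence of [d n] to the function alone determines the limit of the gradients in the
    direction [h]. *)
Lemma gradient_test xs (v : cylinder X) : adj_dom DA A xs -> Cb 1 (cyl_phi v) ->
  \int[nu]_(x in [set: borel X]) (ip (G x) (B (istar xs)) * cyl_fun v x) = 0.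
Proof.
move=> Dxs hv; set h := B _; have [_ _ _ [d [hd d1 d2]]] := gDu.
pose y := adj DA A xs; have ih : i h = Qinf y by exact: hB.
have bv := cyl_fun_bcont hv; have [_ [K vK]] := bv.
have bc := cyl_fun_bcont hc; have bd n := cyl_fun_bcont (hd n).
have bDv := D_H_ip_bcont hH h hv.
have sip (f : cylinder X) (hf : Cb 1 (cyl_phi f)) := bcont_sqint nu1 (D_H_ip_bcont hH h hf).
have sv := bcont_sqint nu1 bv.
have sFh := ip_sqint hH h mF sF.
have sDuh := ip_sqint hH h mDu sDu.
have sP : sqint nu (fun x => ip (D_H istar v x) h - (y x : R) * cyl_fun v x - cyl_fun v x * ip (F x) h).
  apply: sqintB; last exact: (sqint_bounded (measurable_bcont bv) vK).
  apply: sqintB; first exact: sip.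
  by have := sqint_bounded (measurable_bcont bv) vK (sdual y); under eq_fun do rewrite mulrC.
have E (f : cylinder X) : Cb 1 (cyl_phi f) ->
    \int[nu]_(x in [set: borel X]) (ip (D_H istar f x) h * cyl_fun v x) =
    - \int[nu]_(x in [set: borel X]) (cyl_fun f x *
       (ip (D_H istar v x) h - (y x : R) * cyl_fun v x - cyl_fun v x * ip (F x) h)).
  move=> hf; have [hm gm] := Cb1_mul hf hv.
  have bf := bcont_sqint nu1 (cyl_fun_bcont hf).
  have i1 := sqint_mul (sip f hf) sv.
  have i2 := sqint_mul bf sP.
  have i3 := sqint_mul (sdual y) (bcont_sqint nu1 (cyl_fun_bcont hm)).
  have i4 : nu.-integrable [set: borel X] (EFin \o (fun x =>
      ip (D_H istar (cyl_mul f v) x) h - cyl_fun (cyl_mul f v) x * ip (F x) h)).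
    have := RintegrableD (bcont_integrable_fin nu1 (D_H_ip_bcont hH h hm))
      (RintegrableZ (-1) (sqint_mul (bcont_sqint nu1 (cyl_fun_bcont hm)) sFh)).
    by congr (_.-integrable _ (EFin \o _)); apply/funext => x; rewrite mulN1r.
  apply/eqP; rewrite -addr_eq0 -(RintegralD _ i1 i2)//.
  have := nu_ibp ih hm => /eqP; rewrite eq_sym -subr_eq0 -(RintegralB _ i4 i3)//.
  congr (_ == _); apply: eq_Rintegral => x _.
  rewrite !cyl_funM !(D_H_ip hH) gm dualD !dualZ.
  have key (p q a b s t : R) : a * p + b * q - b * a * s - t * (b * a) =
    p * a + b * (q - t * a - a * s) by ring.
  exact: key.
have sdd n := bcont_sqint nu1 (bd n).
have c1 := cvg_Rintegral_mulr sdd (bcont_sqint nu1 bc) sP d1.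
have [_ d3] : (forall n, sqint nu (fun x => ip (D_H istar (d n) x) h - ip (Du x) h)) /\
    \int[nu]_(x in [set: borel X])
      ((ip (D_H istar (d n) x) h - ip (Du x) h) ^+ 2) @[n --> \oo] --> 0.
  apply: (@sqint_norm_le _ (borel X) R nu (fun n x => `|D_H istar (d n) x - Du x|) _ `|h|) => //.
  - by move=> n; exact: (norm_D_HB_sqint hH nu1 (hd n) mDu sDu).
  - move=> n; apply: measurable_funB; last exact: (measurable_ip hH mDu).
    exact: (measurable_bcont (D_H_ip_bcont hH h (hd n))).
  - by move=> n x; rewrite -ipBl normr_id mulrC cauchy_schwarz.
have c2 := cvg_Rintegral_mulr (fun n => sip _ (hd n)) sDuh sv d3.
have E' : \int[nu]_(x in [set: borel X]) (ip (Du x) h * cyl_fun v x) =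
    \int[nu]_(x in [set: borel X]) (ip (D_H istar c x) h * cyl_fun v x).
  rewrite E// -(cvg_lim _ c2)//; apply: cvg_lim => //.
  by under eq_fun do rewrite E//; exact: cvgN.
transitivity (\int[nu]_(x in [set: borel X])
    (ip (Du x) h * cyl_fun v x - ip (D_H istar c x) h * cyl_fun v x)).
  by apply: eq_Rintegral => x _; rewrite /G ipBl mulrBl.
by rewrite (RintegralB _ (sqint_mul sDuh sv) (sqint_mul (sip c hc) sv))// E' subrr.
Qed.

(** Each direction [B (istar xs)] has its own exceptional set, so [h] is approached by a sequence of
    such directions and only countably many null sets are joined. *)
Lemma gradient_unique h : {ae nu, forall x : borel X, ip (G x) h = 0}.
Proof.
have mG (k : H) : sqint nu (fun x => ip (G x) k).
  rewrite /G; under eq_fun do rewrite ipBl; apply: sqintB.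
    exact: (ip_sqint hH k mDu sDu).
  exact: (bcont_sqint nu1 (D_H_ip_bcont hH k hc)).
have ae_B xs : adj_dom DA A xs -> {ae nu, forall x : borel X, ip (G x) (B (istar xs)) = 0}.
  move=> Dxs; apply: (cylinders_determining hX) => [|v hv]; last exact: gradient_test.
  have := sqint_mul (mG (B (istar xs))) (bcont_sqint nu1 (bcont_cst (1 : R))).
  by congr (_.-integrable _ (EFin \o _)); apply/funext => x; rewrite mulr1.
have /choice[xs hxs] (n : nat) : exists xs, adj_dom DA A xs /\ `|h - B (istar xs)| < n.+1%:R^-1.
  by have [|xs Dxs hl] := @range_B_dense h n.+1%:R^-1; [rewrite invr_gt0|exists xs].
have cl : B (istar (xs n)) @[n --> \oo] --> h.
  apply: (@cvg_harmonic_bound _ _ _ _ 1) => n.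
  by rewrite mul1r distrC ltW//; exact: (hxs n).2.
have /ae_foralln := fun n => ae_B _ (hxs n).1.
apply: filterS => x hx; rewrite -(cvg_lim _ (ip_cvgr (u := G x) hN cl))//.
by apply: cvg_lim => //; under eq_fun do rewrite hx; exact: cvg_cst.
Qed.

(** [D_H v] combines finitely many fixed vectors, so [B] moves to the other side as [B^* = - B - 1]
    and only the finitely many directions [k j] have to be tested. The field [G] itself is not shown
    to vanish. *)
Lemma gradient_form (v : cylinder X) : Cb 1 (cyl_phi v) ->
  \int[nu]_(x in [set: borel X]) ip (B (Du x)) (D_H istar v x) =
  \int[nu]_(x in [set: borel X]) ip (B (D_H istar c x)) (D_H istar v x).
Proof.
move=> hv; pose k j := - B (istar (cyl_xs v j)) - istar (cyl_xs v j).
have h0 : {ae nu, forall x : borel X, forall j, ip (G x) (k j) = 0}.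
  by apply: filter_forall => j; exact: gradient_unique.
rewrite /Rintegral; congr fine; apply: ae_eq_integral => //.
- apply/measurable_EFinP; exact: (measurable_ip_D_H hH mDu).
- apply/measurable_EFinP; apply: (measurable_ip_D_H hH) => //.
  exact: borel_measurable_map (D_H_continuous hc).
- apply: filterS h0 => x hx _; congr EFin; apply/eqP.
  rewrite -subr_eq0 -ipBl -(linearB B) ip_D_H_sum; apply/eqP.
  apply: big1 => j _; rewrite -[X in _ * X](_ : ip (G x) (k j) = _); first by rewrite hx mulr0.
  have := B_skew (G x) (istar (cyl_xs v j)); rewrite /k ipBr ipNr.
  by move=> <-; rewrite addrC addrK.
Qed.

End Closability.

Lemma L2_graph_unique c g : Cb 2 (cyl_phi c) -> cyl_in_adj_dom DA A c ->
  L2_graph ip istar B nu (cyl_fun c) g -> {ae nu, forall x : borel X, g x = generator_fun c x}.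
Proof.
move=> hc cA [[/measurable_EFinP mg Ng] [Du /(W1p_grad2P hH nu1) gDu form]].
have sg : sqint nu g by apply/(Lnorm2_lty _ mg).
have sG := generator_fun_sqint hc.
have sgG : sqint nu (fun x => g x - generator_fun c x) by exact: sqintB.
have : {ae nu, forall x : borel X, g x - generator_fun c x = 0}.
  apply: (cylinders_determining hX) => [|v hv].
    have := sqint_mul sgG (bcont_sqint nu1 (bcont_cst (1 : R))).
    by congr (_.-integrable _ (EFin \o _)); apply/funext => x; rewrite mulr1.
  have sv := bcont_sqint nu1 (cyl_fun_bcont hv).
  have := form v hv; rewrite /OU_form => /oppr_inj.
  rewrite (gradient_form (CbS hc) gDu hv) (generator_form hc cA hv) => E.
  transitivity (\int[nu]_(x in [set: borel X])
      (g x * cyl_fun v x - generator_fun c x * cyl_fun v x)).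
    by apply: eq_Rintegral => x _; rewrite mulrBl.
  by rewrite (RintegralB _ (sqint_mul sg sv) (sqint_mul sG sv))// E subrr.
by apply: filterS => x /eqP; rewrite subr_eq0 => /eqP.
Qed.

End PerturbedOperator.

Lemma sqint_expR_dual {R : realType} {X : completeNormedModType R}
    (mu : probability (borel X) R) (l : dual X) : centred_gaussian mu ->
  sqint mu (fun x => expR (- (l x : R))).
Proof.
move=> hmu; have mexp : measurable_fun [set: R] (fun t : R => expR (- t)).
  by apply: measurableT_comp.
split; first exact: (measurableT_comp mexp (dual_measurable l)).
have -> : (fun x : borel X => expR (- (l x : R)) ^+ 2) =
    (fun x => expR (- ((2 *: l) x : R))).
  by apply/funext => x; rewrite dualZ expr2 -expRD; congr expR; ring.
apply: (gaussian_integrable hmu (2 *: l) (f := fun t => expR (- t)) (K := 1)) => // t.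
by rewrite mul1r ger0_norm ?expR_ge0// ler_expR -normrN ler_norm.
Qed.

(** Fourth moments, from [t^4 <= 4! exp |t|]: they give second moments for the weighted measure,
    whose density is controlled in L^2(mu). *)
Lemma sqint_sqr_dual {R : realType} {X : completeNormedModType R}
    (mu : probability (borel X) R) (y : dual X) : centred_gaussian mu ->
  sqint mu (fun x => (y x : R) ^+ 2).
Proof.
move=> hmu; split; first by apply: measurable_funX; exact: dual_measurable.
apply: (gaussian_integrable hmu y (f := fun t => (t ^+ 2) ^+ 2) (K := 4`!%:R)).
  by apply: measurable_funX; exact: measurable_funX.
move=> t; rewrite ger0_norm ?sqr_ge0// -exprM.
have := expR_ge1Dxn 3 (normr_ge0 t).
rewrite -normrX ger0_norm ?exprn_even_ge0// -lerBrDl ler_pdivrMr// => h.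
by rewrite (le_trans h)// mulrC ler_wpM2l// gerBl.
Qed.

(** * The potential, its density and the weighted measure *)

Section Potential.
Context {R : realType} {X H : completeNormedModType R} (ip : {dot H for idfun}).
Variables (Q : {linear dual X -> X}) (i : {linear H -> X}) (istar : dual X -> H).
Hypothesis hH : is_RKHS Q ip i istar.
Variable mu : probability (borel X) R.
Hypothesis hmu : centred_gaussian mu.
Variables (U : X -> \bar R) (F : X -> H).
Hypotheses (U_proper : proper_fun U) (U_lsc : lower_semicontinuous U) (U_convex : econvex U).
Hypothesis hU_W : forall p : R, 1 <= p -> W1p_grad istar mu p U F.
Variable nu : {measure set (borel X) -> \bar R}.
Hypothesis hnu : forall E : set (borel X), measurable E ->
  nu E = (\int[mu]_(x in E) expeR (- U x))%E.

Let V x := fine (U x).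
(** [rho] is [1] instead of [0] where [U = +oo], a null set for [mu]; this makes it
    positive everywhere. *)
Let rho (x : borel X) : R := expR (- V x).

Let mu1 : mu.-integrable [set: borel X] (EFin \o (fun=> 1 : R)).
Proof. exact: finite_measure_integrable_cst. Qed.

Let mU : measurable_fun [set: borel X] (U : borel X -> \bar R).
Proof. by have [[]] := hU_W (lexx 1). Qed.

Let mV : measurable_fun [set: borel X] (V : borel X -> R).
Proof. exact: measurableT_comp. Qed.

Let ae_finite : {ae mu, forall x : borel X, U x = (V x)%:E}.
Proof.
have [[_ NU] _ _] := hU_W (lexx 1).
have iU : mu.-integrable [set: borel X] (U : borel X -> \bar R).
  by apply/integrableP; split=> //; move: NU; rewrite Lnorm1.
by apply: filterS (integrable_ae measurableT iU) => x /(_ I) fx; rewrite /V fineK.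
Qed.

(** [U] is integrable, hence infinite only on a null set; its finite version [V] inherits the
    gradient. *)
Lemma potential_grad2 : grad2 istar mu V F.
Proof.
have one2 : 1 <= (2 : R) by rewrite ler1n.
apply/(W1p_grad2P hH mu1); have [[_ NU] hF [c [hc c1 c2]]] := hU_W one2.
split=> //.
  split; first exact/measurable_EFinP.
  rewrite -(@Lnorm_ae_eq _ (borel X) R mu U) //; exact/measurable_EFinP.
exists c; split=> //.
rewrite (_ : (fun n => 'N[mu]_(2%:E)[(fun x : borel X => (cyl_fun (c n) x)%:E - (EFin \o V) x)]%E) =
    (fun n => 'N[mu]_(2%:E)[(fun x : borel X => (cyl_fun (c n) x)%:E - U x)]%E))//.
apply/funext => n.
have mc : measurable_fun [set: borel X] (fun x : borel X => (cyl_fun (c n) x)%:E).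
  by apply/measurable_EFinP; exact: (measurable_bcont (cyl_fun_bcont (hc n))).
apply: Lnorm_ae_eq.
- by apply: emeasurable_funB => //; exact/measurable_EFinP.
- exact: emeasurable_funB.
- by apply: filterS ae_finite => x ->.
Qed.

(** The affine minorant bounds the weight by [exp (- a) * exp (- l)], square integrable by the
    exponential moments of [l]. The added [1] covers the points where [U] is infinite and [rho]
    equals [1]. *)
Lemma weight_sqint : sqint mu rho.
Proof.
have [a [l al]] := affine_minorant U_proper U_lsc U_convex.
have mrho : measurable_fun [set: borel X] rho.
  by apply: measurableT_comp => //; exact: measurableT_comp.
apply: (@sqint_le _ (borel X) R mu _ (fun x => 1 + expR (- a) * expR (- (l x : R)))) => //.
  move=> x; rewrite [leLHS]ger0_norm ?expR_ge0// (le_trans _ (ler_norm _))//.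
  rewrite -expRD /rho /V; have := al x; have := U_proper.1 x.
  case: (U x) => [u _|_ _|//] /=; last by rewrite oppr0 expR0 lerDl expR_ge0.
  rewrite lee_fin => h; rewrite (le_trans (_ : _ <= expR (- a - (l x : R))))//.
    by rewrite ler_expR; lra.
  by rewrite lerDr.
apply: sqintD; first exact: (bcont_sqint mu1 (bcont_cst (1 : R))).
by apply: sqintZ; exact: sqint_expR_dual.
Qed.

Let mrho : measurable_fun [set: borel X] rho := weight_sqint.1.

Let rho0 x : 0 <= rho x. Proof. exact: expR_ge0. Qed.

(** The real positive [rho] agrees almost everywhere with [expeR (- U x)]; the latter is [rho] cut
    off on [D], which shows that it is measurable. *)
Lemma weight_density (E : set (borel X)) : measurable E ->
  nu E = (\int[mu]_(x in E) (rho x)%:E)%E.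
Proof.
move=> mE; rewrite hnu//; pose D := [set x : borel X | U x = +oo%E].
have mD : measurable D.
  rewrite (_ : D = [set: borel X] `&` U @^-1` [set +oo%E]); last by rewrite setTI.
  by apply: mU => //; exact: emeasurable_set1.
apply: ae_eq_integral => //.
- have -> : (fun x : borel X => expeR (- U x)) =
      (fun x : borel X => (rho x * \1_(~` D) x)%:E).
    apply/funext => x; rewrite indicE /rho /V.
    have := U_proper.1 x; case Ux : (U x) => [u| |//] _ /=.
      by rewrite mem_set ?mulr1// /D/= Ux.
    by rewrite memNset ?mulr0//; apply; rewrite /D/= Ux.
  apply/measurable_EFinP; apply: measurable_funTS; apply: measurable_funM => //.
  by apply: measurable_indic; exact: measurableC.
- by apply/measurable_EFinP; exact: measurable_funTS.
- by apply: filterS ae_finite => x Ux _; rewrite Ux.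
Qed.

Lemma weighted_measure_finite : nu.-integrable [set: borel X] (EFin \o (fun=> 1 : R)).
Proof.
apply/(integrable_density mrho rho0 weight_density) => //.
have := sqint_mul (bcont_sqint mu1 (bcont_cst (1 : R))) weight_sqint.
exact.
Qed.

(** [f ^+ 2] and [rho] are both in L^2(mu), so their product is integrable. *)
Lemma sqint_density (f : borel X -> R) : measurable_fun [set: borel X] f ->
  sqint mu (fun x => f x ^+ 2) -> sqint nu f.
Proof.
move=> mf sf; split=> //.
apply/(integrable_density mrho rho0 weight_density); first exact: measurable_funX.
exact: (sqint_mul sf weight_sqint).
Qed.

Lemma potential_gradient_measurable : measurable_fun [set: borel X] (F : borel X -> borel H).
Proof. by have [_ []] := hU_W (lexx 1). Qed.

Lemma potential_gradient_sqint : sqint nu (fun x => `|F x|).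
Proof.
have mF := measurable_norm_field potential_gradient_measurable.
(* The exponent 4 makes the squared norm of the gradient an element of L^2(mu), as [sqint_density]
   demands. *)
have one4 : 1 <= (4 : R) by rewrite ler1n.
apply: sqint_density => //; split; first exact: measurable_funX.
have [_ [_ NF] _] := hU_W one4.
have /(Lnorm_nat_lty mu 3 mF) := NF.
by congr (_.-integrable _ (EFin \o _)); apply/funext => x; rewrite normr_id -exprM.
Qed.

Lemma dual_sqint_weighted (y : dual X) : sqint nu (y : borel X -> R).
Proof. by apply: sqint_density; [exact: dual_measurable|exact: sqint_sqr_dual]. Qed.

Variable C : dual X -> X.
Hypothesis hC : covariance_operator mu C.

Lemma weighted_measure_ibp (y : dual X) h (c : cylinder X) : i h = C y -> Cb 1 (cyl_phi c) ->
  \int[nu]_(x in [set: borel X]) ((y x : R) * cyl_fun c x) =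
  \int[nu]_(x in [set: borel X]) (ip (D_H istar c x) h - cyl_fun c x * ip (F x) h).
Proof.
move=> ih hc; have mw := measurable_bcont (cyl_fun_bcont hc).
rewrite !(Rintegral_density mrho rho0 weight_density).
- by have [] := weighted_ibp hH hmu hC potential_grad2 ih weight_sqint hc.
- apply: measurable_funB; first exact: (measurable_bcont (D_H_ip_bcont hH h hc)).
  apply: measurable_funM => //.
  exact: (measurable_ip hH potential_gradient_measurable).
- by apply: measurable_funM => //; exact: dual_measurable.
Qed.

End Potential.

Theorem proposition3p3 (R : realType) (X : completeNormedModType R)
  (hX : exists2 S : set X, countable S & dense S)
  (* (1) *)
  (Q : {linear dual X -> X})
  (hQ_bounded : dual_bounded Q)
  (hQ_sym : forall xs ys : dual X, ys (Q xs) = xs (Q ys))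
  (hQ_ge0 : forall xs : dual X, 0 <= xs (Q xs))
  (S : R -> {linear X -> X}) (DA : set X) (A : X -> X)
  (hS : contraction_semigroup S)
  (hA : is_generator S DA A)
  (* (2) *)
  (Qt : R -> dual X -> X)
  (hQt : forall t, 0 < t -> forall xs,
     is_weak_integral 0 t (fun s => S s (Q (adj setT (S s) xs))) (Qt t xs))
  (hQt_gaussian : forall t, 0 < t -> exists2 gamma : probability (borel X) R,
     centred_gaussian gamma & covariance_operator gamma (Qt t))
  (Qinf : dual X -> X)
  (hQinf : forall xs ys : dual X, ys (Qt t xs) @[t --> +oo] --> ys (Qinf xs))
  (muinf : probability (borel X) R)
  (hmuinf : centred_gaussian muinf)
  (hmuinf_cov : covariance_operator muinf Qinf)
  (hmuinf_nondeg : nondegenerate_covariance Qinf)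
  (H : completeNormedModType R) (ip : {dot H for idfun})
  (i : {linear H -> X}) (istar : dual X -> H)
  (hH : is_RKHS Q ip i istar)
  (* (3) *)
  (hQinfA : exists2 c : R, 0 < c & forall xs, adj_dom DA A xs ->
     exists2 h : H, i h = Qinf (adj DA A xs) & `|h| <= c * `|istar xs|)
  (B : {linear H -> H}) (hB_cont : continuous B)
  (hB : forall xs, adj_dom DA A xs -> i (B (istar xs)) = Qinf (adj DA A xs))
  (* (4) *)
  (U : X -> \bar R)
  (hU_proper : proper_fun U)
  (hU_lsc : lower_semicontinuous U)
  (hU_convex : econvex U)
  (D_HU : X -> H)
  (hU_W : forall p : R, 1 <= p -> W1p_grad istar muinf p U D_HU)
  (nuinf : {measure set (borel X) -> \bar R})
  (hnuinf : forall V : set (borel X), measurable V ->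
     nuinf V = (\int[muinf]_(x in V) expeR (- U x))%E) :
  FCb_adj 2 DA A `<=` L2_dom ip istar B nuinf /\
  forall c : cylinder X, Cb 2 (cyl_phi c) -> cyl_in_adj_dom DA A c ->
  forall L2u : X -> R, L2_graph ip istar B nuinf (cyl_fun c) L2u ->
  {ae nuinf, forall x : borel X,
     L2u x = 2^-1 * trace ip (D2_H ip istar c x) + adj_D DA A c x x
             + ip (B (D_H istar c x)) (D_HU x)}.
Proof.
have hQinf_sym (xs ys : dual X) : (ys (Qinf xs) : R) = xs (Qinf ys).
  exact: (covariance_sym hmuinf_cov).
have skew := B_skew hH hS hA hQ_bounded hQ_sym hQt hQinf hQinf_sym hB_cont hB.
have den := istar_adj_dom_dense hH hS hA.
have nu1 := weighted_measure_finite hmuinf hU_proper hU_lsc hU_convex hU_W hnuinf.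
have mF := potential_gradient_measurable hU_W.
have sF := potential_gradient_sqint hmuinf hU_proper hU_lsc hU_convex hU_W hnuinf.
have sdual := dual_sqint_weighted hmuinf hU_proper hU_lsc hU_convex hU_W hnuinf.
have nu_ibp := weighted_measure_ibp hH hmuinf hU_proper hU_lsc hU_convex hU_W hnuinf hmuinf_cov.
split.
  move=> _ [c [hc cA ->]]; exists (generator_fun ip istar DA A B D_HU c).
  exact: (generator_in_dom hX hH hB skew nu1 mF sF sdual nu_ibp hc cA).
move=> c hc cA L2u hL.
exact: (L2_graph_unique hX hH hB_cont hB skew den nu1 mF sF sdual nu_ibp hc cA hL).
Qed.
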